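(* Let $M$ be an orientable smooth manifold of dimension $2n+1$ and put $W=M\times\mathbb{R}$. The following assertions are equivalent: (1) the gauge equation of dual connections on $M$ admits a skew-symmetric solution $\theta$ with $\operatorname{rank}\theta=2n$; (2) $M$ admits an almost cosymplectic structure (equivalently, an almost contact structure); (3) $W$ admits an almost symplectic structure; (4) the gauge equation of dual connections on $W$ admits a skew-symmetric solution $\theta$ with $\operatorname{rank}\theta=2n+2$.
   Context: Given a Riemannian metric $g$ and an affine connection $\nabla$ (torsion allowed) on a manifold $N$, the dual connection $\nabla^*$ is defined by $Z(g(X,Y))=g(\nabla_Z X,Y)+g(X,\nabla^*_Z Y)$. ''The gauge equation of dual connections on $N$ admits a skew-symmetric solution $\theta$ with $\operatorname{rank}\theta=r$'' means: there exist a Riemannian metric $g$ on $N$, an affine connection $\nabla$ with $g$-dual $\nabla^*$, and a $(1,1)$-tensor field $\theta$ on $N$ of rank $r$ at every point with $g(\theta X,Y)=-g(X,\theta Y)$ and $\nabla^*_X(\theta Y)=\theta(\nabla_X Y)$ for all vector fields $X,Y$. An almost cosymplectic structure on a $(2n+1)$-manifold is a pair $(\omega,\eta)$ of a 2-form and a 1-form with $\omega^n\wedge\eta$ nowhere vanishing. An almost contact structure is a triple $(\phi,\xi,\eta)$ ($(1,1)$-tensor field, vector field, 1-form) with $\eta(\xi)=1$ and $\phi^2=-\mathrm{Id}+\eta\otimes\xi$. An almost symplectic structure is a (not necessarily closed) non-degenerate 2-form. *)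

(* Defs.v *)
From HB Require Import structures.
From mathcomp Require Import all_boot all_order all_algebra all_fingroup.
From mathcomp Require Import all_classical all_reals all_analysis.
Set Implicit Arguments.
Unset Strict Implicit.
Unset Printing Implicit Defensive.
Import Order.TTheory GRing.Theory Num.Theory.
Import numFieldNormedType.Exports.
Local Open Scope classical_set_scope.
Local Open Scope ring_scope.

Fixpoint Ck (R : realType) (m k : nat) (A : set 'rV[R]_m) (f : 'rV[R]_m -> R)
    : Prop :=
  if k is k'.+1 then
    forall i : 'I_m, (forall x, A x -> derivable f x (delta_mx 0 i)) /\
                     Ck k' A ('D_(delta_mx 0 i) f)
  else forall x, A x -> {for x, continuous f}.

(* C^oo, for an open A; only the values of f on A matter. *)
Definition smooth_on (R : realType) (m : nat) (A : set 'rV[R]_m)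
  (f : 'rV[R]_m -> R) : Prop := forall k, Ck k A f.

(* The values of [cmap] off [cdom] and of [cinv] off the open set
   [cmap @` cdom] are irrelevant. *)
Record chart (R : realType) (m : nat) (T : topologicalType) := Chart {
  cdom : set T;
  cmap : T -> 'rV[R]_m;
  cinv : 'rV[R]_m -> T;
  cdom_open : open cdom;
  cimg_open : open (cmap @` cdom);
  cmapK : forall p, cdom p -> cinv (cmap p) = p;
  cmap_continuous : forall p, cdom p -> {for p, continuous cmap};
  cinv_continuous : forall x, (cmap @` cdom) x -> {for x, continuous cinv}
}.

Definition cimg (R : realType) (m : nat) (T : topologicalType)
  (c : chart R m T) : set 'rV[R]_m := cmap c @` cdom c.

Definition smooth_transition (R : realType) (m : nat) (T : topologicalType)
    (c d : chart R m T) : Prop :=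
  forall j, smooth_on (cmap c @` (cdom c `&` cdom d))
                      (fun x => cmap d (cinv c x) 0 j).

(* Smooth manifold without boundary; the atlas need not be maximal. The
   preferred chart [chart_at p] serves to represent tangent vectors at p. *)
Record manifold (R : realType) (m : nat) := Manifold {
  mspace :> topologicalType;
  atlas : set (chart R m mspace);
  chart_at : mspace -> chart R m mspace;
  chart_at_atlas : forall p, atlas (chart_at p);
  chart_at_dom : forall p, cdom (chart_at p) p;
  atlas_smooth : forall c d, atlas c -> atlas d -> smooth_transition c d;
  mspace_hausdorff : hausdorff_space mspace;
  mspace_second_countable : @second_countable mspace
}.

Section ProductWithLine.
Context {R : realType} {m : nat}.

Lemma mx_continuous_at (T : topologicalType) r s (f : T -> 'M[R]_(r, s)) p :
  (forall i j, {for p, continuous (fun q => f q i j)}) ->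
  {for p, continuous f}.
Proof.
move=> h A [P P_nbhs sPA]; rewrite nbhs_filterE.
apply: (@filterS _ _ _ [set q | forall i j, P i j (f q i j)]).
  by move=> q Pq; apply: sPA.
by apply: filter_forall => i; apply: filter_forall => j; exact: h.
Qed.

Lemma lsubmx_continuous : continuous (@lsubmx R 1 m 1).
Proof.
move=> x; apply: mx_continuous_at => i j.
rewrite (_ : (fun q => _) = fun q : 'rV_(m + 1) => q i (lshift 1 j)).
  exact: coord_continuous.
by apply/funext => q; rewrite mxE.
Qed.

Lemma rsubmx0_continuous :
  continuous (fun x : 'rV[R]_(m + 1) => rsubmx x 0 0).
Proof.
move=> x; rewrite (_ : (fun q => _) = fun q : 'rV_(m + 1) => q 0 (rshift m 0)).
  exact: coord_continuous.
by apply/funext => q; rewrite mxE.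
Qed.

Lemma Ck_subset n k (A B : set 'rV[R]_n) f : A `<=` B -> Ck k B f -> Ck k A f.
Proof.
move=> AB; elim: k f => [|k ih] f /=; first by move=> h x /AB; exact: h.
move=> h i; have [h1 h2] := h i; split; last exact: ih.
by move=> x /AB; exact: h1.
Qed.

Lemma Ck_cst n k (A : set 'rV[R]_n) (a : R) : Ck k A (cst a).
Proof.
elim: k a => [|k ih] a /=; first by move=> x _; exact: cst_continuous.
move=> i; split; first by move=> x _; exact: derivable_cst.
rewrite (_ : 'D__ _ = cst 0); first exact: ih.
by apply/funext => x; rewrite derive_cst.
Qed.

Lemma quotient_lsub (f : 'rV[R]_m -> R) (x v : 'rV[R]_(m + 1)) :
  (fun h : R => h^-1 *: (((f \o lsubmx) \o shift x) (h *: v) - (f \o lsubmx) x))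
  = (fun h => h^-1 *: ((f \o shift (lsubmx x)) (h *: lsubmx v) - f (lsubmx x))).
Proof.
apply/funext => h /=; congr (_ *: (f _ - _)).
by apply/matrixP => i j; rewrite !mxE.
Qed.

Lemma Ck_lsub k (A : set 'rV[R]_m) (f : 'rV[R]_m -> R) :
  Ck k A f -> Ck k (@lsubmx R 1 m 1 @^-1` A) (f \o lsubmx).
Proof.
elim: k f => [|k ih] f /=.
  move=> h x Ax; apply: continuous_comp; first exact: lsubmx_continuous.
  exact: h.
have Dl (v : 'rV[R]_(m + 1)) : 'D_v (f \o lsubmx) = 'D_(lsubmx v) f \o lsubmx.
  by apply/funext => x; rewrite /derive /= quotient_lsub.
have dl (x v : 'rV[R]_(m + 1)) :
    derivable f (lsubmx x) (lsubmx v) -> derivable (f \o lsubmx) x v.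
  by rewrite /derivable quotient_lsub.
move=> h i; rewrite Dl; case: (split_ordP i) => j ->.
  have -> : lsubmx (delta_mx 0 (lshift 1 j)) = delta_mx 0 j :> 'rV[R]_m.
    by apply/matrixP => a b; rewrite !mxE (inj_eq (@lshift_inj _ _)).
  have [h1 h2] := h j; split; last exact: ih.
  move=> x Ax; apply: dl.
  rewrite [X in derivable _ _ X](_ : _ = delta_mx 0 j); first exact: h1.
  by apply/matrixP => a b; rewrite !mxE (inj_eq (@lshift_inj _ _)).
have -> : lsubmx (delta_mx 0 (rshift m j)) = 0 :> 'rV[R]_m.
  by apply/matrixP => a b; rewrite !mxE eq_lrshift andbF.
split.
  move=> x Ax; apply: dl.
  rewrite [X in derivable _ _ X](_ : _ = 0); first exact: derivable0.
  by apply/matrixP => a b; rewrite !mxE eq_lrshift andbF.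
rewrite (_ : _ \o _ = cst 0); first exact: Ck_cst.
by apply/funext => x /=; rewrite derive0.
Qed.

Lemma Ck_coord n k (A : set 'rV[R]_n) j : Ck k A (fun x => x 0 j).
Proof.
case: k => [|k] /=; first by move=> x _; exact: coord_continuous.
have q (v x : 'rV[R]_n) :
    \forall h \near 0^', h^-1 *: (((fun x => x 0 j) \o shift x) (h *: v) - x 0 j)
                         = v 0 j :> R.
  near=> h; rewrite /= !mxE addrK.
  rewrite /GRing.scale /= mulKf //; near: h; exact: nbhs_dnbhs_neq.
move=> i; pose v : 'rV[R]_n := delta_mx 0 i.
split; first by move=> x _; exact: (is_cvg_near_cst (v 0 j) (q v x)).
rewrite (_ : derive _ ^~ _ = cst (v 0 j)); first exact: Ck_cst.
by apply/funext => x; exact: (lim_near_cst _ (q v x)).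
Unshelve. all: by end_near. Qed.

Variable T : topologicalType.

Section LineChart.
Variable c : chart R m T.

Let ldom : set (T * R) := fst @^-1` cdom c.
Let lmap (q : T * R) : 'rV[R]_(m + 1) := row_mx (cmap c q.1) q.2%:M.
Let linv (x : 'rV[R]_(m + 1)) : T * R := (cinv c (lsubmx x), rsubmx x 0 0).

Let lmap_img : lmap @` ldom = lsubmx @^-1` cimg c.
Proof.
rewrite eqEsubset; split=> [_ [q cq <-]|x [p cp px]] /=.
  by rewrite /lmap row_mxKl; exists q.1.
exists (p, rsubmx x 0 0) => //=.
by rewrite /lmap /= px -mx11_scalar hsubmxK.
Qed.

Let ldom_open : open ldom.
Proof.
by apply: open_comp; [move=> q _; exact: cvg_fst | exact: cdom_open].
Qed.

Let limg_open : open (lmap @` ldom).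
Proof.
by rewrite lmap_img; apply: open_comp;
  [move=> x _; exact: lsubmx_continuous | exact: cimg_open].
Qed.

Let lmapK q : ldom q -> linv (lmap q) = q.
Proof.
case: q => p t cp; rewrite /linv /lmap row_mxKl row_mxKr cmapK //.
by rewrite mxE eqxx mulr1n.
Qed.

Let lmap_continuous q : ldom q -> {for q, continuous lmap}.
Proof.
move=> cq; apply: mx_continuous_at => i j; rewrite ord1.
case: (split_ordP j) => k ->.
  rewrite (_ : (fun _ => _) = fun q : T * R => cmap c q.1 0 k).
    apply: (@continuous_comp _ _ _ fst (fun p => cmap c p 0 k)).
      exact: cvg_fst.
    apply: (@continuous_comp _ _ _ (cmap c) (fun x => x 0 k)).
      exact: cmap_continuous.
    exact: coord_continuous.
  by apply/funext => s; rewrite /lmap row_mxEl.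
rewrite (_ : (fun _ => _) = snd); first exact: cvg_snd.
by apply/funext => s; rewrite /lmap row_mxEr mxE ord1 eqxx mulr1n.
Qed.

Let linv_continuous x : (lmap @` ldom) x -> {for x, continuous linv}.
Proof.
rewrite lmap_img => cx.
have h1 : {for x, continuous (cinv c \o @lsubmx R 1 m 1)}.
  apply: continuous_comp; first exact: lsubmx_continuous.
  exact: cinv_continuous.
exact: (cvg_pair h1 (@rsubmx0_continuous x)).
Qed.

Definition line_chart : chart R (m + 1) (T * R)%type :=
  Chart ldom_open limg_open lmapK lmap_continuous linv_continuous.

End LineChart.

Lemma line_smooth_transition (c d : chart R m T) :
  smooth_transition c d -> smooth_transition (line_chart c) (line_chart d).
Proof.
move=> cd j k; case: (split_ordP j) => i -> /=.
  rewrite (_ : (fun _ => _) = (fun x => cmap d (cinv c x) 0 i) \o lsubmx).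
    apply: (Ck_subset _ (Ck_lsub (cd i k))).
    by move=> _ [q [cq dq] <-] /=; rewrite row_mxKl; exists q.1.
  by apply/funext => x; rewrite row_mxEl.
rewrite (_ : (fun _ => _) = fun x : 'rV[R]_(m + 1) => x 0 (rshift m i)).
  exact: Ck_coord.
by apply/funext => x; rewrite row_mxEr !mxE ord1 eqxx mulr1n.
Qed.

Lemma prod_line_hausdorff : hausdorff_space T -> hausdorff_space (T * R)%type.
Proof.
move=> hT [p s] [q t] clpq.
have fstc (z : T * R) : {for z, continuous fst} by exact: cvg_fst.
have sndc (z : T * R) : {for z, continuous snd} by exact: cvg_snd.
congr (_, _).
  apply: hT => A B pA qB.
  by have [[x y] [/= xA xB]] := clpq _ _ (fstc (p, s) A pA) (fstc (q, t) B qB);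
    exists x.
apply: (@Rhausdorff R) => A B pA qB.
by have [[x y] [/= xA xB]] := clpq _ _ (sndc (p, s) A pA) (sndc (q, t) B qB);
  exists y.
Qed.

Lemma prod_line_second_countable :
  @second_countable T -> @second_countable (T * R)%type.
Proof.
move=> [B Bcount [Bopen Bbasis]].
pose F (u : set T * (rat * rat)) : set (T * R) :=
  u.1 `*` `]ratr u.2.1, ratr u.2.2[%classic.
exists (F @` (B `*` [set: rat * rat])).
  apply: sub_countable (card_image_le _ _) _.
  by apply: countableX => //; exact: countableP.
split=> [_ [[U [a b]] [BU _] <-]|[p t] A [[U V] [/= pU tV] UVA]].
  rewrite (_ : F _ = fst @^-1` U `&` snd @^-1` `]ratr a, ratr b[%classic) //.
  apply: openI; apply: open_comp.
  - by move=> q _; exact: cvg_fst.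
  - exact: Bopen.
  - by move=> q _; exact: cvg_snd.
  - exact: interval_open.
have [W [BW Wp] WU] := Bbasis p U pU.
have [e e0 eV] : exists2 e : R, 0 < e & ball t e `<=` V by exact/nbhs_ballP.
have [a] : exists q : rat, ratr q \in `]t - e, t[.
  by apply: rat_in_itvoo; rewrite ltrBlDr ltrDl.
have [b] : exists q : rat, ratr q \in `]t, t + e[.
  by apply: rat_in_itvoo; rewrite ltrDl.
rewrite !in_itv /= => /andP[tb be] /andP[ea at_].
exists (F (W, (a, b))).
  by split; [exists (W, (a, b)) | split; rewrite //= in_itv /= at_ tb].
move=> [x y] [/= Wx]; rewrite in_itv /= => /andP[ay yb].
apply: UVA; split; first exact: WU.
apply: eV; rewrite /ball /= ltr_distlC.
by rewrite (lt_trans ea ay) (lt_trans yb be).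
Qed.

End ProductWithLine.

(* M x R, with the charts (p, t) |-> (cmap c p, t). *)
Definition product_line (R : realType) (m : nat) (M : manifold R m) :
    manifold R (m + 1).
Proof.
apply: (@Manifold R (m + 1) (M * R)%type (@line_chart R m M @` @atlas R m M)
          (fun q => line_chart (chart_at q.1))).
- by move=> q; exists (chart_at q.1) => //; exact: chart_at_atlas.
- by move=> q; exact: chart_at_dom.
- by move=> _ _ [c ac <-] [d ad <-]; exact/line_smooth_transition/atlas_smooth.
- exact/prod_line_hausdorff/mspace_hausdorff.
- exact/prod_line_second_countable/mspace_second_countable.
Defined.

(* Row vectors of components: u in the chart c becomes u *m jac c d p in d. *)
Definition jac (R : realType) (m : nat) (T : topologicalType)
  (c d : chart R m T) (p : T) : 'M[R]_m := 'J (cmap d \o cinv c) (cmap c p).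

(* There is a cover by charts of the smooth structure (not necessarily in the
   given atlas) with orientation preserving transitions; for m > 0. *)
Definition orientable (R : realType) (m : nat) (M : manifold R m) : Prop :=
  exists B : set (chart R m M),
    [/\ forall p, exists2 c, B c & cdom c p,
        forall c d, B c -> atlas d ->
          smooth_transition c d /\ smooth_transition d c &
        forall c d p, B c -> B d -> cdom c p -> cdom d p ->
          0 < \det (jac c d p)].

(* T_p M is 'rV[R]_m: a row vector stands for the tangent vector with these
   components in [chart_at p]. A covector is a column vector, an endomorphism of
   T_p M is a matrix acting on the right, a bilinear form is its Gram matrix.
   A tensor field is smooth when its components in every chart of the atlas,
   obtained by the usual transformation rules, are smooth. *)
Section TensorFields.
Context {R : realType} {m : nat} (M : manifold R m).

Definition smooth_function (f : M -> R) : Prop :=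
  forall c, atlas c -> smooth_on (cimg c) (f \o cinv c).

(* [F c p] holds the components at p in the chart c. *)
Definition smooth_components r s (F : chart R m M -> M -> 'M[R]_(r, s)) :
    Prop :=
  forall c, atlas c ->
    forall i j, smooth_on (cimg c) (fun x => F c (cinv c x) i j).

Definition vector_field (X : M -> 'rV[R]_m) : Prop :=
  smooth_components (fun c p => X p *m jac (chart_at p) c p).

Definition one_form (eta : M -> 'cV[R]_m) : Prop :=
  smooth_components (fun c p => jac c (chart_at p) p *m eta p).

Definition bilinear_field (B : M -> 'M[R]_m) : Prop :=
  smooth_components (fun c p =>
    jac c (chart_at p) p *m B p *m (jac c (chart_at p) p)^T).

Definition endomorphism_field (theta : M -> 'M[R]_m) : Prop :=
  smooth_components (fun c p =>
    jac c (chart_at p) p *m theta p *m jac (chart_at p) c p).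

Definition form2 (B : 'M[R]_m) (u v : 'rV[R]_m) : R := (u *m B *m v^T) 0 0.

Definition form1 (eta : 'cV[R]_m) (u : 'rV[R]_m) : R := (u *m eta) 0 0.

Definition two_form (omega : M -> 'M[R]_m) : Prop :=
  bilinear_field omega /\
  forall p u v, form2 (omega p) u v = - form2 (omega p) v u.

Definition riemannian_metric (g : M -> 'M[R]_m) : Prop :=
  [/\ bilinear_field g,
      forall p u v, form2 (g p) u v = form2 (g p) v u &
      forall p u, u != 0 -> 0 < form2 (g p) u u].

(* Z f *)
Definition directional_derivative (Z : M -> 'rV[R]_m) (f : M -> R) (p : M) :
    R :=
  'D_(Z p) (f \o cinv (chart_at p)) (cmap (chart_at p) p).

(* [nabla X Y] is the covariant derivative of Y along X; its values on fields
   that are not smooth are irrelevant. *)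
Definition field_operator : Type :=
  (M -> 'rV[R]_m) -> (M -> 'rV[R]_m) -> M -> 'rV[R]_m.

Record affine_connection (nabla : field_operator) : Prop := {
  connection_field : forall X Y, vector_field X -> vector_field Y ->
    vector_field (nabla X Y);
  connection_addl : forall X X' Y,
    vector_field X -> vector_field X' -> vector_field Y ->
    forall p, nabla (fun q => X q + X' q) Y p = nabla X Y p + nabla X' Y p;
  connection_scalel : forall f X Y,
    smooth_function f -> vector_field X -> vector_field Y ->
    forall p, nabla (fun q => f q *: X q) Y p = f p *: nabla X Y p;
  connection_addr : forall X Y Y',
    vector_field X -> vector_field Y -> vector_field Y' ->
    forall p, nabla X (fun q => Y q + Y' q) p = nabla X Y p + nabla X Y' p;
  connection_leibniz : forall f X Y,
    smooth_function f -> vector_field X -> vector_field Y ->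
    forall p, nabla X (fun q => f q *: Y q) p =
              directional_derivative X f p *: Y p + f p *: nabla X Y p
}.

Definition dual_connection (g : M -> 'M[R]_m) (nabla nabla' : field_operator) :
    Prop :=
  forall X Y Z, vector_field X -> vector_field Y -> vector_field Z ->
  forall p, directional_derivative Z (fun q => form2 (g q) (X q) (Y q)) p =
            form2 (g p) (nabla Z X p) (Y p) + form2 (g p) (X p) (nabla' Z Y p).

Definition skew_symmetric (g theta : M -> 'M[R]_m) : Prop :=
  forall X Y, vector_field X -> vector_field Y ->
  forall p, form2 (g p) (X p *m theta p) (Y p) =
            - form2 (g p) (X p) (Y p *m theta p).

Definition gauge_equation (nabla nabla' : field_operator)
    (theta : M -> 'M[R]_m) : Prop :=
  forall X Y, vector_field X -> vector_field Y ->
  forall p, nabla' X (fun q => Y q *m theta q) p = nabla X Y p *m theta p.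

Definition has_skew_gauge_solution (r : nat) : Prop :=
  exists (g : M -> 'M[R]_m) (nabla nabla' : field_operator)
         (theta : M -> 'M[R]_m),
    [/\ riemannian_metric g,
        affine_connection nabla,
        affine_connection nabla' /\ dual_connection g nabla nabla',
        endomorphism_field theta /\ (forall p, \rank (theta p) = r) &
        skew_symmetric g theta /\ gauge_equation nabla nabla' theta].

Definition has_almost_symplectic : Prop :=
  exists omega : M -> 'M[R]_m, two_form omega /\
    forall p u, (forall v, form2 (omega p) u v = 0) -> u = 0.

End TensorFields.

Section Wedge.
Context {R : realType} {m : nat}.

(* A k-form on 'rV[R]_m takes its k arguments as the rows of a matrix. *)
Definition form (k : nat) : Type := 'M[R]_(k, m) -> R.

(* (a /\ b) = 1 / (k! l!) * sum over s in S_(k+l) of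
   sgn(s) a(v_s(1), .., v_s(k)) b(v_s(k+1), .., v_s(k+l)). *)
Definition wedge (k l : nat) (a : form k) (b : form l) : form (k + l) :=
  fun v => (k`! * l`!)%:R^-1 *
    \sum_(s : 'S_(k + l))
      (-1) ^+ s * a (usubmx (row_perm s v)) * b (dsubmx (row_perm s v)).

Fixpoint wedge_exp (a : form 2) (n : nat) : form (n * 2) :=
  match n with
  | 0 => fun=> 1
  | n'.+1 => wedge a (@wedge_exp a n')
  end.

Definition form_of_two (B : 'M[R]_m) : form 2 :=
  fun v => form2 B (row 0 v) (row 1 v).

Definition form_of_one (eta : 'cV[R]_m) : form 1 :=
  fun v => form1 eta (row 0 v).

End Wedge.
Arguments wedge_exp {R m} a n _.

Section AlmostContact.
Context {R : realType} {n : nat} (M : manifold R (2 * n + 1)).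

Definition has_almost_cosymplectic : Prop :=
  exists (omega : M -> 'M[R]_(2 * n + 1)) (eta : M -> 'cV[R]_(2 * n + 1)),
    [/\ two_form omega, one_form eta &
        forall p, exists v,
          wedge (wedge_exp (form_of_two (omega p)) n)
                (form_of_one (eta p)) v != 0].

Definition has_almost_contact : Prop :=
  exists (phi : M -> 'M[R]_(2 * n + 1)) (xi : M -> 'rV[R]_(2 * n + 1))
         (eta : M -> 'cV[R]_(2 * n + 1)),
    [/\ endomorphism_field phi, vector_field xi, one_form eta,
        forall p, form1 (eta p) (xi p) = 1 &
        forall p u, u *m phi p *m phi p = - u + form1 (eta p) u *: xi p].

End AlmostContact.

(* Main.v *)
Require Import Defs.
From HB Require Import structures.
From mathcomp Require Import all_boot all_order all_algebra all_fingroup.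
From mathcomp Require Import complex.
From mathcomp Require Import all_classical all_reals all_analysis.
From mathcomp Require Import ring lra zify.
Set Implicit Arguments.
Unset Strict Implicit.
Unset Printing Implicit Defensive.
Import Order.TTheory GRing.Theory Num.Theory.
Import numFieldNormedType.Exports.
Local Open Scope classical_set_scope.
Local Open Scope ring_scope.

(** In the splitting given by the projections BN and NB, a skew T has an image-image block, two
    mixed blocks and a kernel-kernel block. The equation C B + B C^T = T reaches all of them but the
    last, and differentiating B = B N B shows that d_k B has no such block; the smoothness of N is
    how constant rank enters. The factor 1/2 appears because both C B and B C^T produce the
    image-image block. Being affine in the connection, the equation survives gluing with weights of
    sum one.

    For the almost contact structure, an auxiliary metric is first replaced by one in which xi is
    the unit normal of ker h. The polar factor is then taken through the geometric mean of two
    forms, because the mean commutes with changes of basis and so is a tensor, while a matrix square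
    root is not.

    The wedge product is a sum over permutations, so its nonvanishing is checked on a symplectic
    basis, where every term is nonnegative and the identity term is positive. *)

(* A skew endomorphism theta of (M, g) corresponds to the 2-form B = theta g, and
   the gauge equation says that B is parallel from nabla to nabla. A 2-form B of
   constant rank is always parallel for some connection: in a chart, with N a skew
   generalized inverse of B, the coefficients
   C_k = (1 - BN/2) (d_k B) N B N satisfy C_k B + B C_k^T = d_k B, and such
   connections are glued by a partition of unity; theta = B g^-1 then solves the
   gauge equation. So gauge solutions exist as soon as B and a smooth N do.

   Over a point, (B, h) is almost cosymplectic exactly when the bordered matrix
   [[B, h], [-h^T, 0]] is invertible, and the blocks of its inverse provide both N
   and the Reeb vector xi with xi B = 0, xi h = 1. This matrix is also the Gram
   matrix of a 2-form on M x R, which gives (3) from (2'), and (1) from (4) by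
   restriction to t = 0.

   For (1) => (2), B^n /\ h = h(v) vol for a vector v spanning the kernel of B, which
   depends on the volume form vol; an orientation fixes its sign.
   For (2) => (2'), phi is the orthogonal part in a polar decomposition of omega,
   smooth because the square root of positive definite matrices is. *)

(** * Calculus on open sets of coordinate space *)

Section Differentiability.
Context {R : realType}.

Lemma mvt_abs (phi : R -> R) (s : R) :
  (forall t, `|t| <= `|s| -> derivable phi t 1) ->
  exists2 t, `|t| <= `|s| & phi s - phi 0 = 'D_1 phi t * s.
Proof.
move=> dphi.
have cphi t : `|t| <= `|s| -> {for t, continuous phi}.
  by move=> /dphi /derivable1_diffP; exact: differentiable_continuous.
have [s0|s0|<-] := ltgtP 0 s.
- have cw : {within `[0, s], continuous phi}.
    apply: derivable_within_continuous => t; rewrite in_itv/= => /andP[t0 ts].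
    by apply: dphi; rewrite !ger0_norm // ltW.
  have [|c] := @MVT_segment _ phi ('D_1 phi) _ _ (ltW s0) _ cw.
    move=> t; rewrite in_itv/= => /andP[t0 ts].
    by apply/derivableP/dphi; rewrite !ger0_norm // ltW.
  rewrite in_itv/= => /andP[c0 cs] ->; exists c; last by rewrite subr0.
  by rewrite !ger0_norm // ltW.
- have cw : {within `[s, 0], continuous phi}.
    apply: derivable_within_continuous => t; rewrite in_itv/= => /andP[t0 ts].
    by apply: dphi; rewrite !ler0_norm ?lerN2 // ltW.
  have [|c] := @MVT_segment _ phi ('D_1 phi) _ _ (ltW s0) _ cw.
    move=> t; rewrite in_itv/= => /andP[t0 ts].
    by apply/derivableP/dphi; rewrite !ler0_norm ?lerN2 // ltW.
  rewrite in_itv/= => /andP[c0 cs] /(congr1 -%R); rewrite opprB => ->; exists c.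
    by rewrite !ler0_norm ?lerN2 // ltW.
  by rewrite sub0r mulrN opprK.
- by exists 0 => //; rewrite subrr mulr0.
Qed.

Lemma derive_line m (f : 'rV[R]_m -> R) (y v : 'rV[R]_m) (t : R) :
  (derivable (fun s : R => f (y + s *: v)) t 1 <-> derivable f (y + t *: v) v) /\
  'D_1 (fun s : R => f (y + s *: v)) t = 'D_v f (y + t *: v).
Proof.
have e : (fun h : R => h^-1 *: (((fun s : R => f (y + s *: v)) \o shift t) (h *: 1)
           - f (y + t *: v))) =
         (fun h => h^-1 *: ((f \o shift (y + t *: v)) (h *: v) - f (y + t *: v))).
  apply/funext => h /=; congr (_ *: (f _ - _)).
  have -> : h *: (1 : R) = h by rewrite [LHS]mulr1.
  by rewrite scalerDl addrCA.
by rewrite /derivable /derive e.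
Qed.

Lemma continuous_sumr (T : topologicalType) (I : Type) (r : seq I) (P : pred I)
    (F : I -> T -> R) (x : T) :
  (forall i, P i -> {for x, continuous (F i)}) ->
  {for x, continuous (fun y => \sum_(i <- r | P i) F i y)}.
Proof.
move=> cF; elim: r => [|i r ih].
  rewrite (_ : (fun y => _) = cst 0); first exact: cst_continuous.
  by apply/funext => y; rewrite big_nil.
case: (boolP (P i)) => Pi; last first.
  rewrite (_ : (fun y => _) = fun y => \sum_(j <- r | P j) F j y) //.
  by apply/funext => y; rewrite big_cons (negbTE Pi).
rewrite (_ : (fun y => _) = fun y => F i y + \sum_(j <- r | P j) F j y).
  by apply: continuousD; [exact: cF|exact: ih].
by apply/funext => y; rewrite big_cons Pi.
Qed.

Definition lin_of m (a : 'cV[R]_m) (u : 'rV[R]_m) : R^o := (u *m a) 0 0.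

Fact lin_of_linear m (a : 'cV[R]_m) : linear (lin_of a).
Proof. by move=> k u w; rewrite /lin_of mulmxDl -scalemxAl !mxE. Qed.

HB.instance Definition _ m (a : 'cV[R]_m) :=
  GRing.isLinear.Build R 'rV[R]_m R^o _ (lin_of a) (lin_of_linear a).

Lemma lin_of_continuous m (a : 'cV[R]_m) : continuous (lin_of a).
Proof.
move=> x.
rewrite (_ : lin_of a = fun u => \sum_j u 0 j * a j 0); last first.
  by apply/funext => u; rewrite /lin_of mxE.
apply: continuous_sumr => j _; apply: continuousM; last exact: cst_continuous.
exact: coord_continuous.
Qed.

Lemma rV_norm_entry m (u : 'rV[R]_m) j : `|u 0 j| <= `|u|.
Proof.
rewrite [leRHS]/Num.Def.normr/= mx_normrE.
exact: (@le_bigmax _ _ _ _ (fun i : 'I_1 * 'I_m => `|u i.1 i.2|) (0, j)).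
Qed.

Lemma rV_norm_le m (u : 'rV[R]_m) (c : R) :
  0 <= c -> (forall j, `|u 0 j| <= c) -> `|u| <= c.
Proof.
move=> c0 uc; rewrite [leLHS]/Num.Def.normr/= mx_normrE bigmax_le //= => -[i j] _ /=.
by rewrite ord1.
Qed.

(** The differential is picked by choice, so an explicit candidate [df] has to be identified with it
    through [diff_unique]. *)
Lemma differentiable_intro (V W : normedModType R) (f : V -> W)
    (df : {linear V -> W}) x : continuous df ->
  (forall e : R, 0 < e ->
     \forall h \near (0 : V), `|f (h + x) - (f x + df h)| <= e * `|h|) ->
  differentiable f x.
Proof.
move=> cdf h.
have ex : f \o shift x = cst (f x) + df +o_ 0 id.
  by apply/eqaddoP => e e0; exact: h.
by apply/diff_locallyP; rewrite (diff_unique cdf ex).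
Qed.

(** Move from x to x + h one coordinate at a time and apply the mean value theorem on each leg;
    continuity of the partial derivatives bounds the error of every leg. *)
Lemma C1_differentiable m (A : set 'rV[R]_m) (f : 'rV[R]_m -> R) x :
  open A -> Ck 1 A f -> A x -> differentiable f x.
Proof.
move=> oA fA Ax.
pose a : 'cV[R]_m := \col_j 'D_(delta_mx 0 j) f x.
apply: (@differentiable_intro _ _ f (lin_of a) x (@lin_of_continuous m a)).
move=> _/posnumP[e].
(* There are m legs, each allowed an error d |h|; the successor keeps the denominator nonzero when m
   = 0. *)
pose d := e%:num / m.+1%:R.
have d0 : 0 < d by rewrite divr_gt0.
have nA : \forall y \near x, A y /\
    forall j, `|'D_(delta_mx 0 j) f y - 'D_(delta_mx 0 j) f x| < d.
  have nAx : \forall y \near x, A y by exact: open_nbhs_nbhs.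
  near=> y; split; first by near: y.
  near: y; apply: filter_forall => j.
  have [_ /(_ x Ax) cj] := fA j.
  move/cvgrPdist_lt : cj => /(_ d d0).
  by apply: filterS => y; rewrite distrC.
have [r /= r0 rA] := (nbhs_ballP _ _).1 nA.
apply/nbhs_ballP; exists r => //= h.
rewrite -ball_normE /= sub0r normrN => hr.
(* Corner number k of the path: the first k coordinates of h have been added. *)
pose z k : 'rV[R]_m := \row_j (if (j < k)%N then h 0 j else 0).
have hz : z m = h by apply/rowP => j; rewrite mxE ltn_ord.
have z0 : z 0 = 0 by apply/rowP => j; rewrite !mxE.
have nz k : `|z k| <= `|h|.
  apply: rV_norm_le => // j; rewrite mxE; case: ifP => _; last by rewrite normr0.
  exact: rV_norm_entry.
have step (k : 'I_m) : `|f (x + z k.+1) - f (x + z k) - h 0 k * a k 0| <= d * `|h|.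
  have pt (t : R) : `|t| <= `|h 0 k| -> `|z k + t *: delta_mx 0 k| <= `|h|.
    move=> th; apply: rV_norm_le => // j.
    rewrite !mxE eqxx /=; case: (eqVneq j k) => [->|jk].
      by rewrite ltnn add0r mulr1 (le_trans th) // rV_norm_entry.
    rewrite mulr0 addr0; case: ifP => _; first exact: rV_norm_entry.
    by rewrite normr0.
  have ptA (t : R) : `|t| <= `|h 0 k| ->
      A (x + z k + t *: delta_mx 0 k) /\
    forall j, `|'D_(delta_mx 0 j) f (x + z k + t *: delta_mx 0 k)
                - 'D_(delta_mx 0 j) f x| < d.
    move=> th; apply: rA; rewrite -ball_normE /= -addrA opprD addNKr normrN.
    by apply: le_lt_trans hr; exact: pt.
  have [|t th] := @mvt_abs (fun s : R => f (x + z k + s *: delta_mx 0 k)) (h 0 k).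
    move=> t th; apply/(derive_line _ _ _ _).1.
    by have [+ _] := fA k; apply; case: (ptA t th).
  have -> : x + z k + h 0 k *: delta_mx 0 k = x + z k.+1.
    rewrite -addrA; congr (_ + _); apply/rowP => j; rewrite !mxE eqxx /= ltnS [(j <= k)%N]leq_eqVlt.
    case: (eqVneq j k) => [->|jk]; first by rewrite ltnn mulr1 add0r eqxx.
    by rewrite mulr0 addr0 -(inj_eq val_inj) /= in jk *; rewrite (negbTE jk).
  rewrite scale0r addr0 => ->; rewrite (derive_line _ _ _ _).2 mxE mulrC -mulrBr normrM mulrC.
  apply: ler_pM => //; last exact: rV_norm_entry.
  by apply: ltW; case: (ptA t th) => _; exact.
have -> : f (h + x) - (f x + lin_of a h) =
   \sum_(k < m) (f (x + z k.+1) - f (x + z k) - h 0 k * a k 0).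
  rewrite sumrB -(big_mkord xpredT (fun k => f (x + z k.+1) - f (x + z k))).
  rewrite telescope_sumr // hz z0 addr0 opprD addrA [h + x]addrC; congr (_ - _).
  by rewrite /lin_of mxE.
apply: le_trans (ler_norm_sum _ _ _) _.
apply: le_trans (ler_sum _ (fun k _ => step k)) _.
rewrite sumr_const card_ord -mulr_natl mulrA ler_wpM2r //.
rewrite /d mulrCA ler_piMr // ler_pdivrMr // mul1r ler_nat //.
Unshelve. all: by end_near. Qed.

End Differentiability.

Section CkCalculus.
Context {R : realType}.

Lemma near_eq_continuous (T U : topologicalType) (f g : T -> U) x :
  {near x, f =1 g} -> {for x, continuous f} -> {for x, continuous g}.
Proof.
move=> fg cf; have fgx : f x = g x by exact: (nbhs_singleton fg).
rewrite /prop_for /continuous_at -fgx; apply: cvg_trans cf.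
by apply: near_eq_cvg; apply: filterS fg => y ->.
Qed.

Lemma open_near_eq (T : topologicalType) (U : Type) (A : set T) (f g : T -> U) x :
  open A -> A x -> (forall y, A y -> f y = g y) -> {near x, f =1 g}.
Proof.
move=> oA Ax fg; have : \forall y \near x, A y by exact: open_nbhs_nbhs.
by apply: filterS => y /fg.
Qed.

Lemma Ck_ext m k (A : set 'rV[R]_m) f g : open A ->
  (forall x, A x -> f x = g x) -> Ck k A f -> Ck k A g.
Proof.
move=> oA; elim: k f g => [|k ih] f g fg /=.
  move=> h x Ax; apply: near_eq_continuous (h x Ax).
  exact: open_near_eq Ax fg.
move=> h i; have [h1 h2] := h i; split.
  by move=> x Ax; apply: near_eq_derivable (h1 x Ax); exact: open_near_eq Ax fg.
apply: ih h2 => x Ax; apply: near_eq_derive.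
exact: open_near_eq Ax fg.
Qed.

(** [Ck] asks for continuity of the derivatives of top order only, so going down one order already
    requires that C^1 functions are continuous. *)
Lemma Ck_le m k l (A : set 'rV[R]_m) f : open A -> (l <= k)%N -> Ck k A f -> Ck l A f.
Proof.
move=> oA; have S n h : Ck n.+1 A h -> Ck n A h.
  elim: n h => [|n ih] h hn.
    by move=> x Ax; apply: differentiable_continuous; exact: C1_differentiable hn Ax.
  by move=> i; have [h1 h2] := hn i; split=> //; exact: ih.
elim: k f => [|k ih] f; first by rewrite leqn0 => /eqP ->.
by rewrite leq_eqVlt => /predU1P[-> //|]; rewrite ltnS => lk /S; exact: ih.
Qed.

Lemma Ck_differentiable m k (A : set 'rV[R]_m) f x : open A ->
  Ck k.+1 A f -> A x -> differentiable f x.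
Proof. by move=> oA hf Ax; exact: C1_differentiable oA (@Ck_le m k.+1 1 A f oA isT hf) Ax. Qed.

Lemma CkD m k (A : set 'rV[R]_m) f g : open A ->
  Ck k A f -> Ck k A g -> Ck k A (fun x => f x + g x).
Proof.
move=> oA; elim: k f g => [|k ih] f g /=.
  by move=> cf cg x Ax; apply: continuousD; [exact: cf|exact: cg].
move=> hf hg i; have [f1 f2] := hf i; have [g1 g2] := hg i; split.
  by move=> x Ax; apply: derivableD; [exact: f1|exact: g1].
apply: Ck_ext (ih _ _ f2 g2) => // x Ax.
by rewrite deriveD; [|exact: f1|exact: g1].
Qed.

Lemma CkM m k (A : set 'rV[R]_m) f g : open A ->
  Ck k A f -> Ck k A g -> Ck k A (fun x => f x * g x).
Proof.
move=> oA; elim: k f g => [|k ih] f g.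
  by move=> cf cg x Ax; apply: continuousM; [exact: cf|exact: cg].
move=> hf hg i; have [f1 f2] := hf i; have [g1 g2] := hg i; split.
  by move=> x Ax; apply: derivableM; [exact: f1|exact: g1].
have f0 := Ck_le oA (leqnSn k) hf; have g0 := Ck_le oA (leqnSn k) hg.
apply: Ck_ext (CkD oA (ih _ _ f0 g2) (ih _ _ g0 f2)) => // x Ax.
by rewrite deriveM; [|exact: f1|exact: g1].
Qed.

Lemma CkN m k (A : set 'rV[R]_m) f : open A ->
  Ck k A f -> Ck k A (fun x => - f x).
Proof.
move=> oA hf; apply: Ck_ext (CkM oA (Ck_cst k A (-1)) hf) => // x _.
by rewrite mulN1r.
Qed.

Lemma Ck_sum m k (A : set 'rV[R]_m) (I : Type) (r : seq I) (P : pred I) F : open A ->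
  (forall i, P i -> Ck k A (F i)) -> Ck k A (fun x => \sum_(i <- r | P i) F i x).
Proof.
move=> oA hF; elim: r => [|i r ih].
  by apply: Ck_ext (Ck_cst k A 0) => // x _; rewrite big_nil.
case: (boolP (P i)) => Pi.
  by apply: Ck_ext (CkD oA (hF i Pi) ih) => // x _; rewrite big_cons Pi.
by apply: Ck_ext ih => // x _; rewrite big_cons (negbTE Pi).
Qed.

Lemma Ck_prod m k (A : set 'rV[R]_m) (I : Type) (r : seq I) (P : pred I) F : open A ->
  (forall i, P i -> Ck k A (F i)) -> Ck k A (fun x => \prod_(i <- r | P i) F i x).
Proof.
move=> oA hF; elim: r => [|i r ih].
  by apply: Ck_ext (Ck_cst k A 1) => // x _; rewrite big_nil.
case: (boolP (P i)) => Pi.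
  by apply: Ck_ext (CkM oA (hF i Pi) ih) => // x _; rewrite big_cons Pi.
by apply: Ck_ext ih => // x _; rewrite big_cons (negbTE Pi).
Qed.

Lemma differentiable_row m n (f : 'rV[R]_m -> 'rV[R]_n) x :
  (forall j, differentiable (fun y => f y 0 j) x) -> differentiable f x.
Proof.
move=> df.
rewrite (_ : f = \sum_(j < n) (fun y => f y 0 j *: delta_mx 0 j)); last first.
  by apply/funext => y; rewrite fct_sumE [LHS]row_sum_delta.
by apply: differentiable_sum => j; apply: differentiableZl.
Qed.

Lemma derive_chain m n (f : 'rV[R]_m -> 'rV[R]_n) (g : 'rV[R]_n -> R) x v :
  differentiable f x -> differentiable g (f x) ->
  derivable (g \o f) x v /\
  'D_v (g \o f) x =
    \sum_j 'D_v (fun y => f y 0 j) x * 'D_(delta_mx 0 j) g (f x).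
Proof.
move=> df dg; have dgf : differentiable (g \o f) x by exact: differentiable_comp.
split; first exact: diff_derivable.
rewrite deriveE // diff_comp //= -(deriveE _ df) derive_mx; last exact: diff_derivable.
rewrite [X in 'd g _ X]row_sum_delta linear_sum; apply: eq_bigr => j _.
by rewrite linearZ -deriveE // mxE.
Qed.

Lemma derive_comp_real m (f : 'rV[R]_m -> R) (phi : R -> R) x v :
  differentiable f x -> derivable phi (f x) 1 ->
  derivable (phi \o f) x v /\ 'D_v (phi \o f) x = 'D_1 phi (f x) * 'D_v f x.
Proof.
move=> df /derivable1_diffP dphi.
have dc : differentiable (phi \o f) x by exact: differentiable_comp.
split; first exact: diff_derivable.
rewrite deriveE // diff_comp //= -(deriveE _ df) (deriveE _ dphi).
rewrite -[X in 'd phi _ X]mulr1 -[X in 'd phi _ X]/('D_v f x *: (1 : R^o)).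
by rewrite [LHS]linearZ mulrC.
Qed.

Lemma Ck_comp m n k (A : set 'rV[R]_m) (B : set 'rV[R]_n)
    (f : 'rV[R]_m -> 'rV[R]_n) (g : 'rV[R]_n -> R) :
  open A -> open B -> (forall x, A x -> B (f x)) ->
  (forall j, Ck k A (fun x => f x 0 j)) -> Ck k B g -> Ck k A (g \o f).
Proof.
move=> oA oB AB; elim: k g => [|k ih] g hf hg.
  move=> x Ax; apply: continuous_comp; last by apply: hg; exact: AB.
  by apply: mx_continuous_at => i j; rewrite ord1; exact: hf.
have df x : A x -> differentiable f x.
  by move=> Ax; apply: differentiable_row => j; exact: Ck_differentiable (hf j) Ax.
have dg x : A x -> differentiable g (f x).
  by move=> /AB Bx; exact: Ck_differentiable hg Bx.
move=> i; split.
  by move=> x Ax; case: (derive_chain (delta_mx 0 i) (df x Ax) (dg x Ax)).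
apply: (@Ck_ext _ _ _ (fun x => \sum_j 'D_(delta_mx 0 i) (fun y => f y 0 j) x
   * ('D_(delta_mx 0 j) g \o f) x)) => //.
  by move=> x Ax; case: (derive_chain (delta_mx 0 i) (df x Ax) (dg x Ax)).
apply: Ck_sum => // j _; apply: CkM => //; first by have [] := hf j i.
apply: ih; last by have [] := hg j.
by move=> l; apply: Ck_le (hf l).
Qed.

Lemma CkV m k (A : set 'rV[R]_m) f : open A ->
  (forall x, A x -> f x != 0) -> Ck k A f -> Ck k A (fun x => (f x)^-1).
Proof.
move=> oA f0; elim: k => [|k ih] hf.
  by move=> x Ax; apply: continuousV; [exact: f0|exact: hf].
have h := ih (Ck_le oA (leqnSn k) hf).
move=> i; have [f1 f2] := hf i; split.
  by move=> x Ax; apply: derivableV; [exact: f0|exact: f1].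
apply: Ck_ext (CkM oA (CkN oA (CkM oA h h)) f2) => // x Ax.
rewrite deriveV; [|exact: f0|exact: f1].
by rewrite [RHS]mulNr mulNr -[(f x)^-2]exprVn expr2.
Qed.

(** When the derivative of each member is a combination of members, one induction on k treats the
    whole family. This covers functions whose higher derivatives have no convenient closed form. *)
Lemma Ck_family m (I : Type) (B : set R) (phi : I -> R -> R) (next : I -> seq (R * I))
    (A : set 'rV[R]_m) f :
  open A -> (forall x, A x -> B (f x)) ->
  (forall i t, B t -> derivable (phi i) t 1) ->
  (forall i t, B t -> 'D_1 (phi i) t = \sum_(p <- next i) p.1 * phi p.2 t) ->
  forall k i, Ck k A f -> Ck k A (phi i \o f).
Proof.
move=> oA AB dphi Dphi; elim=> [|k ih] i hf.
  move=> x Ax; apply: continuous_comp; first exact: hf.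
  by apply: differentiable_continuous; apply/derivable1_diffP/dphi/AB.
have df x : A x -> differentiable f x by exact: Ck_differentiable hf.
have h := Ck_le oA (leqnSn k) hf.
move=> j; split.
  move=> x Ax.
  by case: (derive_comp_real (delta_mx 0 j) (df x Ax) (dphi i _ (AB x Ax))).
apply: (@Ck_ext _ _ _ (fun x => (\sum_(p <- next i) p.1 * (phi p.2 \o f) x)
   * 'D_(delta_mx 0 j) f x)) => //.
  move=> x Ax.
  have [_ ->] := derive_comp_real (delta_mx 0 j) (df x Ax) (dphi i _ (AB x Ax)).
  by rewrite Dphi //; exact: AB.
apply: CkM => //; last by have [] := hf j.
apply: Ck_sum => // p _; apply: CkM => //; first exact: Ck_cst.
exact: ih.
Qed.

End CkCalculus.

(** * A smooth step function, and smoothness of the scalar square root *)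

Section SmoothStep.
Context {R : realType}.

(** The powers of 1/t are carried along because the derivatives of exp(-1/t) are combinations of
    these functions. *)
Definition flat (k : nat) (t : R) : R :=
  if 0 < t then t^-1 ^+ k * expR (- t^-1) else 0.

Lemma flat_ge0 k t : 0 <= flat k t.
Proof.
rewrite /flat; case: ifPn => // t0.
by rewrite mulr_ge0 ?expR_ge0 // exprn_ge0 // invr_ge0 ltW.
Qed.

Lemma flat_gt0 k t : 0 < t -> 0 < flat k t.
Proof. by move=> t0; rewrite /flat t0 mulr_gt0 ?expR_gt0 // exprn_gt0 // invr_gt0. Qed.

Lemma flat_le0 k t : t <= 0 -> flat k t = 0.
Proof. by rewrite /flat leNgt => /negbTE ->. Qed.

(** For t > 0, exp(1/t) dominates the single term t^-(k+1) / (k+1)! of its series. The linear decay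
    is what makes difference quotients at 0 vanish in the limit. *)
Lemma flat_bound k t : `|flat k t| <= k.+1`!%:R * `|t|.
Proof.
rewrite ger0_norm ?flat_ge0 // /flat; case: ifPn => t0; last by rewrite mulr_ge0.
rewrite (gtr0_norm t0) expRN.
have := @expR_ge1Dxn R t^-1 k; rewrite invr_ge0 (ltW t0) => /(_ isT) h.
have F0 : 0 < k.+1`!%:R :> R by rewrite ltr0n fact_gt0.
have {h}h : t^-1 ^+ k.+1 <= expR t^-1 * k.+1`!%:R.
  by rewrite -ler_pdivrMr //; apply: le_trans h; rewrite lerDr.
rewrite ler_pdivrMr ?expR_gt0 // mulrAC -ler_pdivrMr //.
by rewrite -exprSr mulrC.
Qed.

Lemma is_derive_flat k (t : R) :
  is_derive t 1 (flat k) (- k%:R * flat k.+1 t + flat k.+2 t).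
Proof.
have [t0|t0|<-] := ltgtP 0 t.
- have tn0 : t != 0 by rewrite gt_eqF.
  have iV : is_derive t (1 : R) (fun y : R => y^-1) (- t ^- 2 *: (1 : R)).
    by apply: is_deriveV => //; exact: is_derive_id.
  have iX := is_deriveX k iV.
  have iN := is_deriveN iV.
  have iE := @is_derive1_comp _ expR _ t _ _ (is_derive_expR _) iN.
  have iM := is_deriveM iX iE.
  have -> : - k%:R * flat k.+1 t + flat k.+2 t =
     ((fun y : R => y^-1) ^+ k) t *: (expR (- t^-1) * (- (- t ^- 2 *: (1 : R)))) +
     (expR \o (- (fun y : R => y^-1))) t *: (k%:R * t^-1 ^+ k.-1 * (- t ^- 2 *: (1:R))).
    rewrite /flat t0 exprfctE /= fctE; rewrite /GRing.scale /=.
    case: k {iX iM} => [|k] /=; rewrite -exprVn; last rewrite !exprS; ring.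
  apply: near_eq_is_derive iM; near=> y.
  rewrite /flat ifT; last by near: y; exact: lt_nbhsr.
  by rewrite fctE exprfctE.
- rewrite !flat_le0 ?ltW // mulr0 addr0.
  apply: near_eq_is_derive (is_derive_cst 0 t 1); near=> y.
  rewrite flat_le0 //; near: y; exact: lt_le_nbhsl.
rewrite !flat_le0 // mulr0 addr0.
suff h : (fun h : R => h^-1 *: ((flat k \o shift 0) (h *: 1) - flat k 0)) @ 0^' --> (0 : R).
  by split; [apply/cvg_ex; exists 0|exact: (cvg_lim _ h)].
apply/cvgrPdist_le => e e0; near=> h.
have h0 : h != 0 by near: h; exact: nbhs_dnbhs_neq.
rewrite /= (flat_le0 k (lexx 0)) subr0 addr0 sub0r normrN /GRing.scale /= mulr1.
(* Dividing by h raises the index by one, and the next function tends to 0 by [flat_bound]. *)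
have -> : h^-1 * flat k h = flat k.+1 h.
  by rewrite /flat; case: ifP => _; rewrite ?mulr0 // exprS mulrA.
apply: le_trans (flat_bound _ _) _.
have F0 : 0 < k.+2`!%:R :> R by rewrite ltr0n fact_gt0.
rewrite mulrC -ler_pdivlMr //.
by near: h; apply: (@dnbhs0_le R R^o); rewrite divr_gt0.
Unshelve. all: by end_near. Qed.

Lemma Ck_flat m k (A : set 'rV[R]_m) f : open A -> Ck k A f ->
  Ck k A (fun x => flat 0 (f x)).
Proof.
move=> oA; apply: (@Ck_family _ _ _ setT flat
  (fun i => [:: (- i%:R, i.+1); (1, i.+2)])) => // i t _.
  by case: (is_derive_flat i t).
by case: (is_derive_flat i t) => _ ->; rewrite !big_cons big_nil addr0 mul1r.
Qed.

Definition step (t : R) : R := flat 0 t / (flat 0 t + flat 0 (1 - t)).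

Lemma step_den t : 0 < flat 0 t + flat 0 (1 - t).
Proof.
have [t0|t0] := ltP 0 t; first by rewrite ltr_pwDl ?flat_gt0 // flat_ge0.
by rewrite ltr_wpDl ?flat_ge0 // flat_gt0 //; lra.
Qed.

Lemma step_ge0 t : 0 <= step t.
Proof. by rewrite divr_ge0 ?flat_ge0 // ltW // step_den. Qed.

Lemma step_le1 t : step t <= 1.
Proof. by rewrite ler_pdivrMr ?step_den // mul1r lerDl flat_ge0. Qed.

Lemma step_le0 t : t <= 0 -> step t = 0.
Proof. by move=> t0; rewrite /step flat_le0 ?mul0r. Qed.

Lemma step_ge1 t : 1 <= t -> step t = 1.
Proof.
move=> t1; rewrite /step [flat 0 (1 - t)]flat_le0 ?subr_le0 // addr0 divff //.
by rewrite gt_eqF // flat_gt0 //; lra.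
Qed.

Lemma Ck_step m k (A : set 'rV[R]_m) f : open A -> Ck k A f ->
  Ck k A (fun x => step (f x)).
Proof.
move=> oA hf; apply: CkM => //; first exact: Ck_flat.
apply: CkV => //; first by move=> x _; rewrite gt_eqF // step_den.
apply: CkD => //; apply: Ck_flat => //.
by apply: CkD (Ck_cst _ _ _) _ => //; exact: CkN.
Qed.

Lemma Ck_sqrt m k (A : set 'rV[R]_m) (f : 'rV[R]_m -> R) : open A -> (forall x, A x -> 0 < f x) ->
  Ck k A f -> Ck k A (fun x => Num.sqrt (f x)).
Proof.
move=> oA f0.
(* The family t^-i sqrt t is closed under derivation: the derivative of member i is (1/2 - i) times
   member i + 1. *)
pose phi (i : nat) (t : R) := t^-1 ^+ i * Num.sqrt t.
have h (i : nat) (t : R) : 0 < t ->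
    is_derive t (1 : R) (phi i) ((2^-1 - i%:R) * phi i.+1 t).
  move=> t0; have tn0 : t != 0 by rewrite gt_eqF.
  have iV : is_derive t (1 : R) (fun y : R => y^-1) (- t ^- 2 *: (1 : R)).
    by apply: is_deriveV => //; exact: is_derive_id.
  have := is_deriveM (is_deriveX i iV) (is_derive1_sqrt t0).
  rewrite exprfctE => iM.
  have -> : (2^-1 - i%:R) * phi i.+1 t =
     t^-1 ^+ i *: (2 * Num.sqrt t)^-1 +
     Num.sqrt t *: (i%:R * t^-1 ^+ i.-1 * (- t ^- 2 *: (1:R))).
    have s0 : Num.sqrt t != 0 by rewrite gt_eqF // sqrtr_gt0.
    have -> : (2 * Num.sqrt t)^-1 = 2^-1 * (t^-1 * Num.sqrt t).
      rewrite -{2}(sqr_sqrtr (ltW t0)); field.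
      by rewrite s0.
    rewrite /phi /GRing.scale /=.
    case: i {iM} => [|i] /=; rewrite -exprVn ?exprS; ring.
  apply: near_eq_is_derive iM; near=> y.
  by rewrite /phi.
move=> hf.
apply: Ck_ext (@Ck_family _ _ _ [set t | 0 < t] phi
   (fun i => [:: (2^-1 - i%:R, i.+1)]) _ _ oA _ _ _ k 0%N hf) => //.
- by move=> x _; rewrite /phi /= mul1r.
- by move=> i t /= t0; case: (h i t t0).
- by move=> i t /= t0; case: (h i t t0) => _ ->; rewrite big_cons big_nil addr0.
Unshelve. all: by end_near. Qed.

End SmoothStep.

(** * Smooth matrix functions and square roots *)

Section SmoothMatrices.
Context {R : realType} {m : nat} (k : nat) (A : set 'rV[R]_m).
Hypothesis oA : open A.

Definition Ckmx r s (F : 'rV[R]_m -> 'M[R]_(r, s)) : Prop :=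
  forall i j, Ck k A (fun x => F x i j).

Lemma Ckmx_ext r s (F G : 'rV[R]_m -> 'M[R]_(r, s)) :
  (forall x, A x -> F x = G x) -> Ckmx F -> Ckmx G.
Proof. by move=> FG h i j; apply: Ck_ext (h i j) => // x Ax; rewrite FG. Qed.

Lemma Ckmx_cst r s (B : 'M[R]_(r, s)) : Ckmx (fun=> B).
Proof. by move=> i j; exact: Ck_cst. Qed.

Lemma CkmxD r s (F G : 'rV[R]_m -> 'M[R]_(r, s)) :
  Ckmx F -> Ckmx G -> Ckmx (fun x => F x + G x).
Proof.
move=> hF hG i j; apply: (Ck_ext oA) (CkD oA (hF i j) (hG i j)) => x _.
by rewrite mxE.
Qed.

Lemma CkmxN r s (F : 'rV[R]_m -> 'M[R]_(r, s)) : Ckmx F -> Ckmx (fun x => - F x).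
Proof.
by move=> hF i j; apply: (Ck_ext oA) (CkN oA (hF i j)) => x _; rewrite mxE.
Qed.

Lemma CkmxB r s (F G : 'rV[R]_m -> 'M[R]_(r, s)) :
  Ckmx F -> Ckmx G -> Ckmx (fun x => F x - G x).
Proof. by move=> hF hG; apply: CkmxD => //; exact: CkmxN. Qed.

Lemma CkmxZ r s (f : 'rV[R]_m -> R) (F : 'rV[R]_m -> 'M[R]_(r, s)) :
  Ck k A f -> Ckmx F -> Ckmx (fun x => f x *: F x).
Proof.
move=> hf hF i j; apply: (Ck_ext oA) (CkM oA hf (hF i j)) => x _.
by rewrite mxE.
Qed.

Lemma Ckmx_sum r s (I : Type) (l : seq I) (P : pred I)
    (F : I -> 'rV[R]_m -> 'M[R]_(r, s)) :
  (forall i, P i -> Ckmx (F i)) -> Ckmx (fun x => \sum_(i <- l | P i) F i x).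
Proof.
move=> hF i j.
apply: (@Ck_ext _ _ _ _ (fun x => \sum_(t <- l | P t) F t x i j)) => //.
  by move=> x _; rewrite summxE.
by apply: Ck_sum => // t Pt; exact: hF.
Qed.

Lemma CkmxM r s t (F : 'rV[R]_m -> 'M[R]_(r, s)) (G : 'rV[R]_m -> 'M[R]_(s, t)) :
  Ckmx F -> Ckmx G -> Ckmx (fun x => F x *m G x).
Proof.
move=> hF hG i j.
apply: (@Ck_ext _ _ _ _ (fun x => \sum_l F x i l * G x l j)) => //.
  by move=> x _; rewrite mxE.
by apply: Ck_sum => // l _; apply: CkM.
Qed.

Lemma Ckmx_tr r s (F : 'rV[R]_m -> 'M[R]_(r, s)) : Ckmx F -> Ckmx (fun x => (F x)^T).
Proof. by move=> hF i j; apply: (Ck_ext oA) (hF j i) => x _; rewrite mxE. Qed.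

Lemma Ckmx_block r1 r2 s1 s2 (F : 'rV[R]_m -> 'M[R]_(r1, s1)) G H
    (K : 'rV[R]_m -> 'M[R]_(r2, s2)) :
  Ckmx F -> Ckmx G -> Ckmx H -> Ckmx K ->
  Ckmx (fun x => block_mx (F x) (G x) (H x) (K x)).
Proof.
move=> hF hG hH hK i j; case: (split_ordP i) => i' ->; case: (split_ordP j) => j' ->.
- by apply: (Ck_ext oA) (hF i' j') => x _; rewrite block_mxEul.
- by apply: (Ck_ext oA) (hG i' j') => x _; rewrite block_mxEur.
- by apply: (Ck_ext oA) (hH i' j') => x _; rewrite block_mxEdl.
- by apply: (Ck_ext oA) (hK i' j') => x _; rewrite block_mxEdr.
Qed.

Lemma Ckmx_sub r s r' s' (f : 'I_r' -> 'I_r) (g : 'I_s' -> 'I_s)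
    (F : 'rV[R]_m -> 'M[R]_(r, s)) :
  Ckmx F -> Ckmx (fun x => mxsub f g (F x)).
Proof. by move=> hF i j; apply: (Ck_ext oA) (hF (f i) (g j)) => x _; rewrite mxE. Qed.

Lemma Ck_det r (F : 'rV[R]_m -> 'M[R]_r) : Ckmx F -> Ck k A (fun x => \det (F x)).
Proof.
move=> hF; apply: Ck_sum => // s _; apply: CkM => //; first exact: Ck_cst.
by apply: Ck_prod => // i _; exact: hF.
Qed.

Lemma Ckmx_inv r (F : 'rV[R]_m -> 'M[R]_r) :
  (forall x, A x -> F x \in unitmx) -> Ckmx F -> Ckmx (fun x => invmx (F x)).
Proof.
move=> uF hF; apply: (@Ckmx_ext _ _ (fun x => (\det (F x))^-1 *: \adj (F x))).
  by move=> x Ax; rewrite /invmx uF.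
apply: CkmxZ; first apply: CkV => //; last 2 first.
- exact: Ck_det.
- move=> i j; apply: (@Ck_ext _ _ _ _ (fun x => (-1) ^+ (j + i) *
      \det (mxsub (lift j) (lift i) (F x)))) => //.
    move=> x _; rewrite mxE /cofactor; congr (_ * \det _).
    by apply/matrixP => a b; rewrite !mxE.
  apply: CkM => //; first exact: Ck_cst.
  by apply: Ck_det; exact: Ckmx_sub.
by move=> x Ax; have := uF x Ax; rewrite unitmxE unitfE.
Qed.

End SmoothMatrices.

(** * Positive definite matrices and existence of their square roots *)

Section PositiveMatrices.
Context {R : realType}.

Definition spd m (A : 'M[R]_m) : Prop :=
  A^T = A /\ forall u : 'rV[R]_m, u != 0 -> 0 < (u *m A *m u^T) 0 0.

Lemma spd_ge0 m (A : 'M[R]_m) (u : 'rV[R]_m) : spd A -> 0 <= (u *m A *m u^T) 0 0.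
Proof.
case=> _ pA; have [->|u0] := eqVneq u 0; first by rewrite !mul0mx mxE.
exact/ltW/pA.
Qed.

Lemma spd_unit m (A : 'M[R]_m) : spd A -> A \in unitmx.
Proof.
case=> _ pA; rewrite unitmxE unitfE; apply/det0P => -[v v0 vA].
by have := pA v v0; rewrite vA mul0mx mxE ltxx.
Qed.

Lemma dot_ge0 m (u : 'rV[R]_m) : 0 <= (u *m u^T) 0 0.
Proof. by rewrite mxE sumr_ge0 // => i _; rewrite mxE -expr2 sqr_ge0. Qed.

Lemma dot_gt0 m (u : 'rV[R]_m) : u != 0 -> 0 < (u *m u^T) 0 0.
Proof.
move=> u0; rewrite lt_neqAle dot_ge0 andbT eq_sym; apply: contra u0.
rewrite mxE psumr_eq0; last by move=> i _; rewrite mxE -expr2 sqr_ge0.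
move/allP => h; apply/eqP/rowP => i; have := h i (mem_index_enum i).
by rewrite mxE /= -expr2 sqrf_eq0 mxE => /eqP.
Qed.

Lemma spd1 m : spd (1%:M : 'M[R]_m).
Proof. by split; [exact: trmx1|move=> u u0; rewrite mulmx1 dot_gt0]. Qed.

Lemma spd_congr m (A J : 'M[R]_m) : J \in unitmx -> spd A -> spd (J *m A *m J^T).
Proof.
move=> uJ [sA pA]; split; first by rewrite !trmx_mul trmxK sA mulmxA.
move=> u u0; rewrite !mulmxA -(mulmxA _ J^T) -trmx_mul; apply: pA.
apply: contra u0 => /eqP uJ0.
by rewrite -[u](mulmxK uJ) uJ0 mul0mx.
Qed.

Lemma spd_inv m (A : 'M[R]_m) : spd A -> spd (invmx A).
Proof.
move=> pA; have uA := spd_unit pA.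
have -> : invmx A = invmx A *m A *m (invmx A)^T.
  by rewrite mulVmx // mul1mx trmx_inv (proj1 pA).
by apply: spd_congr => //; rewrite unitmx_inv.
Qed.

Lemma spd_sqr m (A : 'M[R]_m) : A^T = A -> A \in unitmx -> spd (A *m A).
Proof.
move=> sA uA; rewrite (_ : A *m A = A *m 1%:M *m A^T); last by rewrite mulmx1 sA.
by apply: spd_congr => //; exact: spd1.
Qed.

Lemma diag_congr m r (A : 'M[R]_m) (D : 'M[R]_(r, m)) i :
  (D *m A *m D^T) i i = (row i D *m A *m (row i D)^T) 0 0.
Proof.
rewrite [LHS]mxE [RHS]mxE; apply: eq_bigr => j _.
by rewrite -row_mul [row i (D *m A) 0 j]mxE; congr (_ * _); rewrite !mxE.
Qed.

Lemma trace_ge0 m r (A : 'M[R]_m) (D : 'M[R]_(r, m)) : spd A ->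
  0 <= \tr (D *m A *m D^T).
Proof.
by move=> pA; apply: sumr_ge0 => i _; rewrite diag_congr spd_ge0.
Qed.

Lemma trace_eq0 m r (A : 'M[R]_m) (D : 'M[R]_(r, m)) : spd A ->
  \tr (D *m A *m D^T) = 0 -> D = 0.
Proof.
move=> pA.
have e i := diag_congr A D i.
move/eqP; rewrite psumr_eq0; last by move=> i _; rewrite e; exact: spd_ge0.
move/allP => h; apply/row_matrixP => i; rewrite row0.
have := h i (mem_index_enum i); rewrite e /=.
by case: (eqVneq (row i D) 0) => // /(proj2 pA) /gt_eqF ->.
Qed.

(** Multiplying by D^T and taking traces gives tr(D^T X D) + tr(D Y D^T) = 0, a sum of two
    nonnegative numbers. *)
Lemma sylvester_inj m (X Y D : 'M[R]_m) : spd X -> spd Y ->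
  X *m D + D *m Y = 0 -> D = 0.
Proof.
move=> pX pY e; apply: (trace_eq0 pY).
have h : \tr (D^T *m X *m D^T^T) + \tr (D *m Y *m D^T) = 0.
  rewrite trmxK [\tr (D *m Y *m _)]mxtrace_mulC -mxtraceD -mulmxA -mulmxDr.
  by rewrite e mulmx0 mxtrace0.
by apply/eqP; move/eqP: h; rewrite paddr_eq0 ?trace_ge0 // => /andP[].
Qed.

(** X^2 - Y^2 = X (X - Y) + (X - Y) Y, so the difference solves a homogeneous Sylvester equation. *)
Lemma spd_sqr_inj m (X Y : 'M[R]_m) : spd X -> spd Y ->
  X *m X = Y *m Y -> X = Y.
Proof.
move=> pX pY e; apply/subr0_eq/(sylvester_inj pX pY).
by rewrite mulmxBr mulmxBl e addrA subrK subrr.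
Qed.

(** It replaces a root function on a finite spectrum by a polynomial, so that the root of a real
    symmetric matrix is a real polynomial in that matrix. *)
Lemma interpolation (s : seq R) (F : R -> R) :
  exists p : {poly R}, forall x, x \in s -> p.[x] = F x.
Proof.
elim: s => [|x s [p hp]]; first by exists 0.
have [xs|xs] := boolP (x \in s).
  by exists p => y; rewrite inE => /predU1P[-> |]; exact: hp.
pose q : {poly R} := \prod_(y <- s) ('X - y%:P).
have qx : q.[x] != 0 by rewrite -rootE root_prod_XsubC.
exists (p + ((F x - p.[x]) / q.[x]) *: q) => y; rewrite inE => /predU1P[->|ys].
  by rewrite hornerD hornerZ divfK // addrC subrK.
rewrite hornerD hornerZ hp // (_ : q.[y] = 0) ?mulr0 ?addr0 //.
by apply/eqP; rewrite -rootE root_prod_XsubC.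
Qed.

(** The complexified matrix is diagonalized by the spectral theorem for Hermitian matrices; its
    eigenvalues are real and positive, and interpolation on them yields a root over the reals. *)
Lemma spd_sqrt_ex m (A : 'M[R]_m) : spd A -> exists2 Q, spd Q & Q *m Q = A.
Proof.
case: m A => [|m] A pA.
  by exists A => //; apply/matrixP => -[].
pose C := R[i]; pose rc : {rmorphism R -> C} := real_complex R.
pose Ac : 'M[C]_m.+1 := map_mx rc A.
have hA : Ac \is hermsymmx.
  apply/is_hermitianmxP; rewrite expr0 scale1r; apply/matrixP => i j.
  rewrite !mxE conj_Creal; last by apply/complex_realP; exists (A j i).
  by rewrite -[in LHS](proj1 pA) mxE.
have nA := hermitian_normalmx hA.
have eA := orthomx_spectralP nA.
have dr := hermitian_spectral_diag_real hA.
pose d := spectral_diag Ac; pose P := spectralmx Ac.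
have uP : P \in unitmx := spectral_unit Ac.
have dR i : d 0 i = rc (complex.Re (d 0 i)) by rewrite [RHS]RRe_real //; move/mxOverP: dr; apply.
pose r i := complex.Re (d 0 i).
(* The number r_i annihilates the real determinant det(A - r_i), so it has a real eigenvector, to
   which positivity of A applies. *)
have r0 i : 0 < r i.
  have : \det (A - (r i)%:M) == 0.
    rewrite -(fmorph_eq0 rc) -det_map_mx map_mxB map_scalar_mx -/Ac -dR.
    rewrite {1}eA -/d -/P.
    have -> : (d 0 i)%:M = invmx P *m (d 0 i)%:M *m P.
      by rewrite mul_mx_scalar -scalemxAl mulVmx // scalemx1.
    rewrite -mulmxBl -mulmxBr !det_mulmx mulf_eq0 mulf_eq0.
    have -> : diag_mx d - (d 0 i)%:M = diag_mx (\row_j (d 0 j - d 0 i)).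
      by apply/matrixP => a b; rewrite !mxE -mulrnBl.
    by rewrite det_diag (bigD1 i) //= mxE subrr mul0r eqxx orbT.
  move/det0P => [v v0 /eqP]; rewrite mulmxBr subr_eq0 => /eqP vA.
  have := proj2 pA v v0; rewrite vA mul_mx_scalar -scalemxAl mxE.
  by rewrite pmulr_lgt0 // dot_gt0.
(* A fourth root K is interpolated rather than a square root: K is only known to be symmetric and
   invertible, but then K^2 is positive definite for free. *)
have [p hp] := interpolation [seq r i | i <- enum 'I_m.+1] (fun x => Num.sqrt (Num.sqrt x)).
have h4 i : (p ^+ 4).[r i] = r i.
  rewrite horner_exp hp; last by apply/mapP; exists i => //; rewrite mem_enum.
  by rewrite (exprM _ 2 2) !sqr_sqrtr ?sqrtr_ge0 // ltW.
pose K := horner_mx A p.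
have K4 : K ^+ 4 = A.
  have h40 i : (p ^+ 4 - 'X).[r i] = 0 by rewrite hornerD hornerN hornerX h4 subrr.
  apply/eqP; rewrite -subr_eq0 -rmorphXn -{2}(horner_mx_X A) -rmorphB /=.
  move: (p ^+ 4 - 'X) h40 => q hq; apply/eqP.
  apply: (map_mx_inj (f := rc)); rewrite map_mx0.
  have -> : map_mx rc (horner_mx A q) = horner_mx Ac (map_poly rc q) by exact: map_horner_mx.
  have -> : horner_mx Ac (map_poly rc q) =
      invmx P *m horner_mx (diag_mx d) (map_poly rc q) *m P.
    by rewrite -horner_mx_uconjC // {1}eA.
  rewrite horner_mx_diag (_ : map_mx _ _ = 0) ?linear0 ?mulmx0 ?mul0mx //.
  by apply/rowP => i; rewrite !mxE dR horner_map /= hq rmorph0.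
have sK : K^T = K.
  rewrite /K; elim/poly_ind: (p) => [|q c ih]; first by rewrite rmorph0 trmx0.
  rewrite rmorphD rmorphM /= horner_mx_X horner_mx_C linearD /= tr_scalar_mx.
  congr (_ + _); rewrite trmx_mul ih (proj1 pA).
  by have := comm_mx_horner q (erefl : comm_mx A A).
have uK : K \in unitmx.
  have := spd_unit pA; rewrite -K4 exprS unitmx_mul => /andP[] //.
exists (K *m K); first exact: spd_sqr.
by rewrite -[RHS]K4 (exprM K 2 2) !expr2.
Qed.

Definition sqrtmx m (A : 'M[R]_m) : 'M[R]_m :=
  xget 0 [set Q | spd Q /\ Q *m Q = A].

Lemma sqrtmxP m (A : 'M[R]_m) : spd A -> spd (sqrtmx A) /\ sqrtmx A *m sqrtmx A = A.
Proof.
by case/spd_sqrt_ex => Q pQ QA; apply: (@xgetPex _ 0 [set Q | spd Q /\ Q *m Q = A]); exists Q.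
Qed.

Lemma sqrtmx_unique m (A Q : 'M[R]_m) : spd Q -> Q *m Q = A -> sqrtmx A = Q.
Proof.
move=> pQ QA; have pA : spd A by rewrite -QA; apply: spd_sqr (spd_unit pQ); case: pQ.
by have [pS SA] := sqrtmxP pA; apply: spd_sqr_inj => //; rewrite QA.
Qed.

End PositiveMatrices.

(** * Smooth dependence of the matrix square root *)

Section SmoothSquareRoot.
Context {R : realType} {m r : nat}.

(** The Sylvester operator D |-> X D + D Y on vectorized matrices; written as a matrix, its inverse
    is smooth by [Ckmx_inv]. *)
Definition sylv (X Y : 'M[R]_r) : 'M[R]_(r * r) := lin_mulmx X + lin_mulmxr Y.

Lemma sylvE X Y (D : 'M[R]_r) : mxvec D *m sylv X Y = mxvec (X *m D + D *m Y).
Proof. by rewrite mulmxDr !mul_vec_lin -linearD. Qed.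

Lemma sylv_unit X Y : spd X -> spd Y -> sylv X Y \in unitmx.
Proof.
move=> pX pY; rewrite unitmxE unitfE; apply/det0P => -[v v0].
rewrite -[v]vec_mxK sylvE => /eqP; rewrite mxvec_eq0 => /eqP /(sylvester_inj pX pY) e.
by case/eqP: v0; rewrite -[v]vec_mxK e linear0.
Qed.

Lemma Ckmx_mxvec k (A : set 'rV[R]_m) p q (F : 'rV[R]_m -> 'M[R]_(p, q)) : open A ->
  Ckmx k A F -> Ckmx k A (fun x => mxvec (F x)).
Proof.
move=> oA hF i j; rewrite ord1; case/mxvec_indexP: j => a b.
by apply: (Ck_ext oA) (hF a b) => x _; rewrite mxvecE.
Qed.

Lemma Ckmx_vec k (A : set 'rV[R]_m) p q (F : 'rV[R]_m -> 'rV[R]_(p * q)) : open A ->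
  Ckmx k A F -> Ckmx k A (fun x => vec_mx (F x)).
Proof. by move=> oA hF i j; apply: (Ck_ext oA) (hF 0 (mxvec_index i j)) => x _; rewrite mxE. Qed.

Lemma Ckmx_sylv k (A : set 'rV[R]_m) (X Y : 'rV[R]_m -> 'M[R]_r) : open A ->
  Ckmx k A X -> Ckmx k A Y -> Ckmx k A (fun x => sylv (X x) (Y x)).
Proof.
move=> oA hX hY i j.
have h : Ckmx k A (fun x => mxvec (X x *m vec_mx (delta_mx 0 i) + vec_mx (delta_mx 0 i) *m Y x)).
  apply: Ckmx_mxvec => //; apply: CkmxD => //; apply: CkmxM => //; exact: Ckmx_cst.
apply: (Ck_ext oA) (h 0 j) => x _.
by rewrite linearD /sylv ![in RHS]mxE [LHS]mxE.
Qed.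

Variables (A : set 'rV[R]_m) (S : 'rV[R]_m -> 'M[R]_r).
Hypothesis oA : open A.
Hypothesis pS : forall x, A x -> spd (S x).
Let X x := sqrtmx (S x).

Let pX x : A x -> spd (X x). Proof. by move=> /pS /sqrtmxP[]. Qed.
Let XX x : A x -> X x *m X x = S x. Proof. by move=> /pS /sqrtmxP[]. Qed.

(** This identity is exact, without remainder: the increment of the root solves a Sylvester equation
    whose right-hand side is the increment of S. Both continuity and the derivative are read off
    from it. *)
Let diffX x y : A x -> A y ->
  X y *m (X y - X x) + (X y - X x) *m X x = S y - S x.
Proof. by move=> Ax Ay; rewrite mulmxBr mulmxBl !XX // addrA subrK. Qed.

(** Expand |E - G|^2 >= 0 for the Frobenius inner product. *)
Lemma amgm_trace (E G : 'M[R]_r) :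
  \tr (E^T *m E) <= \tr (E^T *m G) -> \tr (E^T *m E) <= \tr (G^T *m G).
Proof.
have h : 0 <= \tr ((E - G)^T *m 1%:M *m (E - G)^T^T) by exact: trace_ge0 (spd1 _).
move: h; rewrite mulmx1 trmxK; have -> : (E - G)^T = E^T - G^T by rewrite linearB.
rewrite mulmxBl !mulmxBr !raddfB /=.
have -> : \tr (G^T *m E) = \tr (E^T *m G).
  by rewrite -mxtrace_tr trmx_mul trmxK.
lra.
Qed.

Lemma entry_le_trace (E : 'M[R]_r) i j : E i j ^+ 2 <= \tr (E^T *m E).
Proof.
rewrite /mxtrace (bigD1 j) //= mxE (bigD1 i) //= mxE -expr2 -addrA lerDl addr_ge0 //.
  by apply: sumr_ge0 => k _; rewrite mxE -expr2 sqr_ge0.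
by apply: sumr_ge0 => k _; rewrite mxE sumr_ge0 // => l _; rewrite mxE -expr2 sqr_ge0.
Qed.

(** Write D = X y - X x and let Y be the square root of X x. Pairing [diffX] with D and dropping the
    nonnegative term tr(D^T X_y D) gives |D Y|^2 <= <D Y, (S y - S x) Y^-1>, hence |D Y| <= |(S y -
    S x) Y^-1|, which tends to 0. *)
Let cX : Ckmx 0 A S -> Ckmx 0 A X.
Proof.
move=> cS.
suff main x : A x -> exists2 Y : 'M[R]_r, Y \in unitmx &
    forall i j, {for x, continuous (fun y => ((X y - X x) *m Y) i j)}.
  move=> i j x Ax; have [Y uY cY] := main x Ax.
  have h : {for x, continuous (fun y => \sum_l ((X y - X x) *m Y) i l * (invmx Y) l j + X x i j)}.
    apply: continuousD; last exact: cst_continuous.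
    apply: continuous_sumr => l _; apply: continuousM; first exact: cY.
    exact: cst_continuous.
  rewrite (_ : (fun y => _) = fun y => \sum_l ((X y - X x) *m Y) i l * (invmx Y) l j + X x i j) //.
  apply/funext => y.
  have <- : ((X y - X x) *m Y *m invmx Y) i j =
     \sum_l ((X y - X x) *m Y) i l * (invmx Y) l j by rewrite mxE.
  by rewrite mulmxK // !mxE subrK.
move=> Ax; pose Y := sqrtmx (X x).
have [pY YY] := sqrtmxP (pX Ax); rewrite -/Y in pY YY.
have uY := spd_unit pY; exists Y => //.
pose G y := (S y - S x) *m invmx Y.
have bound y : A y -> forall i j,
    ((X y - X x) *m Y) i j ^+ 2 <= \tr ((G y)^T *m G y).
  move=> Ay i j; apply: le_trans (entry_le_trace _ i j) _; apply: amgm_trace.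
  set D := X y - X x.
  have sD : D^T = D by rewrite linearB /= (proj1 (pX Ay)) (proj1 (pX Ax)).
  have -> : \tr ((D *m Y)^T *m (D *m Y)) = \tr (D *m X x *m D^T).
    by rewrite mxtrace_mulC trmx_mul (proj1 pY) !mulmxA -(mulmxA D Y Y) YY.
  have -> : \tr ((D *m Y)^T *m G y) = \tr (D^T *m (S y - S x)).
    rewrite trmx_mul (proj1 pY) /G mulmxA mxtrace_mulC !mulmxA mulVmx // mul1mx //.
  rewrite -(diffX Ax Ay) -/D mulmxDr mxtraceD.
  rewrite [\tr (D *m X x *m D^T)]mxtrace_mulC lerDr mulmxA -{2}[D]trmxK.
  exact: trace_ge0 (pX Ay).
have cG : {for x, continuous (fun y => \tr ((G y)^T *m G y))}.
  have h : Ckmx 0 A (fun y => (G y)^T *m G y).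
    have hG : Ckmx 0 A G.
      by apply: CkmxM => //; [apply: CkmxB => //; exact: Ckmx_cst|exact: Ckmx_cst].
    by apply: CkmxM => //; apply: Ckmx_tr.
  by apply: continuous_sumr => i _; exact: h.
have G0 : \tr ((G x)^T *m G x) = 0 by rewrite /G subrr mul0mx mulmx0 mxtrace0.
move=> i j; apply/(cvgrPdist_lt (F := nbhs x)) => e e0.
have nG : \forall y \near x, \tr ((G y)^T *m G y) < e ^+ 2.
  move/cvgrPdist_lt : cG => /(_ (e ^+ 2) (exprn_gt0 2 e0)).
  apply: filterS => y; rewrite G0 sub0r normrN; exact/le_lt_trans/ler_norm.
have nA : \forall y \near x, A y by exact: open_nbhs_nbhs.
near=> y.
rewrite subrr mul0mx [X in X - _]mxE sub0r normrN ltNge; apply/negP => ee.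
have Gy : \tr ((G y)^T *m G y) < e ^+ 2 by near: y.
have Ay : A y by near: y.
have := le_lt_trans (bound y Ay i j) Gy.
by rewrite ltNge -[X in _ <= X]real_normK ?num_real // lerXn2r // nnegrE ltW.
Unshelve. all: by end_near. Qed.

(** By [diffX] the difference quotient of the root is that of S times the inverse Sylvester operator
    at (X y, X x); continuity of X lets y tend to x. *)
Let derX v x : Ckmx 0 A S -> A x ->
  (forall i j, derivable (fun y => S y i j) x v) ->
  forall i j, derivable (fun y => X y i j) x v /\
   'D_v (fun y => X y i j) x =
     vec_mx (mxvec (\matrix_(a, b) 'D_v (fun y => S y a b) x)
             *m invmx (sylv (X x) (X x))) i j.
Proof.
move=> cS Ax dS i j.
pose K y := invmx (sylv (X y) (X x)).
have cK : Ckmx 0 A K.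
  apply: Ckmx_inv => //; first by move=> y Ay; apply: sylv_unit; exact: pX.
  by apply: Ckmx_sylv => //; [exact: cX|exact: Ckmx_cst].
have limh : (fun h : R => h *: v + x) @ 0^' --> x.
  rewrite -[X in _ --> X]add0r -[X in _ --> X + _](scale0r v).
  apply: cvgD; last exact: cvg_cst.
  by apply: cvgZr_tmp; apply: nbhs_dnbhs.
have nA : \forall h \near (0 : R)^', A (h *: v + x).
  by apply: limh; exact: open_nbhs_nbhs.
suff lim : (fun h : R => h^-1 *: (((fun y => X y i j) \o shift x) (h *: v) - X x i j)) @ 0^' -->
   vec_mx (mxvec (\matrix_(a, b) 'D_v (fun y => S y a b) x)
             *m invmx (sylv (X x) (X x))) i j.
  by split; [apply/cvg_ex; eexists; exact: lim|exact: cvg_lim lim].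
rewrite [X in _ --> X]mxE [X in _ --> X]mxE.
pose T (h : R) l : R := h^-1 * mxvec (S (h *: v + x) - S x) 0 l.
apply: (@cvg_trans _ ((fun h : R => \sum_l T h l * K (h *: v + x) l (mxvec_index i j)) @ 0^')).
  apply: near_eq_cvg; near=> h.
  have Ah : A (h *: v + x) by near: h.
  have e : mxvec (X (h *: v + x) - X x) = mxvec (S (h *: v + x) - S x) *m K (h *: v + x).
    by rewrite -diffX // -sylvE mulmxK // sylv_unit //; exact: pX.
  have -> : ((fun y => X y i j) \o shift x) (h *: v) - X x i j =
       mxvec (X (h *: v + x) - X x) 0 (mxvec_index i j).
    by rewrite mxvecE !mxE.
  rewrite e mxE [RHS]mulr_sumr; apply: eq_bigr => l _.
  by rewrite /T mulrA.
apply: cvg_big => [|l _].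
  exact: add_continuous.
apply: cvgM; last first.
  have := cK l (mxvec_index i j) x Ax.
  by move=> /(cvg_comp _ _ limh).
case/mxvec_indexP: l => a b.
rewrite [X in _ --> X](_ : _ = 'D_v (fun y => S y a b) x); last first.
  by rewrite mxvecE mxE.
have := dS a b; rewrite /derivable /derive; set q := (fun h : R => _).
have -> : q = T^~ (mxvec_index a b); last exact.
by apply/funext => h; rewrite /T mxvecE !mxE.
Unshelve. all: by end_near. Qed.

(** Bootstrapping: the formula of [derX] expresses the derivative of the root through the derivative
    of S and the root itself, so a root of class C^l is of class C^(l+1) as long as S allows it. *)
Lemma Ckmx_sqrt k : Ckmx k A S -> Ckmx k A X.
Proof.
suff h l : (l <= k)%N -> Ckmx k A S -> Ckmx l A X by exact: h.
move=> lk hS; have hS0 : Ckmx 0 A S.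
  by move=> i j; exact: (Ck_le oA (leq0n k) (hS i j)).
elim: l lk => [|l ih] lk; first exact: cX.
have hX := ih (ltnW lk).
have hSl : Ckmx l.+1 A S by move=> i j; exact: (Ck_le oA lk (hS i j)).
have D (x v : 'rV[R]_m) : A x -> forall i j, derivable (fun y => S y i j) x v.
  by move=> Ax i j; apply: diff_derivable; exact: (Ck_differentiable oA (hSl i j) Ax).
move=> i j e; split.
  by move=> x Ax; case: (derX hS0 Ax (D x (delta_mx 0 e) Ax) i j).
have h : Ckmx l A (fun x => vec_mx (mxvec (\matrix_(a, b) 'D_(delta_mx 0 e) (fun y => S y a b) x)
             *m invmx (sylv (X x) (X x)))).
  apply: Ckmx_vec => //; apply: CkmxM => //.
    apply: Ckmx_mxvec => // a b; have [_ hab] := hSl a b e.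
    by apply: (Ck_ext oA) hab => x _; rewrite mxE.
  apply: Ckmx_inv => //; last exact: Ckmx_sylv.
  by move=> x Ax; apply: sylv_unit; exact: pX.
apply: (Ck_ext oA) (h i j) => x Ax.
by case: (derX hS0 Ax (D x (delta_mx 0 e) Ax) i j).
Qed.

End SmoothSquareRoot.

(** * Smooth maps and tensor fields on manifolds *)

Lemma Ck_local (R : realType) m k (A : set 'rV[R]_m) f :
  (forall x, A x -> exists2 B, B x & Ck k B f) -> Ck k A f.
Proof.
elim: k f => [|k ih] f h.
  by move=> x Ax; have [B Bx hB] := h x Ax; exact: hB.
move=> i; split.
  by move=> x Ax; have [B Bx hB] := h x Ax; have [+ _] := hB i; exact.
by apply: ih => x Ax; have [B Bx hB] := h x Ax; exists B => //; have [] := hB i.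
Qed.

Lemma derive_coord (R : realType) m (x v : 'rV[R]_m) j :
  'D_v (fun y : 'rV[R]_m => y 0 j) x = v 0 j.
Proof.
have q : \forall h \near (0 : R)^', h^-1 *: (((fun x : 'rV[R]_m => x 0 j) \o
    shift x) (h *: v) - x 0 j) = v 0 j :> R.
  near=> h; rewrite /= !mxE addrK.
  by rewrite /GRing.scale /= mulKf //; near: h; exact: nbhs_dnbhs_neq.
by rewrite -[RHS](lim_near_cst _ q).
Unshelve. all: by end_near. Qed.

Section Charts.
Context {R : realType} {m : nat} {T : topologicalType}.
Implicit Types (c d e : chart R m T) (p : T).

Lemma cimg_map c p : cdom c p -> cimg c (cmap c p).
Proof. by move=> cp; exists p. Qed.

Lemma cimg_inv c x : cimg c x -> cdom c (cinv c x) /\ cmap c (cinv c x) = x.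
Proof. by move=> [p cp <-]; rewrite cmapK. Qed.

Lemma open_chart_image c (U : set T) : open U -> open (cmap c @` (cdom c `&` U)).
Proof.
move=> oU; rewrite openE => _ [p [cp Up] <-]; rewrite /interior.
have n1 : \forall x \near cmap c p, cimg c x.
  by apply: open_nbhs_nbhs; split; [exact: cimg_open|exact: cimg_map].
have n2 : \forall x \near cmap c p, U (cinv c x).
  apply: (@cinv_continuous _ _ _ c _ (cimg_map cp)).
  by rewrite cmapK //; exact: open_nbhs_nbhs.
near=> x.
have [dx <-] : cdom c (cinv c x) /\ cmap c (cinv c x) = x by apply: cimg_inv; near: x.
by exists (cinv c x) => //; split=> //; near: x.
Unshelve. all: by end_near. Qed.

Lemma smooth_transition_refl c : smooth_transition c c.
Proof.
move=> j k; rewrite setIid.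
apply: (@Ck_ext _ _ _ _ (fun x => x 0 j)) (Ck_coord _ _ _); first exact: cimg_open.
by move=> _ [p cp <-]; rewrite cmapK.
Qed.

Lemma transition_differentiable c d p : smooth_transition c d ->
  cdom c p -> cdom d p -> differentiable (cmap d \o cinv c) (cmap c p).
Proof.
move=> cd cp dp; apply: differentiable_row => j.
apply: (@Ck_differentiable _ _ 0 (cmap c @` (cdom c `&` cdom d))).
- by apply: open_chart_image; exact: cdom_open.
- exact: cd.
- by exists p.
Qed.

Lemma jacE c d p i j : smooth_transition c d -> cdom c p -> cdom d p ->
  jac c d p i j = 'D_(delta_mx 0 i) (fun x => cmap d (cinv c x) 0 j) (cmap c p).
Proof.
move=> cd cp dp; have df := transition_differentiable cd cp dp.
rewrite /jac /jacobian mxE -deriveE // derive_mx; last exact: diff_derivable.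
by rewrite mxE.
Qed.

#[global] Opaque jac.

Lemma jac_cocycle c d e p :
  smooth_transition c d -> smooth_transition d e -> smooth_transition c e ->
  cdom c p -> cdom d p -> cdom e p -> jac c e p = jac c d p *m jac d e p.
Proof.
move=> cd de ce cp dp ep; apply/matrixP => i j; rewrite (jacE i j ce cp ep) mxE.
have df := transition_differentiable cd cp dp.
have dg : differentiable (fun y => cmap e (cinv d y) 0 j) (cmap d (cinv c (cmap c p))).
  rewrite cmapK //; have := transition_differentiable de dp ep => h.
  apply: (@Ck_differentiable _ _ 0 (cmap d @` (cdom d `&` cdom e))).
  - by apply: open_chart_image; exact: cdom_open.
  - exact: de.
  - by exists p.
have [_ Dgf] := derive_chain (delta_mx 0 i) df dg.
transitivity ('D_(delta_mx 0 i)
    ((fun y => cmap e (cinv d y) 0 j) \o (cmap d \o cinv c)) (cmap c p)).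
  apply: near_eq_derive; apply: (@open_near_eq _ _ (cmap c @` (cdom c `&` cdom d))).
  - by apply: open_chart_image; exact: cdom_open.
  - by exists p.
  - by move=> _ [q [cq dq] <-] /=; rewrite cmapK // cmapK.
have ep' : (cmap d \o cinv c) (cmap c p) = cmap d p by rewrite /= cmapK.
rewrite ep' in Dgf; apply: etrans Dgf _; apply: eq_bigr => l _.
congr (_ * _); symmetry; first exact: (jacE i l cd cp dp).
exact: (jacE l j de dp ep).
Qed.

Lemma jac_id c p : cdom c p -> jac c c p = 1%:M.
Proof.
move=> cp; apply/matrixP => i j; rewrite (jacE i j (smooth_transition_refl c) cp cp).
transitivity ('D_(delta_mx 0 i) (fun x : 'rV[R]_m => x 0 j) (cmap c p)); last first.
  by rewrite derive_coord !mxE eqxx /= eq_sym.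
apply: (@near_eq_derive _ _ _ _ (fun x : 'rV[R]_m => x 0 j)).
apply: (@open_near_eq _ _ (cimg c)); [exact: cimg_open|exact: cimg_map|].
by move=> x /cimg_inv[_ ->].
Qed.

End Charts.
Arguments open_chart_image {R m T} c {U}.

Section SmoothOnManifold.
Context {R : realType} {m : nat} (M : manifold R m).
Implicit Types (c d e : chart R m M) (p : M) (U V : set M).

(** The charts of an oriented cover need not belong to the atlas, so the calculus of components is
    developed for every chart smoothly related to it. *)
Definition compatible c := forall d, atlas d ->
  smooth_transition c d /\ smooth_transition d c.

Lemma atlas_compatible c : atlas c -> compatible c.
Proof. by move=> ac d ad; split; exact: atlas_smooth. Qed.

Definition smf U (f : M -> R) : Prop :=
  forall c, atlas c -> forall k, Ck k (cmap c @` (cdom c `&` U)) (f \o cinv c).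

Definition smo r s U (F : M -> 'M[R]_(r, s)) : Prop :=
  forall i j, smf U (fun p => F p i j).

Lemma smoP r s U (F : M -> 'M[R]_(r, s)) : smo U F <->
  forall c, atlas c -> forall k, Ckmx k (cmap c @` (cdom c `&` U)) (F \o cinv c).
Proof. by split=> h; [move=> c ac k i j|move=> i j c ac k]; apply: h. Qed.

Lemma smf_local U f : (forall p, U p -> exists2 V, V p & smf V f) -> smf U f.
Proof.
move=> h c ac k; apply: Ck_local => _ [p [cp Up] <-].
have [V Vp hV] := h p Up.
by exists (cmap c @` (cdom c `&` V)); [exists p|exact: hV].
Qed.

Lemma smo_local r s U (F : M -> 'M[R]_(r, s)) :
  (forall p, U p -> exists2 V, V p & smo V F) -> smo U F.
Proof.
move=> h i j; apply: smf_local => p /h[V Vp hV].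
by exists V => //; exact: hV.
Qed.

Lemma smf_ext U f g : open U -> (forall p, U p -> f p = g p) -> smf U f -> smf U g.
Proof.
move=> oU fg h c ac k; apply: Ck_ext (h c ac k); first exact: open_chart_image.
by move=> _ [p [cp Up] <-] /=; rewrite cmapK // fg.
Qed.

Lemma smo_ext r s U (F G : M -> 'M[R]_(r, s)) : open U ->
  (forall p, U p -> F p = G p) -> smo U F -> smo U G.
Proof. by move=> oU FG h i j; apply: smf_ext (h i j) => // p /FG ->. Qed.

Lemma smf_sub U V f : U `<=` V -> smf V f -> smf U f.
Proof.
move=> UV h c ac k; apply: Ck_subset (h c ac k).
by move=> _ [p [cp Up] <-]; exists p => //; split=> //; exact: UV.
Qed.

Lemma smo_sub r s U V (F : M -> 'M[R]_(r, s)) : U `<=` V -> smo V F -> smo U F.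
Proof. by move=> UV h i j; apply: smf_sub (h i j). Qed.

Lemma smf_chart c U f : compatible c -> open U -> U `<=` cdom c ->
  (forall k, Ck k (cmap c @` U) (f \o cinv c)) -> smf U f.
Proof.
move=> cc oU Uc h d ad k; have [_ dc] := cc d ad.
have oA := open_chart_image d oU.
have UE : cdom c `&` U = U by rewrite setIC; apply/setIidPl.
rewrite -UE in h.
apply: (@Ck_ext _ _ _ _ ((f \o cinv c) \o (cmap c \o cinv d))) => //.
  by move=> _ [p [dp Up] <-] /=; rewrite cmapK // cmapK //; exact: Uc.
apply: (Ck_comp oA (open_chart_image c oU)) (h k).
  move=> _ [p [dp Up] <-] /=; rewrite cmapK //; exists p => //; split=> //; exact: Uc.
move=> j; apply: Ck_subset (dc j k).
by move=> _ [p [dp Up] <-]; exists p => //; split=> //; exact: Uc.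
Qed.

Lemma smo_chart r s c U (F : M -> 'M[R]_(r, s)) : compatible c -> open U -> U `<=` cdom c ->
  (forall k, Ckmx k (cmap c @` U) (F \o cinv c)) -> smo U F.
Proof. by move=> cc oU Uc h i j; apply: (smf_chart cc) => // k; exact: h. Qed.

Section Operations.
Variable U : set M.
Hypothesis oU : open U.
Let oA c := open_chart_image c oU.

Lemma smf_cst a : smf U (fun=> a).
Proof. by move=> c ac k; exact: Ck_cst. Qed.

Lemma smfD f g : smf U f -> smf U g -> smf U (fun p => f p + g p).
Proof. by move=> hf hg c ac k; exact: (CkD (@oA c) (hf c ac k) (hg c ac k)). Qed.

Lemma smfM f g : smf U f -> smf U g -> smf U (fun p => f p * g p).
Proof. by move=> hf hg c ac k; exact: (CkM (@oA c) (hf c ac k) (hg c ac k)). Qed.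

Lemma smfN f : smf U f -> smf U (fun p => - f p).
Proof. by move=> hf c ac k; exact: (CkN (@oA c) (hf c ac k)). Qed.

Lemma smf_prod (I : Type) (l : seq I) (f : I -> M -> R) :
  (forall i, smf U (f i)) -> smf U (fun p => \prod_(i <- l) f i p).
Proof. by move=> hf c ac k; apply: (Ck_prod l (@oA c)) => i _; exact: hf. Qed.

Lemma smfV f : (forall p, U p -> f p != 0) -> smf U f -> smf U (fun p => (f p)^-1).
Proof.
move=> f0 hf c ac k; apply: (CkV (@oA c)) (hf c ac k).
by move=> _ [p [cp Up] <-] /=; rewrite cmapK // f0.
Qed.

Lemma smf_sqrt (f : M -> R) : (forall p, U p -> 0 < f p) -> smf U f ->
  smf U (fun p => Num.sqrt (f p)).
Proof.
move=> f0 hf c ac k; apply: (Ck_sqrt (@oA c)) (hf c ac k).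
by move=> _ [p [cp Up] <-] /=; rewrite cmapK // f0.
Qed.

Lemma smo_cst r s (B : 'M[R]_(r, s)) : smo U (fun=> B).
Proof. by move=> i j; exact: smf_cst. Qed.

Lemma smoD r s (F G : M -> 'M[R]_(r, s)) : smo U F -> smo U G -> smo U (fun p => F p + G p).
Proof. by move=> /smoP hF /smoP hG; apply/smoP => c ac k; exact: (CkmxD (@oA c) (hF c ac k) (hG c ac k)). Qed.

Lemma smoN r s (F : M -> 'M[R]_(r, s)) : smo U F -> smo U (fun p => - F p).
Proof. by move=> /smoP hF; apply/smoP => c ac k; exact: (CkmxN (@oA c) (hF c ac k)). Qed.

Lemma smoB r s (F G : M -> 'M[R]_(r, s)) : smo U F -> smo U G -> smo U (fun p => F p - G p).
Proof. by move=> hF hG; apply: smoD => //; exact: smoN. Qed.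

Lemma smoZ r s f (F : M -> 'M[R]_(r, s)) : smf U f -> smo U F -> smo U (fun p => f p *: F p).
Proof. by move=> hf /smoP hF; apply/smoP => c ac k; exact: (CkmxZ (@oA c) (hf c ac k) (hF c ac k)). Qed.

Lemma smoM r s t (F : M -> 'M[R]_(r, s)) (G : M -> 'M[R]_(s, t)) :
  smo U F -> smo U G -> smo U (fun p => F p *m G p).
Proof. by move=> /smoP hF /smoP hG; apply/smoP => c ac k; exact: (CkmxM (@oA c) (hF c ac k) (hG c ac k)). Qed.

Lemma smo_sum r s (I : Type) (l : seq I) (P : pred I) (F : I -> M -> 'M[R]_(r, s)) :
  (forall i, P i -> smo U (F i)) -> smo U (fun p => \sum_(i <- l | P i) F i p).
Proof.
move=> hF; apply/smoP => c ac k.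
apply: (@Ckmx_sum _ _ k _ (@oA c) _ _ _ l P (fun i => F i \o cinv c)) => i Pi.
exact: (proj1 (smoP _ _) (hF i Pi)).
Qed.

Lemma smo_tr r s (F : M -> 'M[R]_(r, s)) : smo U F -> smo U (fun p => (F p)^T).
Proof. by move=> /smoP hF; apply/smoP => c ac k; exact: (Ckmx_tr (@oA c) (hF c ac k)). Qed.

Lemma smo_block r1 r2 s1 s2 (F : M -> 'M[R]_(r1, s1)) G H (K : M -> 'M[R]_(r2, s2)) :
  smo U F -> smo U G -> smo U H -> smo U K ->
  smo U (fun p => block_mx (F p) (G p) (H p) (K p)).
Proof.
move=> /smoP hF /smoP hG /smoP hH /smoP hK; apply/smoP => c ac k.
exact: (Ckmx_block (@oA c) (hF c ac k) (hG c ac k) (hH c ac k) (hK c ac k)).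
Qed.

Lemma smo_inv r (F : M -> 'M[R]_r) : (forall p, U p -> F p \in unitmx) ->
  smo U F -> smo U (fun p => invmx (F p)).
Proof.
move=> uF /smoP hF; apply/smoP => c ac k; apply: (Ckmx_inv (@oA c)) (hF c ac k).
by move=> _ [p [cp Up] <-] /=; rewrite cmapK // uF.
Qed.

Lemma smf_det r (F : M -> 'M[R]_r) : smo U F -> smf U (fun p => \det (F p)).
Proof. by move=> /smoP hF c ac k; exact: (Ck_det (@oA c) (hF c ac k)). Qed.

End Operations.

(** Near each point the transition factors through the preferred atlas chart of that point. *)
Lemma compatible_trans c e : compatible c -> compatible e -> smooth_transition c e.
Proof.
move=> cc ce j k; apply: Ck_local => _ [p [cp ep] <-].
pose d := chart_at p; have dp : cdom d p := chart_at_dom p.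
have [cd _] := cc d (chart_at_atlas p); have [_ de] := ce d (chart_at_atlas p).
have oU : open (cdom d `&` cdom e) by apply: openI; exact: cdom_open.
have oA := open_chart_image c oU; have oB := open_chart_image d oU.
exists (cmap c @` (cdom c `&` (cdom d `&` cdom e))); first by exists p.
apply: (@Ck_ext _ _ _ _ ((fun y => cmap e (cinv d y) 0 j) \o (cmap d \o cinv c))) => //.
  by move=> _ [q [cq [dq eq]] <-] /=; rewrite cmapK // cmapK.
apply: (Ck_comp oA oB).
- by move=> _ [q [cq [dq eq]] <-] /=; rewrite cmapK //; exists q.
- move=> l; apply: Ck_subset (cd l k).
  by move=> _ [q [cq [dq eq]] <-]; exists q.
- apply: Ck_subset (de j k).
  by move=> _ [q [dq [_ eq]] <-]; exists q.
Qed.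

Lemma jac_comp c d e p : compatible c -> compatible d -> compatible e ->
  cdom c p -> cdom d p -> cdom e p -> jac c e p = jac c d p *m jac d e p.
Proof. by move=> cc cd ce; apply: jac_cocycle; exact: compatible_trans. Qed.

Lemma jacK c d p : compatible c -> compatible d -> cdom c p -> cdom d p ->
  jac c d p *m jac d c p = 1%:M.
Proof. by move=> cc cd cp dp; rewrite -jac_comp // jac_id. Qed.

Lemma jac_smooth c d : compatible c -> compatible d ->
  smo (cdom c `&` cdom d) (jac c d).
Proof.
move=> cc dd; have cd := compatible_trans cc dd.
have oU : open (cdom c `&` cdom d) by apply: openI; exact: cdom_open.
apply: (smo_chart cc) => //.
move=> k i j; have [_ h] := cd j k.+1 i.
apply: Ck_ext h.
  have := open_chart_image c oU; congr open; congr (_ @` _).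
  by rewrite setIA setIid.
by move=> _ [p [cp dp] <-] /=; rewrite cmapK // -jacE.
Qed.

Section Tensorial.
Context {r s : nat} (F : chart R m M -> M -> 'M[R]_(r, s)).

(** A common form of the transformation rules of vectors, covectors, bilinear forms and
    endomorphisms, so that independence of the chart is proved once for the four. *)
Definition tensorial : Prop :=
  exists (L : chart R m M -> chart R m M -> M -> 'M[R]_r)
         (Q : chart R m M -> chart R m M -> M -> 'M[R]_s),
  (forall c d, compatible c -> compatible d ->
     smo (cdom c `&` cdom d) (L c d) /\ smo (cdom c `&` cdom d) (Q c d)) /\
  forall c d p, compatible c -> compatible d -> cdom c p -> cdom d p ->
    F d p = L c d p *m F c p *m Q c d p.

Hypothesis tF : tensorial.

Lemma tensorial_change c d U : compatible c -> compatible d -> open U ->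
  U `<=` cdom c `&` cdom d -> smo U (F c) -> smo U (F d).
Proof.
move=> cc cd oU Ucd hF; have [L [Q [sLQ FE]]] := tF.
have [sL sQ] := sLQ c d cc cd.
apply: (@smo_ext _ _ _ (fun p => L c d p *m F c p *m Q c d p)) => //.
  by move=> p /Ucd[cp dp]; rewrite (FE c d p cc cd cp dp).
by apply: smoM => //; [apply: smoM => //|]; exact: smo_sub Ucd _.
Qed.

Lemma tensor_intro :
  (forall p, exists c U, [/\ compatible c, open U, U p, U `<=` cdom c & smo U (F c)]) ->
  smooth_components F.
Proof.
move=> h d ad; suff hd : smo (cdom d) (F d).
  by move=> i j k; have := hd i j d ad k; rewrite setIid.
apply: smo_local => p dp; have [c [U [cc oU Up Uc hF]]] := h p.
exists (U `&` cdom d) => //.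
have oUd : open (U `&` cdom d) by apply: openI => //; exact: cdom_open.
apply: (tensorial_change cc (atlas_compatible ad) oUd).
  by move=> q [Uq dq]; split=> //; exact: Uc.
by apply: smo_sub hF => q [].
Qed.

Lemma tensor_elim c : compatible c -> smooth_components F -> smo (cdom c) (F c).
Proof.
move=> cc hF.
have ha d : atlas d -> smo (cdom d) (F d).
  move=> ad; apply: (smo_chart (atlas_compatible ad)) => //; first exact: cdom_open.
  by move=> k i j; exact: hF.
apply: smo_local => p cp; have ap := chart_at_atlas p.
exists (cdom (chart_at p) `&` cdom c); first by split=> //; exact: chart_at_dom.
apply: (tensorial_change (atlas_compatible ap) cc) => //.
  by apply: openI; exact: cdom_open.
by apply: smo_sub (ha _ ap) => q [].
Qed.

End Tensorial.

(** The components of the four kinds of fields in a chart c, computed from those in the preferred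
    chart at p. *)
Definition vecc (X : M -> 'rV[R]_m) c p := X p *m jac (chart_at p) c p.
Definition covc (eta : M -> 'cV[R]_m) c p := jac c (chart_at p) p *m eta p.
Definition bilc (B : M -> 'M[R]_m) c p :=
  jac c (chart_at p) p *m B p *m (jac c (chart_at p) p)^T.
Definition endc (theta : M -> 'M[R]_m) c p :=
  jac c (chart_at p) p *m theta p *m jac (chart_at p) c p.

Let at_ok p : compatible (chart_at p : chart R m M) /\ cdom (chart_at p) p.
Proof. by split; [exact/atlas_compatible/chart_at_atlas|exact: chart_at_dom]. Qed.

Lemma vecc_change X c d p : compatible c -> compatible d -> cdom c p -> cdom d p ->
  vecc X d p = vecc X c p *m jac c d p.
Proof.
move=> cc cd cp dp; have [ca pa] := at_ok p.
by rewrite /vecc (jac_comp ca cc cd pa cp dp) mulmxA.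
Qed.

Lemma covc_change eta c d p : compatible c -> compatible d -> cdom c p -> cdom d p ->
  covc eta d p = jac d c p *m covc eta c p.
Proof.
move=> cc cd cp dp; have [ca pa] := at_ok p.
by rewrite /covc (jac_comp cd cc ca dp cp pa) mulmxA.
Qed.

Lemma bilc_change B c d p : compatible c -> compatible d -> cdom c p -> cdom d p ->
  bilc B d p = jac d c p *m bilc B c p *m (jac d c p)^T.
Proof.
move=> cc cd cp dp; have [ca pa] := at_ok p.
by rewrite /bilc (jac_comp cd cc ca dp cp pa) trmx_mul !mulmxA.
Qed.

Lemma endc_change theta c d p : compatible c -> compatible d -> cdom c p -> cdom d p ->
  endc theta d p = jac d c p *m endc theta c p *m jac c d p.
Proof.
move=> cc cd cp dp; have [ca pa] := at_ok p.
by rewrite /endc (jac_comp cd cc ca dp cp pa) (jac_comp ca cc cd pa cp dp) !mulmxA.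
Qed.

Let sm1 r U : smo U (fun=> 1%:M : 'M[R]_r). Proof. exact: smo_cst. Qed.

Lemma vec_tensorial X : tensorial (vecc X).
Proof.
exists (fun _ _ _ => 1%:M), (fun c d => jac c d); split=> [c d cc cd|c d p cc cd cp dp].
  by split; [exact: sm1|exact: jac_smooth].
by rewrite mul1mx (vecc_change _ cc cd cp dp).
Qed.

Lemma cov_tensorial eta : tensorial (covc eta).
Proof.
exists (fun c d => jac d c), (fun _ _ _ => 1%:M); split=> [c d cc cd|c d p cc cd cp dp].
  by split; [rewrite setIC; exact: jac_smooth|exact: sm1].
by rewrite mulmx1 (covc_change _ cc cd cp dp).
Qed.

Lemma bil_tensorial B : tensorial (bilc B).
Proof.
exists (fun c d => jac d c), (fun c d p => (jac d c p)^T); split=> [c d cc cd|c d p cc cd cp dp].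
  have h : smo (cdom c `&` cdom d) (jac d c) by rewrite setIC; exact: jac_smooth.
  split=> //; apply: smo_tr => //; apply: openI; exact: cdom_open.
by rewrite (bilc_change _ cc cd cp dp).
Qed.

Lemma end_tensorial theta : tensorial (endc theta).
Proof.
exists (fun c d => jac d c), (fun c d => jac c d); split=> [c d cc cd|c d p cc cd cp dp].
  by split; [rewrite setIC; exact: jac_smooth|exact: jac_smooth].
by rewrite (endc_change _ cc cd cp dp).
Qed.

Lemma vector_fieldP X : vector_field X <-> forall c, compatible c -> smo (cdom c) (vecc X c).
Proof.
split=> [h c cc|h]; first exact: (tensor_elim (vec_tensorial X) cc h).
apply: (tensor_intro (vec_tensorial X)) => p; have [ca pa] := at_ok p.
by exists (chart_at p), (cdom (chart_at p)); split=> //; [exact: cdom_open|exact: h].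
Qed.

Lemma bilinear_fieldP B : bilinear_field B <-> forall c, compatible c -> smo (cdom c) (bilc B c).
Proof.
split=> [h c cc|h]; first exact: (tensor_elim (bil_tensorial B) cc h).
apply: (tensor_intro (bil_tensorial B)) => p; have [ca pa] := at_ok p.
by exists (chart_at p), (cdom (chart_at p)); split=> //; [exact: cdom_open|exact: h].
Qed.

Lemma one_formP eta : one_form eta <-> forall c, compatible c -> smo (cdom c) (covc eta c).
Proof.
split=> [h c cc|h]; first exact: (tensor_elim (cov_tensorial eta) cc h).
apply: (tensor_intro (cov_tensorial eta)) => p; have [ca pa] := at_ok p.
by exists (chart_at p), (cdom (chart_at p)); split=> //; [exact: cdom_open|exact: h].
Qed.

Lemma endomorphism_fieldP theta :
  endomorphism_field theta <-> forall c, compatible c -> smo (cdom c) (endc theta c).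
Proof.
split=> [h c cc|h]; first exact: (tensor_elim (end_tensorial theta) cc h).
apply: (tensor_intro (end_tensorial theta)) => p; have [ca pa] := at_ok p.
by exists (chart_at p), (cdom (chart_at p)); split=> //; [exact: cdom_open|exact: h].
Qed.

Lemma smooth_functionP f : smooth_function f <-> smf setT f.
Proof. by split=> h c ac k; have := h c ac k; rewrite setIT. Qed.

End SmoothOnManifold.

(** * Partitions of unity and Riemannian metrics *)

Section Bumps.
Context {R : realType} {m : nat} (M : manifold R m).
Implicit Types (c d : chart R m M) (p q : M) (U V : set M).

Definition box_bump (a : 'rV[R]_m) (e : R) (x : 'rV[R]_m) : R :=
  \prod_j (step (2 - (x 0 j - a 0 j) / e) * step (2 + (x 0 j - a 0 j) / e)).

Lemma box_bump_Ck k a e : Ck k setT (box_bump a e).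
Proof.
have h j : Ck k setT (fun x : 'rV[R]_m => (x 0 j - a 0 j) / e).
  apply: CkM (Ck_cst _ _ _) => //; first exact: openT.
  by apply: CkD (Ck_cst _ _ _) => //; [exact: openT|exact: Ck_coord].
apply: Ck_prod => [|j _]; first exact: openT.
apply: CkM; first exact: openT.
- apply: Ck_step; first exact: openT.
  by apply: CkD (Ck_cst _ _ _) _; [exact: openT|apply: CkN; [exact: openT|exact: h]].
- apply: Ck_step; first exact: openT.
  by apply: CkD (Ck_cst _ _ _) _; [exact: openT|exact: h].
Qed.

Lemma box_bump_ge0 a e x : 0 <= box_bump a e x.
Proof. by apply: prodr_ge0 => j _; rewrite mulr_ge0 // step_ge0. Qed.

Lemma box_bump_le1 a e x : box_bump a e x <= 1.
Proof.
rewrite /box_bump; pose P (y : R) := 0 <= y <= 1.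
suff /andP[] : P (\prod_j (step (2 - (x 0 j - a 0 j) / e) * step (2 + (x 0 j - a 0 j) / e))) by [].
have PM y z : P y -> P z -> P (y * z).
  by move=> /andP[y0 y1] /andP[z0 z1]; rewrite /P mulr_ge0 // mulr_ile1.
apply: (big_ind P) => // [|j _]; first by rewrite /P ler01 lexx.
by apply: PM; rewrite /P step_ge0 step_le1.
Qed.

Lemma box_bump_eq1 (a x : 'rV[R]_m) e :
  0 < e -> (forall j, `|x 0 j - a 0 j| <= e) -> box_bump a e x = 1.
Proof.
move=> e0 h; rewrite /box_bump big1 // => j _.
have : `|(x 0 j - a 0 j) / e| <= 1.
  by rewrite normrM normfV (gtr0_norm e0) ler_pdivrMr // mul1r.
rewrite ler_norml => /andP[h1 h2].
by rewrite !step_ge1 ?mulr1 //; lra.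
Qed.

Lemma box_bump_eq0 (a x : 'rV[R]_m) e : 0 < e ->
  ~ (forall j, `|x 0 j - a 0 j| <= 2 * e) -> box_bump a e x = 0.
Proof.
move=> e0 /existsNP[j /negP]; rewrite -ltNge => h.
rewrite /box_bump (bigD1 j) //=.
have : 2 < `|(x 0 j - a 0 j) / e|.
  by rewrite normrM normfV (gtr0_norm e0) ltr_pdivlMr.
rewrite ltr_normr => /orP[h2|h2].
  by rewrite (@step_le0 _ (2 - _)) ?mul0r //; lra.
by rewrite (@step_le0 _ (2 + (x 0 j - a 0 j) / e)) ?mulr0 ?mul0r //; lra.
Qed.

Lemma smo_vanish U (f : M -> R) : open U -> (forall p, U p -> f p = 0) -> smf U f.
Proof. by move=> oU f0; apply: smf_ext (@smf_cst _ _ _ _ 0) => // p /f0. Qed.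

(** Vanishing off the domain would not make an extension by zero smooth at boundary points; a whole
    neighbourhood of zeros does. *)
Definition supported c (f : M -> R) : Prop :=
  forall q, ~ cdom c q -> exists W, [/\ open W, W q & forall q', W q' -> f q' = 0].

Lemma bump_ex c p : compatible c -> cdom c p -> exists (f : M -> R) V,
  [/\ open V, V p & smf setT f] /\
  [/\ forall q, 0 <= f q <= 1, forall q, V q -> f q = 1 & supported c f].
Proof.
move=> cc cp; pose a := cmap c p.
have [r /= r0 rc] : exists2 r : R, 0 < r & ball a r `<=` cimg c.
  apply/nbhs_ballP; apply: open_nbhs_nbhs; split; [exact: cimg_open|exact: cimg_map].
(* The bump lives on the box of radius 2e, which must stay inside the ball of radius r = 3e. *)
pose e := r / 3; have e0 : 0 < e by rewrite divr_gt0.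
pose f q := if pselect (cdom c q) then box_bump a e (cmap c q) else 0.
have fin q : cdom c q -> f q = box_bump a e (cmap c q) by rewrite /f; case: pselect.
have fout q : ~ cdom c q -> f q = 0 by rewrite /f; case: pselect.
pose box : set 'rV[R]_m := [set x | forall j, `[a 0 j - 2 * e, a 0 j + 2 * e]%classic (x 0 j)].
have boxP x : box x <-> forall j, `|x 0 j - a 0 j| <= 2 * e.
  by split=> h j; have := h j; rewrite /= in_itv /= ler_distl.
have boxc : box `<=` cimg c.
  move=> x /boxP xb; apply: rc; rewrite -ball_normE /=.
  apply: (@le_lt_trans _ _ (2 * e)); last by rewrite /e; lra.
  apply: rV_norm_le => [|j]; first by rewrite mulr_ge0 // ltW.
  by rewrite !mxE distrC.
(* The box is compact in coordinates, hence its preimage is compact and, the manifold being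
   Hausdorff, closed. This is what makes the bump vanish near points outside the chart. *)
have cK : compact (cinv c @` box).
  apply: continuous_compact.
    apply: continuous_in_subspaceT => x; rewrite inE => bx.
    by apply: cinv_continuous; exact: boxc.
  by apply: (@rV_compact R m (fun j => `[a 0 j - 2 * e, a 0 j + 2 * e]%classic)) => j; exact: segment_compact.
have oW : open (~` (cinv c @` box)).
  by apply: closed_openC; apply: compact_closed => //; exact: mspace_hausdorff.
have f0 q : ~ (cinv c @` box) q -> f q = 0.
  move=> nq; have [cq|cq] := pselect (cdom c q); last exact: fout.
  rewrite fin // box_bump_eq0 // => h; apply: nq; exists (cmap c q); last exact: cmapK.
  exact/boxP.
have suppf : supported c f.
  move=> q cq; exists (~` (cinv c @` box)); split=> // -[x /boxc xc xq].
  by apply: cq; rewrite -xq; case: (cimg_inv xc).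
pose V := cdom c `&` [set q | ball a e (cmap c q)].
have oV : open V.
  rewrite openE => q [cq aq]; rewrite /interior.
  have n1 : \forall q' \near q, cdom c q'.
    by apply: open_nbhs_nbhs; split=> //; exact: cdom_open.
  have n2 : \forall q' \near q, ball a e (cmap c q').
    apply: (cmap_continuous cq); apply: open_nbhs_nbhs; split=> //.
    exact: ball_open.
  by apply: filterS2 n1 n2 => q' c1 c2; split.
exists f, V; split; split=> //.
- by split=> //; exact: ballxx.
- apply: smf_local => q _; have [cq|cq] := pselect (cdom c q).
    exists (cdom c) => //; apply: (smf_chart cc) => //; first exact: cdom_open.
    move=> k; apply: Ck_ext (Ck_subset (@subsetT _ _) (box_bump_Ck k a e)).
      exact: cimg_open.
    by move=> _ [q' cq' <-] /=; rewrite cmapK // fin.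
  have [W [oW' Wq W0]] := suppf q cq.
  by exists W => //; exact: smo_vanish.
- move=> q; have [cq|cq] := pselect (cdom c q); last by rewrite fout // lexx ler01.
  by rewrite fin // box_bump_ge0 box_bump_le1.
- move=> q [cq aq]; rewrite fin // box_bump_eq1 // => j.
  move: aq; rewrite /= -ball_normE /= => /ltW; apply: le_trans.
  by rewrite distrC; have := rV_norm_entry (a - cmap c q) j; rewrite !mxE.
Qed.

(** Lindelof argument: for each basic open set that fits into some V p, one such p is selected,
    indexed by the code of the basic set. *)
Lemma countable_subcover (V : M -> set M) (p0 : M) :
  (forall p, open (V p) /\ V p p) -> exists x : nat -> M, forall q, exists i, V (x i) q.
Proof.
move=> oV; have [B /countable_injP[g ginj] [Bo Bb]] := @mspace_second_countable _ _ M.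
pose Q i (p : M) := exists U, [/\ B U, g U = i & U `<=` V p].
(* [p0] is a dummy value for integers that code no suitable basic set. *)
exists (fun i => xget p0 (Q i)) => q.
have [oq Vq] := oV q.
have [U [BU Uq] UV] := Bb q (V q) (open_nbhs_nbhs (conj oq Vq)).
exists (g U).
have [U' [BU' gU U'V]] : Q (g U) (xget p0 (Q (g U))) by apply: xgetPex; exists q, U.
by apply: U'V; rewrite (ginj U' U) ?inE.
Qed.

(** The weights f_i * prod_(j < i) (1 - f_j) have partial sums 1 - prod_(j < n) (1 - f_j). Where
    some f_K equals 1, every later weight vanishes and the sum is exactly 1, so local finiteness and
    normalization come together, without dividing by a sum. *)
Lemma partition_of_unity (p0 : M) :
  exists (x : nat -> M) (h : nat -> M -> R) (N : M -> nat),
  [/\ forall i, smf setT (h i),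
      forall i q, 0 <= h i q,
      forall i, supported (chart_at (x i)) (h i),
      forall p, exists V K, [/\ open V, V p & forall q i, V q -> (K <= i)%N -> h i q = 0] &
      forall q, (forall i, (N q <= i)%N -> h i q = 0) /\ \sum_(i < N q) h i q = 1].
Proof.
pose P (p : M) (fV : (M -> R) * set M) :=
  [/\ open fV.2, fV.2 p & smf setT fV.1] /\
  [/\ forall q, 0 <= fV.1 q <= 1, forall q, fV.2 q -> fV.1 q = 1 & supported (chart_at p) fV.1].
have [fV hfV] : {fV : M -> (M -> R) * set M & forall p, P p (fV p)}.
  apply: (@choice _ _ P) => p.
  have [f [V h]] := bump_ex (atlas_compatible (chart_at_atlas p)) (chart_at_dom p).
  by exists (f, V).
have [x hx] : exists x : nat -> M, forall q, exists i, (fV (x i)).2 q.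
  apply: (@countable_subcover (fun p => (fV p).2)) => // p.
  by have [[]] := hfV p.
pose f i := (fV (x i)).1.
pose h i q := f i q * \prod_(j < i) (1 - f j q).
have telescope n q : \sum_(i < n) h i q = 1 - \prod_(j < n) (1 - f j q).
  elim: n => [|n ih]; first by rewrite !big_ord0 subrr.
  by rewrite !big_ord_recr /= ih /h; ring.
have f01 i q : 0 <= f i q <= 1 by have [_ [h1 _ _]] := hfV (x i); exact: h1.
have h0 K i q : (fV (x K)).2 q -> (K < i)%N -> h i q = 0.
  move=> Vq Ki; rewrite /h (bigD1 (Ordinal Ki)) //=.
  by have [_ [_ f1 _]] := hfV (x K); rewrite /f f1 // subrr mul0r mulr0.
have [N hN] := choice hx.
exists x, h, (fun q => (N q).+1); split.
- move=> i; apply: smfM; first exact: openT.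
    by have [[]] := hfV (x i).
  apply: smf_prod => [|j]; first exact: openT.
  apply: smfD; [exact: openT|exact: smf_cst|apply: smfN; first exact: openT].
  by have [[]] := hfV (x j).
- move=> i q; rewrite mulr_ge0 //; first by case/andP: (f01 i q).
  by apply: prodr_ge0 => j _; rewrite subr_ge0; case/andP: (f01 j q).
- move=> i q nq; have [_ [_ _ s]] := hfV (x i).
  by have [W [oW Wq W0]] := s q nq; exists W; split=> // q' /W0; rewrite /h /f => ->; rewrite mul0r.
- move=> p; exists (fV (x (N p))).2, (N p).+1; have [[oV _ _] _] := hfV (x (N p)).
  by split=> // q i Vq; exact: h0.
- move=> q; split=> [i|]; first exact: h0.
  rewrite telescope big_ord_recr /=; have [_ [_ f1 _]] := hfV (x (N q)).
  by rewrite /f f1 // subrr mulr0 subr0.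
Qed.

Lemma smo_cutoff r s c (h : M -> R) (F : M -> 'M[R]_(r, s)) U :
  smf setT h -> supported c h -> open U ->
  smo (cdom c `&` U) F -> smo U (fun p => h p *: F p).
Proof.
move=> hh sh oU hF; apply: smo_local => q Uq.
have [cq|cq] := pselect (cdom c q).
  exists (cdom c `&` U) => //; apply: smoZ => //.
    by apply: openI => //; exact: cdom_open.
  exact: smf_sub (@subsetT _ _) hh.
have [W [oW Wq W0]] := sh q cq; exists W => //.
by apply: smo_ext (@smo_cst _ _ _ _ _ _ 0) => // p /W0 ->; rewrite scale0r.
Qed.

Lemma supported_out c h q : supported c h -> ~ cdom c q -> h q = 0.
Proof. by move=> sh cq; have [W [_ Wq ->]] := sh q cq. Qed.

(** Skew-symmetry of an endomorphism is stated on smooth fields; extending tangent vectors to fields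
    turns it into a pointwise identity. *)
Lemma vector_field_ex p (u : 'rV[R]_m) : exists2 X, vector_field X & X p = u.
Proof.
have cc := atlas_compatible (chart_at_atlas p); have cp := chart_at_dom p.
have [f [V [[oV Vp sf] [_ f1 supp]]]] := bump_ex cc cp.
pose c := chart_at p.
exists (fun q => f q *: (u *m jac c (chart_at q) q)); last first.
  by rewrite f1 // scale1r jac_id // mulmx1.
apply/vector_fieldP => d cd.
apply: (@smo_ext _ _ _ _ _ _ (fun q => f q *: (u *m jac c d q))); first exact: cdom_open.
  move=> q dq; rewrite /vecc -scalemxAl -mulmxA.
  have [cq|cq] := pselect (cdom c q); last by rewrite (supported_out supp) // !scale0r.
  have aq := atlas_compatible (chart_at_atlas q).
  by rewrite -(jac_comp cc aq cd cq (chart_at_dom q) dq).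
apply: smo_cutoff sf supp _ _; first exact: cdom_open.
apply: smoM; first (by apply: openI; exact: cdom_open); first exact: smo_cst.
exact: jac_smooth.
Qed.

End Bumps.

Section Forms.
Context {R : realType} {m : nat}.
Implicit Types (A B : 'M[R]_m) (u v : 'rV[R]_m).

Lemma form2_delta A i j : form2 A (delta_mx 0 i) (delta_mx 0 j) = A i j.
Proof. by rewrite /form2 -rowE trmx_delta -colE !mxE. Qed.

Lemma form2_tr A u v : form2 A^T u v = form2 A v u.
Proof.
have -> : form2 A v u = (v *m A *m u^T)^T 0 0 by rewrite [RHS]mxE.
by rewrite /form2 !trmx_mul trmxK mulmxA.
Qed.

Lemma form2N A u v : form2 (- A) u v = - form2 A u v.
Proof. by rewrite /form2 mulmxN mulNmx mxE. Qed.

Lemma form2_skewP A : (forall u v, form2 A u v = - form2 A v u) <-> A^T = - A.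
Proof.
split=> [h|h u v]; last by rewrite -[LHS]form2_tr h form2N.
by apply/matrixP => i j; rewrite !mxE -!form2_delta h.
Qed.

Lemma form2_spdP A : (forall u v, form2 A u v = form2 A v u) /\
  (forall u, u != 0 -> 0 < form2 A u u) <-> spd A.
Proof.
split=> [[h pA]|[h pA]]; split=> //.
  by apply/matrixP => i j; rewrite !mxE -!form2_delta h.
by move=> u v; rewrite -[LHS]form2_tr h.
Qed.

End Forms.

(** * Gluing local tensor fields; existence of a Riemannian metric *)

Section Gluing.
Context {R : realType} {m : nat} (M : manifold R m).
Implicit Types (c d : chart R m M) (p q : M) (U V : set M).

Lemma compatible_at p : compatible (chart_at p : chart R m M).
Proof. exact/atlas_compatible/chart_at_atlas. Qed.

Lemma jac_unit c d p : compatible c -> compatible d -> cdom c p -> cdom d p ->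
  jac c d p \in unitmx.
Proof.
by move=> cc cd cp dp; have [u _] := mulmx1_unit (jacK cc cd cp dp).
Qed.

Lemma big_ord_trunc (V : zmodType) (a : nat -> V) n k :
  (forall i, (n <= i)%N -> a i = 0) -> (forall i, (k <= i)%N -> a i = 0) ->
  \sum_(i < n) a i = \sum_(i < k) a i.
Proof.
wlog nk : n k / (n <= k)%N.
  by move=> wl an ak; case: (leqP n k) => [|/ltnW] nk; [|symmetry]; apply: wl.
move=> an _; rewrite (big_ord_widen k a nk) big_mkcond /=; apply: eq_bigr => i _.
by case: ltnP => // /an.
Qed.

Section Partition.
Variables (x : nat -> M) (h : nat -> M -> R) (N : M -> nat).
Hypothesis h_smooth : forall i, smf setT (h i).
Hypothesis h_ge0 : forall i q, 0 <= h i q.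
Hypothesis h_supp : forall i, supported (chart_at (x i)) (h i).
Hypothesis h_locfin : forall p, exists V K,
  [/\ open V, V p & forall q i, V q -> (K <= i)%N -> h i q = 0].
Hypothesis h_sum : forall q,
  (forall i, (N q <= i)%N -> h i q = 0) /\ \sum_(i < N q) h i q = 1.

Let c i : chart R m M := chart_at (x i).
Let ac i : atlas (c i). Proof. exact: chart_at_atlas. Qed.
Let cc i : compatible (c i). Proof. exact: compatible_at. Qed.

(** The values of F i outside chart i are irrelevant, since the weight vanishes there. The bound N p
    may jump with p. *)
Definition glued r s (F : nat -> M -> 'M[R]_(r, s)) p : 'M[R]_(r, s) :=
  \sum_(i < N p) h i p *: F i p.

Lemma glue_smooth r s (F : nat -> M -> 'M[R]_(r, s)) U : open U ->
  (forall i, smo (cdom (c i) `&` U) (F i)) -> smo U (glued F).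
Proof.
move=> oU hF; apply: smo_local => p Up; have [V [K [oV Vp VK]]] := h_locfin p.
have oW : open (V `&` U) by exact: openI.
exists (V `&` U) => //.
(* On V the terms of index at least K vanish, so the jumping bound N q may be replaced by the
   constant K. *)
apply: (@smo_ext _ _ _ _ _ _ (fun q => \sum_(i < K) h i q *: F i q)) => //.
  move=> q [Vq _]; apply: (@big_ord_trunc _ (fun i => h i q *: F i q)).
    by move=> i Ki; rewrite VK // scale0r.
  by move=> i Ni; have [h0 _] := h_sum q; rewrite h0 // scale0r.
apply: smo_sum => // i _; apply: (smo_cutoff (@h_smooth i) (@h_supp i) oW).
by apply: smo_sub (hF i) => q [cq [_ Uq]].
Qed.

Lemma glue_eq r s (F G : nat -> M -> 'M[R]_(r, s)) p :
  (forall i, cdom (c i) p -> F i p = G i p) -> glued F p = glued G p.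
Proof.
move=> FG; apply: eq_bigr => i _; have [cp|cp] := pselect (cdom (c i) p).
  by rewrite FG.
by rewrite (supported_out (@h_supp i)) // !scale0r.
Qed.

Lemma glue_cst r s (A : 'M[R]_(r, s)) p : glued (fun _ _ => A) p = A.
Proof. by have [_ h1] := h_sum p; rewrite /glued -scaler_suml h1 scale1r. Qed.

Lemma glueD r s (F G : nat -> M -> 'M[R]_(r, s)) p :
  glued F p + glued G p = glued (fun i p => F i p + G i p) p.
Proof. by rewrite /glued -big_split; apply: eq_bigr => i _; rewrite scalerDr. Qed.

Lemma glueZ r s (a : R) (F : nat -> M -> 'M[R]_(r, s)) p :
  a *: glued F p = glued (fun i p => a *: F i p) p.
Proof.
rewrite /glued scaler_sumr; apply: eq_bigr => i _.
by rewrite !scalerA mulrC.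
Qed.

Lemma glueMr r s t (F : nat -> M -> 'M[R]_(r, s)) (A : 'M[R]_(s, t)) p :
  glued F p *m A = glued (fun i p => F i p *m A) p.
Proof.
by rewrite /glued mulmx_suml; apply: eq_bigr => i _; rewrite scalemxAl.
Qed.

Lemma glueMl r s t (F : nat -> M -> 'M[R]_(s, t)) (A : 'M[R]_(r, s)) p :
  A *m glued F p = glued (fun i p => A *m F i p) p.
Proof.
by rewrite /glued mulmx_sumr; apply: eq_bigr => i _; rewrite scalemxAr.
Qed.

Lemma glueMM r s t u (A : 'M[R]_(r, s)) (F : nat -> M -> 'M[R]_(s, t)) (B : 'M[R]_(t, u)) p :
  A *m glued F p *m B = glued (fun i p => A *m F i p *m B) p.
Proof. by rewrite (glueMl F A p) (glueMr _ B p). Qed.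

Lemma glue_tr r s (F : nat -> M -> 'M[R]_(r, s)) p :
  (glued F p)^T = glued (fun i p => (F i p)^T) p.
Proof. by rewrite /glued linear_sum; apply: eq_bigr => i _; rewrite linearZ. Qed.

(** J J^T is the Gram matrix, in the preferred chart, of the Euclidean metric of chart i. *)
Definition glued_metric p : 'M[R]_m :=
  glued (fun i q => jac (chart_at p) (c i) q *m (jac (chart_at p) (c i) q)^T) p.

Lemma glued_metricP : riemannian_metric glued_metric.
Proof.
suff [gs gp] : bilinear_field glued_metric /\ forall p, spd (glued_metric p).
  by split=> //; [move=> p; case/form2_spdP: (gp p)|move=> p; case/form2_spdP: (gp p)].
split.
  apply/bilinear_fieldP => d cd.
  apply: (@smo_ext _ _ _ _ _ _ (glued (fun i q => jac d (c i) q *m (jac d (c i) q)^T))).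
  - exact: cdom_open.
  - move=> q dq; rewrite /bilc /glued_metric [RHS]glueMM; apply: glue_eq => i cq.
    have aq := compatible_at q; have qq := chart_at_dom q.
    by rewrite (jac_comp cd aq (@cc i) dq qq cq) trmx_mul !mulmxA.
  apply: glue_smooth; first exact: cdom_open.
  move=> i; have oU : open (cdom (c i) `&` cdom d) by apply: openI; exact: cdom_open.
  have hj : smo (cdom (c i) `&` cdom d) (jac d (c i)) by rewrite setIC; exact: jac_smooth.
  by apply: smoM => //; exact: smo_tr.
move=> p; split.
  by rewrite /glued_metric glue_tr; apply: glue_eq => i _; rewrite trmx_mul trmxK.
move=> u u0.
have -> : u *m glued_metric p *m u^T = glued (fun i q => u *m
    (jac (chart_at p) (c i) q *m (jac (chart_at p) (c i) q)^T) *m u^T) p.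
  by rewrite /glued_metric [LHS]glueMM.
rewrite /glued summxE.
have aq := compatible_at p; have qq := chart_at_dom p.
have pos i : cdom (c i) p -> 0 < (u *m (jac (chart_at p) (c i) p *m (jac (chart_at p) (c i) p)^T) *m u^T) 0 0.
  move=> cp; have := @spd_congr R m 1%:M _ (jac_unit aq (@cc i) qq cp) (spd1 m).
  by rewrite mulmx1 => -[_]; exact.
have nn (i : 'I_(N p)) : 0 <= (h i p *: (u *m (jac (chart_at p) (c i) p *m (jac (chart_at p) (c i) p)^T) *m u^T)) 0 0.
  rewrite mxE; have [cp|cp] := pselect (cdom (c i) p); last by rewrite (supported_out (@h_supp i)) // mul0r.
  by rewrite mulr_ge0 //; apply/ltW/pos.
rewrite lt_neqAle sumr_ge0 ?andbT; last by move=> i _; exact: nn.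
(* If the sum vanished, so would each term and hence each weight, contradicting that the weights add
   up to 1. *)
rewrite eq_sym psumr_eq0; last by move=> i _; exact: nn.
apply/negP => /allP h0; have [_ h1] := h_sum p.
suff : \sum_(i < N p) h i p = 0 by rewrite h1 => /eqP; rewrite oner_eq0.
apply: big1 => i _; have := h0 i (mem_index_enum i); rewrite /= mxE mulf_eq0.
case/orP => [/eqP //|/eqP e].
have [cp|cp] := pselect (cdom (c i) p); last by rewrite (supported_out (@h_supp i)).
by have := pos i cp; rewrite e ltxx.
Qed.

End Partition.

Lemma empty_smooth r s (F : chart R m M -> M -> 'M[R]_(r, s)) :
  (M -> False) -> smooth_components F.
Proof.
move=> nM c ac i j k; apply: Ck_local => x [p]; case: (nM p).
Qed.

Lemma riemannian_metric_ex : exists g : M -> 'M[R]_m, riemannian_metric g.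
Proof.
have [[p0 _]|nM] := pselect (exists p : M, True); last first.
  have nM' : M -> False by move=> p; apply: nM; exists p.
  by exists (fun=> 0); split=> [|p|p]; [exact: empty_smooth|case: (nM' p)|case: (nM' p)].
have [x [h [N [h1 h2 h3 h4 h5]]]] := partition_of_unity p0.
by exists (glued_metric x h N); exact: glued_metricP.
Qed.

End Gluing.

(** * Connections and the gauge equation *)

Lemma eq_derive (R : realType) m (f g : 'rV[R]_m -> R) x v :
  f =1 g -> 'D_v f x = 'D_v g x.
Proof. by move=> /funext ->. Qed.

Section PartialDerivatives.
Context {R : realType} {m : nat} (M : manifold R m).
Implicit Types (c d : chart R m M) (p q : M) (U V : set M).

Definition pd r s c (k : 'I_m) (F : M -> 'M[R]_(r, s)) p : 'M[R]_(r, s) :=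
  \matrix_(i, j) 'D_(delta_mx 0 k) (fun y => F (cinv c y) i j) (cmap c p).

Lemma smf_differentiable c U f p : atlas c -> open U -> cdom c p -> U p ->
  smf U f -> differentiable (f \o cinv c) (cmap c p).
Proof.
move=> ac oU cp Up hf.
apply: (@Ck_differentiable _ _ 0 (cmap c @` (cdom c `&` U))).
- exact: open_chart_image.
- exact: hf.
- by exists p.
Qed.

Section AtPoint.
Variables (c : chart R m M) (U : set M) (p : M) (k : 'I_m).
Hypotheses (ac : atlas c) (oU : open U) (cp : cdom c p) (Up : U p).

Lemma smo_derivable r s (F : M -> 'M[R]_(r, s)) i j v : smo U F ->
  derivable (fun y => F (cinv c y) i j) (cmap c p) v.
Proof.
by move=> hF; apply: diff_derivable; exact: smf_differentiable ac oU cp Up (hF i j).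
Qed.

Lemma pd_ext r s (F G : M -> 'M[R]_(r, s)) :
  (forall q, U q -> F q = G q) -> pd c k F p = pd c k G p.
Proof.
move=> FG; apply/matrixP => i j; rewrite !mxE; apply: near_eq_derive.
apply: (@open_near_eq _ _ (cmap c @` (cdom c `&` U))); first exact: open_chart_image.
  by exists p.
by move=> _ [q [cq Uq] <-]; rewrite cmapK // FG.
Qed.

Lemma pdD r s (F G : M -> 'M[R]_(r, s)) : smo U F -> smo U G ->
  pd c k (fun q => F q + G q) p = pd c k F p + pd c k G p.
Proof.
move=> hF hG; apply/matrixP => i j; rewrite !mxE.
rewrite -deriveD; [|exact: smo_derivable|exact: smo_derivable].
by apply: eq_derive => y; rewrite mxE.
Qed.

Lemma pdZ r s (f : M -> R) (F : M -> 'M[R]_(r, s)) : smf U f -> smo U F ->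
  pd c k (fun q => f q *: F q) p =
  'D_(delta_mx 0 k) (f \o cinv c) (cmap c p) *: F p + f p *: pd c k F p.
Proof.
move=> hf hF; apply/matrixP => i j; rewrite !mxE.
transitivity ('D_(delta_mx 0 k) ((f \o cinv c) * (fun y => F (cinv c y) i j)) (cmap c p)).
  by apply: eq_derive => y; rewrite mxE.
rewrite deriveM; last exact: smo_derivable.
  by rewrite addrC /= cmapK //; congr (_ + _); rewrite [LHS]mulrC.
by apply: diff_derivable; exact: smf_differentiable ac oU cp Up hf.
Qed.

Lemma pdM r s t (F : M -> 'M[R]_(r, s)) (G : M -> 'M[R]_(s, t)) : smo U F -> smo U G ->
  pd c k (fun q => F q *m G q) p = pd c k F p *m G p + F p *m pd c k G p.
Proof.
move=> hF hG; apply/matrixP => i j; rewrite !mxE.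
transitivity ('D_(delta_mx 0 k)
    (\sum_l ((fun y => F (cinv c y) i l) * (fun y => G (cinv c y) l j))) (cmap c p)).
  by apply: eq_derive => y; rewrite mxE fct_sumE.
rewrite derive_sum; last by move=> l; apply: derivableM; exact: smo_derivable.
rewrite -big_split; apply: eq_bigr => l _.
rewrite deriveM; [|exact: smo_derivable|exact: smo_derivable].
rewrite /= cmapK // !mxE addrC; congr (_ + _); by rewrite mulrC.
Qed.

Lemma pd_tr r s (F : M -> 'M[R]_(r, s)) : pd c k (fun q => (F q)^T) p = (pd c k F p)^T.
Proof.
apply/matrixP => i j; rewrite !mxE.
by apply: eq_derive => y; rewrite mxE.
Qed.

Lemma directional_derivativeE Z (f : M -> R) : smf U f ->
  directional_derivative Z f p =
    \sum_l vecc Z c p 0 l * 'D_(delta_mx 0 l) (f \o cinv c) (cmap c p).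
Proof.
move=> hf; pose d := chart_at p.
have cc := atlas_compatible ac; have cd := compatible_at p; have dp := chart_at_dom p.
have tr := compatible_trans cd cc.
have df := transition_differentiable tr dp cp.
have e : (cmap c \o cinv d) (cmap d p) = cmap c p by rewrite /= cmapK.
have dg : differentiable (f \o cinv c) ((cmap c \o cinv d) (cmap d p)).
  by rewrite e; exact: smf_differentiable ac oU cp Up hf.
have [_ D] := derive_chain (Z p) df dg; rewrite e in D.
transitivity ('D_(Z p) ((f \o cinv c) \o (cmap c \o cinv d)) (cmap d p)).
  apply: near_eq_derive.
  apply: (@open_near_eq _ _ (cmap d @` (cdom d `&` cdom c))).
  - by apply: open_chart_image; exact: cdom_open.
  - by exists p.
  - by move=> _ [q [dq cq] <-] /=; rewrite cmapK // cmapK.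
apply: etrans D _; apply: eq_bigr => l _; congr (_ * _).
have -> : 'D_(Z p) (fun y => (cmap c \o cinv d) y 0 l) (cmap d p) =
   ('D_(Z p) (cmap c \o cinv d) (cmap d p)) 0 l.
  by rewrite derive_mx ?mxE //; exact: diff_derivable.
rewrite deriveE // [X in 'd _ _ X]row_sum_delta linear_sum summxE.
rewrite /vecc mxE; apply: eq_bigr => i _.
rewrite linearZ mxE; congr (_ * _).
rewrite (jacE i l tr dp cp) -deriveE // derive_mx; last exact: diff_derivable.
by rewrite mxE.
Qed.

End AtPoint.

Lemma pd_smooth r s c U k (F : M -> 'M[R]_(r, s)) : atlas c -> open U ->
  U `<=` cdom c -> smo U F -> smo U (pd c k F).
Proof.
move=> ac oU Uc hF; apply: (smo_chart (atlas_compatible ac)) => // n i j.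
have [_ h] := hF i j c ac n.+1 k.
have UE : cdom c `&` U = U by rewrite setIC; apply/setIidPl.
rewrite UE in h; apply: Ck_ext h; first by rewrite -UE; exact: open_chart_image.
by move=> _ [p Up <-] /=; rewrite mxE cmapK //; exact: Uc.
Qed.

End PartialDerivatives.

Section Connections.
Context {R : realType} {m : nat} (M : manifold R m).
Implicit Types (d : chart R m M) (p q : M) (U V : set M).

Variables (x : nat -> M) (h : nat -> M -> R) (N : M -> nat).
Hypothesis h_smooth : forall i, smf setT (h i).
Hypothesis h_supp : forall i, supported (chart_at (x i)) (h i).
Hypothesis h_locfin : forall p, exists V K,
  [/\ open V, V p & forall q i, V q -> (K <= i)%N -> h i q = 0].
Hypothesis h_sum : forall q,
  (forall i, (N q <= i)%N -> h i q = 0) /\ \sum_(i < N q) h i q = 1.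

Let c i : chart R m M := chart_at (x i).
Let ac i : atlas (c i). Proof. exact: chart_at_atlas. Qed.
Let cc i : compatible (c i). Proof. exact: compatible_at. Qed.

Let geq r s (F G : nat -> M -> 'M[R]_(r, s)) p :
  (forall i, cdom (c i) p -> F i p = G i p) -> glued h N F p = glued h N G p.
Proof. exact: (@glue_eq R m M x h N (@h_supp)). Qed.

Definition cderiv (C : nat -> 'I_m -> M -> 'M[R]_m) i
    (Z Y : M -> 'rV[R]_m) p : 'rV[R]_m :=
  \sum_k vecc Z (c i) p 0 k *:
    (pd (c i) k (vecc Y (c i)) p + vecc Y (c i) p *m C i k p).

Definition conn C (Z Y : M -> 'rV[R]_m) p : 'rV[R]_m :=
  glued h N (fun i q => cderiv C i Z Y q *m jac (c i) (chart_at q) q) p.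

Lemma veccD (X Y : M -> 'rV[R]_m) d p :
  vecc (fun q => X q + Y q) d p = vecc X d p + vecc Y d p.
Proof. by rewrite /vecc mulmxDl. Qed.

Lemma veccZ (f : M -> R) (Y : M -> 'rV[R]_m) d p :
  vecc (fun q => f q *: Y q) d p = f p *: vecc Y d p.
Proof. by rewrite /vecc -scalemxAl. Qed.

Let vsm Y i : vector_field Y -> smo (cdom (c i)) (vecc Y (c i)).
Proof. by move/vector_fieldP; apply. Qed.

Let oc i : open (cdom (c i)). Proof. exact: cdom_open. Qed.

Variable C : nat -> 'I_m -> M -> 'M[R]_m.
Hypothesis C_smooth : forall i k, smo (cdom (c i)) (C i k).

Lemma cderiv_smooth i Z Y : vector_field Z -> vector_field Y ->
  smo (cdom (c i)) (cderiv C i Z Y).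
Proof.
move=> hZ hY; apply: smo_sum => // k _; apply: smoZ => //; first exact: vsm.
apply: smoD => //; first by apply: pd_smooth => //; exact: vsm.
by apply: smoM => //; exact: vsm.
Qed.

Lemma conn_field Z Y : vector_field Z -> vector_field Y -> vector_field (conn C Z Y).
Proof.
move=> hZ hY; apply/vector_fieldP => d cd.
apply: (@smo_ext _ _ _ _ _ _ (glued h N (fun i q => cderiv C i Z Y q *m jac (c i) d q))).
- exact: cdom_open.
- move=> q dq; rewrite /vecc /conn [RHS]glueMr; apply: geq => i cq.
  have aq := compatible_at q; have qq := chart_at_dom q.
  by rewrite (jac_comp (@cc i) aq cd cq qq dq) mulmxA.
apply: (glue_smooth (@h_smooth) (@h_supp) h_locfin h_sum); first exact: cdom_open.
move=> i; have oU : open (cdom (c i) `&` cdom d) by apply: openI; exact: cdom_open.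
apply: smoM => //; [|exact: (jac_smooth (@cc i) cd)].
by apply: smo_sub (cderiv_smooth i hZ hY) => q [].
Qed.

(** In the Leibniz rule every local operator contributes the same term (X f) Y, which comes out with
    coefficient one because the weights sum to 1. *)
Lemma conn_affine : affine_connection (conn C).
Proof.
split.
- exact: conn_field.
- move=> X X' Y _ _ _ p; rewrite /conn [RHS]glueD; apply: geq => i _.
  rewrite -mulmxDl /cderiv -big_split; congr (_ *m _); apply: eq_bigr => k _ /=.
  by rewrite veccD mxE scalerDl.
- move=> f X Y _ _ _ p; rewrite /conn [RHS]glueZ; apply: eq_bigr => i _; congr (_ *: _).
  rewrite scalemxAl /cderiv scaler_sumr; congr (_ *m _); apply: eq_bigr => k _ /=.
  by rewrite veccZ mxE scalerA.
- move=> X Y Y' _ hY hY' p; rewrite /conn [RHS]glueD; apply: geq => i cp.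
  rewrite -mulmxDl /cderiv -big_split; congr (_ *m _); apply: eq_bigr => k _ /=.
  rewrite -scalerDr; congr (_ *: _).
  have -> : pd (c i) k (vecc (fun q => Y q + Y' q) (c i)) p =
    pd (c i) k (fun q => vecc Y (c i) q + vecc Y' (c i) q) p.
    by apply: (pd_ext k (oc i) cp cp) => q _; rewrite veccD.
  rewrite (pdD k (ac i) (oc i) cp cp (vsm i hY) (vsm i hY')) veccD mulmxDl.
  by rewrite addrACA.
- move=> f X Y hf hX hY p.
  have hf' : smf setT f by exact/smooth_functionP.
  transitivity (glued h N (fun i q => (directional_derivative X f q *: (vecc Y (c i) q)) *m jac (c i) (chart_at q) q) p
    + f p *: conn C X Y p).
    rewrite /conn glueZ [RHS]glueD; apply: geq => i cp.
    rewrite scalemxAl -mulmxDl; congr (_ *m _).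
    rewrite (directional_derivativeE (ac i) openT cp I _ hf').
    rewrite /cderiv scaler_suml scaler_sumr -big_split; apply: eq_bigr => k _ /=.
    have -> : pd (c i) k (vecc (fun q => f q *: Y q) (c i)) p =
        pd (c i) k (fun q => f q *: vecc Y (c i) q) p.
      by apply: (pd_ext k (oc i) cp cp) => q _; rewrite veccZ.
    have hfi : smf (cdom (c i)) f by exact: smf_sub (@subsetT _ _) hf'.
    rewrite (pdZ k (ac i) (oc i) cp cp hfi (vsm i hY)) veccZ -scalemxAl.
    by rewrite -addrA !scalerDr !scalerA [f p * _]mulrC.
  congr (_ + _).
  rewrite -[RHS](glue_cst h_sum _ p); apply: geq => i cp.
  have aq := compatible_at p; have qq := chart_at_dom p.
  by rewrite -scalemxAl /vecc -mulmxA (jacK aq (@cc i) qq cp) mulmx1.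
Qed.

End Connections.

(** The product rule for X g Y^T when the derivative of g is A g + g B^T: the coefficients A and B
    are absorbed into the covariant derivatives of X and Y. *)
Lemma dual_product_rule (R : comNzRingType) m (X Y dX dY : 'rV[R]_m) (g A B : 'M[R]_m) :
  (dX *m g + X *m (A *m g + g *m B^T)) *m Y^T + X *m g *m dY^T =
  (dX + X *m A) *m (g *m Y^T) + ((dY + Y *m B) *m (g^T *m X^T))^T.
Proof.
have -> : ((dY + Y *m B) *m (g^T *m X^T))^T = X *m g *m (dY^T + B^T *m Y^T).
  by rewrite !trmx_mul !trmxK linearD /= trmx_mul.
by rewrite !(mulmxDl, mulmxDr) !mulmxA -!addrA; congr (_ + (_ + _)); rewrite addrC.
Qed.

Section DualConnections.
Context {R : realType} {m : nat} (M : manifold R m).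
Implicit Types (d : chart R m M) (p q : M) (U V : set M).

Variables (x : nat -> M) (h : nat -> M -> R) (N : M -> nat).
Hypothesis h_supp : forall i, supported (chart_at (x i)) (h i).
Hypothesis h_sum : forall q,
  (forall i, (N q <= i)%N -> h i q = 0) /\ \sum_(i < N q) h i q = 1.

Let c i : chart R m M := chart_at (x i).
Let ac i : atlas (c i). Proof. exact: chart_at_atlas. Qed.
Let cc i : compatible (c i). Proof. exact: compatible_at. Qed.
Let oc i : open (cdom (c i)). Proof. exact: cdom_open. Qed.
Let geq r s (F G : nat -> M -> 'M[R]_(r, s)) p :
  (forall i, cdom (c i) p -> F i p = G i p) -> glued h N F p = glued h N G p.
Proof. exact: (@glue_eq R m M x h N (@h_supp)). Qed.

Lemma bilc_vecc (B : M -> 'M[R]_m) (Y : M -> 'rV[R]_m) d p : compatible d -> cdom d p ->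
  jac d (chart_at p) p *m (B p *m (Y p)^T) = bilc B d p *m (vecc Y d p)^T.
Proof.
move=> cd dp; have aq := compatible_at p; have qq := chart_at_dom p.
rewrite /bilc -!mulmxA -trmx_mul /vecc -mulmxA (jacK aq cd qq dp) mulmx1.
by rewrite !mulmxA.
Qed.

Lemma form2_chart (B : M -> 'M[R]_m) (X Y : M -> 'rV[R]_m) d p : compatible d -> cdom d p ->
  form2 (B p) (X p) (Y p) = (vecc X d p *m bilc B d p *m (vecc Y d p)^T) 0 0.
Proof.
move=> cd dp; have aq := compatible_at p; have qq := chart_at_dom p.
rewrite /form2 -[in RHS]mulmxA -(bilc_vecc B Y cd dp) [in RHS]mulmxA /vecc.
by rewrite -(mulmxA (X p) (jac _ d p)) (jacK aq cd qq dp) mulmx1 mulmxA.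
Qed.

Lemma vecc_endc (theta : M -> 'M[R]_m) (Y : M -> 'rV[R]_m) d p : compatible d -> cdom d p ->
  vecc (fun q => Y q *m theta q) d p = vecc Y d p *m endc theta d p.
Proof.
move=> cd dp; have aq := compatible_at p; have qq := chart_at_dom p.
rewrite /vecc /endc -!mulmxA (mulmxA _ (jac d _ p)) (jacK aq cd qq dp) mul1mx.
by rewrite !mulmxA.
Qed.

Variables C C' : nat -> 'I_m -> M -> 'M[R]_m.

(** Duality is affine in the pair of connections, so a chartwise condition on the coefficients
    survives gluing both with the same weights. *)
Lemma conn_dual (g : M -> 'M[R]_m) : bilinear_field g ->
  (forall i k p, cdom (c i) p -> pd (c i) k (bilc g (c i)) p =
     C i k p *m bilc g (c i) p + bilc g (c i) p *m (C' i k p)^T) ->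
  dual_connection g (conn x h N C) (conn x h N C').
Proof.
move=> hg hC X Y Z hX hY hZ p.
set f := fun q => form2 (g q) (X q) (Y q).
have aq := compatible_at p; have qq := chart_at_dom p.
(* Scalars are written as 1 x 1 matrices so that the lemmas on [glued] apply to both sides. *)
suff e : (directional_derivative Z f p)%:M = conn x h N C Z X p *m (g p *m (Y p)^T)
    + (conn x h N C' Z Y p *m ((g p)^T *m (X p)^T))^T :> 'M[R]_1.
  transitivity (((directional_derivative Z f p)%:M : 'M[R]_1) 0 0).
    by rewrite mxE eqxx mulr1n.
  rewrite e mxE; congr (_ + _); first by rewrite /form2 mulmxA.
  by rewrite /form2 !trmx_mul !trmxK.
rewrite /conn glueMr glueMr glue_tr glueD -[LHS](glue_cst h_sum _ p).
apply: geq => i cp.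
have vX : smo (cdom (c i)) (vecc X (c i)) by move/vector_fieldP: hX; apply.
have vY : smo (cdom (c i)) (vecc Y (c i)) by move/vector_fieldP: hY; apply.
have vg : smo (cdom (c i)) (bilc g (c i)) by move/bilinear_fieldP: hg; apply.
pose F q := vecc X (c i) q *m bilc g (c i) q *m (vecc Y (c i) q)^T.
have vF : smo (cdom (c i)) F by apply: smoM => //; [exact: smoM|exact: smo_tr].
have fF q : cdom (c i) q -> f q = F q 0 0 by move=> cq; exact: form2_chart.
have sf : smf (cdom (c i)) f by apply: smf_ext (vF 0 0) => // q cq; rewrite fF.
rewrite (directional_derivativeE (ac i) (@oc i) cp cp _ sf).
have df k : 'D_(delta_mx 0 k) (f \o cinv (c i)) (cmap (c i) p) = pd (c i) k F p 0 0.
  rewrite mxE; apply: near_eq_derive.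
  apply: (@open_near_eq _ _ (cimg (c i))); [exact: cimg_open|exact: cimg_map|].
  by move=> _ [q cq <-] /=; rewrite cmapK // fF.
have pF k : pd (c i) k F p =
    (pd (c i) k (vecc X (c i)) p + vecc X (c i) p *m C i k p) *m (bilc g (c i) p *m (vecc Y (c i) p)^T)
    + ((pd (c i) k (vecc Y (c i)) p + vecc Y (c i) p *m C' i k p) *m ((bilc g (c i) p)^T *m (vecc X (c i) p)^T))^T.
  rewrite (pdM k (ac i) (@oc i) cp cp (smoM (@oc i) vX vg) (smo_tr (@oc i) vY)).
  rewrite (pdM k (ac i) (@oc i) cp cp vX vg) pd_tr hC //.
  exact: dual_product_rule.
apply/matrixP => a b; rewrite !ord1 mxE eqxx mulr1n.
rewrite -(mulmxA _ (jac (c i) (chart_at p) p)) (bilc_vecc g Y (@cc i) cp).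
have -> : cderiv x C' i Z Y p *m jac (c i) (chart_at p) p *m ((g p)^T *m (X p)^T) =
    cderiv x C' i Z Y p *m ((bilc g (c i) p)^T *m (vecc X (c i) p)^T).
  have := bilc_vecc (fun q => (g q)^T) X (@cc i) cp; rewrite -mulmxA => ->.
  congr (_ *m (_ *m _)); by rewrite /bilc !trmx_mul trmxK mulmxA.
rewrite /cderiv !mulmx_suml linear_sum -big_split summxE; apply: eq_bigr => k _ /=.
by rewrite -!scalemxAl linearZ /= -scalerDr [RHS]mxE df pF.
Qed.

Lemma conn_gauge (theta : M -> 'M[R]_m) : endomorphism_field theta ->
  (forall i k p, cdom (c i) p -> pd (c i) k (endc theta (c i)) p
     + endc theta (c i) p *m C' i k p = C i k p *m endc theta (c i) p) ->
  gauge_equation (conn x h N C) (conn x h N C') theta.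
Proof.
move=> ht hC X Y hX hY p; rewrite /conn [RHS]glueMr; apply: geq => i cp.
have aq := compatible_at p; have qq := chart_at_dom p.
have vY : smo (cdom (c i)) (vecc Y (c i)) by move/vector_fieldP: hY; apply.
have vt : smo (cdom (c i)) (endc theta (c i)) by move/endomorphism_fieldP: ht; apply.
have e : cderiv x C' i X (fun q => Y q *m theta q) p = cderiv x C i X Y p *m endc theta (c i) p.
  rewrite /cderiv mulmx_suml; apply: eq_bigr => k _; rewrite -scalemxAl; congr (_ *: _).
  have -> : pd (c i) k (vecc (fun q => Y q *m theta q) (c i)) p =
     pd (c i) k (fun q => vecc Y (c i) q *m endc theta (c i) q) p.
    by apply: (pd_ext k (@oc i) cp cp) => q cq; rewrite (vecc_endc theta Y (@cc i) cq).
  rewrite (pdM k (ac i) (@oc i) cp cp vY vt) (vecc_endc theta Y (@cc i) cp).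
  have alg (Y0 dY : 'rV[R]_m) (T dT A B : 'M[R]_m) : dT + T *m B = A *m T ->
      dY *m T + Y0 *m dT + Y0 *m T *m B = (dY + Y0 *m A) *m T.
    by move=> hT; rewrite -addrA -!mulmxA -mulmxDr hT mulmxDl mulmxA.
  by apply: alg; exact: hC.
rewrite e /endc -!mulmxA; congr (_ *m (_ *m _)).
by rewrite (jacK aq (@cc i) qq cp) mulmx1.
Qed.

End DualConnections.

(** * Connection coefficients that make a skew form parallel *)

Section SkewParallel.
Context {R : realType} {m : nat}.
Implicit Types B N T : 'M[R]_m.

(* A solution C of [C B + B C^T = T] when T vanishes on ker B x ker B, for a
   generalized inverse N of B; with T the partial derivatives of B these are
   the coefficients of a connection for which B is parallel. *)
Definition parallel_coef B N T : 'M[R]_m :=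
  (1%:M - 2^-1 *: (B *m N)) *m T *m (N *m B) *m N.

(** With P = NB and Q = BN, skewness of B and N gives P^T = Q. The left-hand side is T P + Q T - Q T
    P, where each of the two summands brings half of Q T P, and this is T - (1 - Q) T (1 - P). *)
Lemma parallel_coefP B N T : B^T = - B -> N^T = - N -> T^T = - T ->
  B *m N *m B = B -> (1%:M - B *m N) *m T *m (1%:M - N *m B) = 0 ->
  parallel_coef B N T *m B + B *m (parallel_coef B N T)^T = T.
Proof.
move=> sB sN sT BNB hT; pose P := N *m B; pose Q := B *m N.
have PP : P *m P = P by rewrite /P -mulmxA (mulmxA B) BNB.
have PT : P^T = Q by rewrite /P trmx_mul sB sN mulNmx mulmxN opprK.
have QT : Q^T = P by rewrite -PT trmxK.
pose S := (1%:M - 2^-1 *: Q) *m T *m P.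
have CB : parallel_coef B N T *m B = S.
  by rewrite /parallel_coef -/P -/Q -(mulmxA _ N B) -/P -(mulmxA _ P P) PP.
have -> : B *m (parallel_coef B N T)^T = - S^T.
  by rewrite -CB [(_ *m B)^T]trmx_mul sB mulNmx opprK.
rewrite CB.
have -> : S^T = - (Q *m T *m (1%:M - 2^-1 *: P)).
  rewrite /S [LHS]trmx_mul PT [(_ *m T)^T]trmx_mul sT linearB /= trmx1 linearZ /= QT.
  by rewrite mulNmx mulmxN mulmxA.
have e : T - (T *m P + Q *m T - Q *m T *m P) = 0.
  rewrite -hT -/P -/Q mulmxBl mul1mx mulmxBr mulmx1 mulmxBl.
  by rewrite !opprD !opprK !addrA; congr (_ + _); rewrite addrAC.
rewrite opprK /S mulmxBl mul1mx mulmxBl mulmxBr mulmx1.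
rewrite -!scalemxAl -scalemxAr addrACA -opprD -scalerDl.
have -> : 2^-1 + 2^-1 = 1 :> R by field.
by rewrite scale1r; symmetry; apply: subr0_eq.
Qed.

(* The derivative of [B = B N B] vanishes on [ker B x ker B]. *)
Lemma skew_kernel_derivative B N dB dN : B *m N *m B = B ->
  dB = (dB *m N + B *m dN) *m B + B *m N *m dB ->
  (1%:M - B *m N) *m dB *m (1%:M - N *m B) = 0.
Proof.
move=> BNB {1}->.
have z1 : B *m (1%:M - N *m B) = 0 by rewrite mulmxBr mulmx1 mulmxA BNB subrr.
have z2 : (1%:M - B *m N) *m B = 0 by rewrite mulmxBl mul1mx BNB subrr.
move: (1%:M - N *m B) (1%:M - B *m N) z1 z2 => K L z1 z2.
by rewrite mulmxDr mulmxDl -!mulmxA z1 !mulmx0 add0r !mulmxA z2 !mul0mx.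
Qed.

(** The coefficient (dg - g C^T) g^-1 is the one forced by duality with C. After multiplication by g
    on the right, the gauge equation for t becomes the parallelism of b = t g. *)
Lemma gauge_algebra (g dg b db t dt C : 'M[R]_m) : g \in unitmx ->
  t *m g = b -> dt *m g + t *m dg = db -> C *m b + b *m C^T = db ->
  dt + t *m ((dg - g *m C^T) *m invmx g) = C *m t.
Proof.
move=> u tg dt_g Cb; apply: (can_inj (mulmxK u)).
rewrite -[RHS]mulmxA tg mulmxDl !mulmxA mulmxKV // mulmxBr addrA dt_g mulmxA tg.
by rewrite -Cb addrK.
Qed.

End SkewParallel.

Section GaugeSolution.
Context {R : realType} {m : nat} (M : manifold R m).
Implicit Types (d : chart R m M) (p q : M) (U V : set M).

Lemma bilc_tr (B : M -> 'M[R]_m) d p : (bilc B d p)^T = bilc (fun q => (B q)^T) d p.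
Proof. by rewrite /bilc !trmx_mul trmxK mulmxA. Qed.

Lemma bilc_spd (g : M -> 'M[R]_m) d p : compatible d -> cdom d p ->
  spd (g p) -> spd (bilc g d p).
Proof.
move=> cd dp sg; have aq := compatible_at p; have qq := chart_at_dom p.
by apply: spd_congr => //; exact: jac_unit.
Qed.

Lemma endc_musical (B g : M -> 'M[R]_m) d p : compatible d -> cdom d p ->
  g p \in unitmx ->
  endc (fun q => B q *m invmx (g q)) d p = bilc B d p *m invmx (bilc g d p).
Proof.
move=> cd dp ug; have aq := compatible_at p; have qq := chart_at_dom p.
have uJ := jac_unit cd aq dp qq.
have uJT : (jac d (chart_at p) p)^T \in unitmx by rewrite unitmx_tr.
have ugc : bilc g d p \in unitmx by rewrite /bilc !unitmx_mul uJ ug uJT.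
apply: (can_inj (mulmxK ugc)); rewrite mulmxKV // /endc /bilc.
have alg (J J' B0 g0 : 'M[R]_m) : J' *m J = 1%:M -> g0 \in unitmx ->
    J *m (B0 *m invmx g0) *m J' *m (J *m g0 *m J^T) = J *m B0 *m J^T.
  move=> JJ u; rewrite !mulmxA -(mulmxA _ J' J) JJ mulmx1.
  by rewrite -(mulmxA _ (invmx g0)) mulVmx // mulmx1.
by apply: alg => //; exact: jacK.
Qed.

(** The generalized inverse [Nf] is given chart by chart because it only feeds the local
    coefficients, which are glued afterwards. *)
Lemma gauge_solution (B : M -> 'M[R]_m) (Nf : chart R m M -> M -> 'M[R]_m) r :
  two_form B ->
  (forall c, atlas c -> smo (cdom c) (Nf c)) ->
  (forall c p, atlas c -> cdom c p -> (Nf c p)^T = - Nf c p /\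
     bilc B c p *m Nf c p *m bilc B c p = bilc B c p) ->
  (forall p, \rank (B p) = r) ->
  has_skew_gauge_solution M r.
Proof.
move=> [hB sB] hN NB rB.
have [g mg] := riemannian_metric_ex M.
have [hg symg posg] := mg.
have sg p : spd (g p) by apply/form2_spdP; split; [exact: symg|exact: posg].
have ug p : g p \in unitmx by exact: spd_unit.
have sB' p : (B p)^T = - B p by apply/form2_skewP; exact: sB.
pose theta p := B p *m invmx (g p).
have ht : endomorphism_field theta.
  apply/endomorphism_fieldP => d cd.
  apply: (@smo_ext _ _ _ _ _ _ (fun p => bilc B d p *m invmx (bilc g d p))).
  - exact: cdom_open.
  - by move=> p dp; rewrite endc_musical.
  apply: smoM; first exact: cdom_open.
    by move/bilinear_fieldP: hB; apply.
  apply: smo_inv; first exact: cdom_open.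
    by move=> p dp; apply: spd_unit; exact: bilc_spd.
  by move/bilinear_fieldP: hg; apply.
have rt p : \rank (theta p) = r.
  by rewrite /theta mxrankMfree ?rB // row_free_unit unitmx_inv.
have skt : skew_symmetric g theta.
  move=> X Y _ _ p; rewrite /form2 /theta -!mulmxA mulKmx //.
  rewrite !trmx_mul trmx_inv (proj1 (sg p)) -!mulmxA mulKVmx //.
  by rewrite sB' mulNmx mulmxN [in RHS]mxE opprK.
(* The partition of unity starts from a point, so the empty manifold is treated apart. *)
have [[p0 _]|nM] := pselect (exists p : M, True); last first.
  have nM' : M -> False by move=> p; apply: nM; exists p.
  exists g, (fun _ _ _ => 0), (fun _ _ _ => 0), theta.
  have ac0 : affine_connection (fun _ _ (_ : M) => 0 : 'rV[R]_m).
    by split=> *; first exact: empty_smooth; case: nM'.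
  by split=> //; [split=> //|split=> //]; move=> X Y Z *; case: nM'.
have [x [h [N [h1 h2 h3 h4 h5]]]] := partition_of_unity p0.
pose c i : chart R m M := chart_at (x i).
have ac i : atlas (c i) by exact: chart_at_atlas.
have cc i : compatible (c i) by exact: compatible_at.
have oc i : open (cdom (c i)) by exact: cdom_open.
have smB i : smo (cdom (c i)) (bilc B (c i)) by move/bilinear_fieldP: hB; apply.
have smg i : smo (cdom (c i)) (bilc g (c i)) by move/bilinear_fieldP: hg; apply.
have smN i : smo (cdom (c i)) (Nf (c i)) by exact: hN.
have ugc i p : cdom (c i) p -> bilc g (c i) p \in unitmx.
  by move=> cp; apply: spd_unit; apply: bilc_spd => //; exact: cc.
pose C i k p := parallel_coef (bilc B (c i) p) (Nf (c i) p) (pd (c i) k (bilc B (c i)) p).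
pose C' i k p := (pd (c i) k (bilc g (c i)) p - bilc g (c i) p *m (C i k p)^T)
   *m invmx (bilc g (c i) p).
have smC i k : smo (cdom (c i)) (C i k).
  rewrite /C /parallel_coef; do 3 (apply: smoM => //).
  - apply: smoB => //; first exact: smo_cst.
    by apply: smoZ => //; [exact: smf_cst|exact: smoM].
  - exact: pd_smooth.
have smC' i k : smo (cdom (c i)) (C' i k).
  apply: smoM => //; last by apply: smo_inv => // p; exact: ugc.
  apply: smoB => //; first exact: pd_smooth.
  by apply: smoM => //; exact: smo_tr.
have skB i p : (bilc B (c i) p)^T = - bilc B (c i) p.
  by rewrite bilc_tr /bilc sB' mulmxN mulNmx.
have parB i k p : cdom (c i) p ->
    C i k p *m bilc B (c i) p + bilc B (c i) p *m (C i k p)^T = pd (c i) k (bilc B (c i)) p.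
  move=> cp; have [skN BNB] := NB _ _ (ac i) cp.
  apply: parallel_coefP => //.
    rewrite -pd_tr.
    transitivity (pd (c i) k (fun q => (-1) *: bilc B (c i) q) p).
      by apply: (pd_ext k (oc i) cp cp) => q _; rewrite skB scaleN1r.
    rewrite (pdZ k (ac i) (oc i) cp cp (@smf_cst _ _ _ _ (-1)) (smB i)).
    by rewrite derive_cst scale0r add0r scaleN1r.
  have e : pd (c i) k (bilc B (c i)) p =
     (pd (c i) k (bilc B (c i)) p *m Nf (c i) p + bilc B (c i) p *m pd (c i) k (Nf (c i)) p) *m bilc B (c i) p
     + bilc B (c i) p *m Nf (c i) p *m pd (c i) k (bilc B (c i)) p.
    rewrite -(pdM k (ac i) (oc i) cp cp (smB i) (smN i)).
    rewrite -(pdM k (ac i) (oc i) cp cp (smoM (oc i) (smB i) (smN i)) (smB i)).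
    apply: (pd_ext k (oc i) cp cp) => q cq.
    by have [_ eq] := NB _ _ (ac i) cq; exact: esym eq.
  exact: (skew_kernel_derivative BNB e).
have dualg i k p : cdom (c i) p -> pd (c i) k (bilc g (c i)) p =
     C i k p *m bilc g (c i) p + bilc g (c i) p *m (C' i k p)^T.
  move=> cp.
  have gT q : (bilc g (c i) q)^T = bilc g (c i) q by rewrite bilc_tr /bilc (proj1 (sg q)).
  have dgT : (pd (c i) k (bilc g (c i)) p)^T = pd (c i) k (bilc g (c i)) p.
    by rewrite -pd_tr; apply: (pd_ext k (oc i) cp cp) => q _; rewrite gT.
  rewrite /C' trmx_mul trmx_inv gT linearB /= dgT trmx_mul trmxK gT.
  by rewrite mulKVmx ?ugc // addrC subrK.
have gaugec i k p : cdom (c i) p -> pd (c i) k (endc theta (c i)) p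
     + endc theta (c i) p *m C' i k p = C i k p *m endc theta (c i) p.
  move=> cp; have u := ugc i p cp.
  have smt : smo (cdom (c i)) (endc theta (c i)) by move/endomorphism_fieldP: ht; apply.
  have tg q : cdom (c i) q -> endc theta (c i) q *m bilc g (c i) q = bilc B (c i) q.
    move=> cq; have -> : endc theta (c i) q = bilc B (c i) q *m invmx (bilc g (c i) q).
      exact: (endc_musical B (cc i) cq (ug q)).
    by apply: mulmxKV; exact: ugc.
  have dt : pd (c i) k (endc theta (c i)) p *m bilc g (c i) p +
     endc theta (c i) p *m pd (c i) k (bilc g (c i)) p = pd (c i) k (bilc B (c i)) p.
    rewrite -(pdM k (ac i) (oc i) cp cp smt (smg i)).
    by apply: (pd_ext k (oc i) cp cp) => q cq; rewrite tg.
  exact: gauge_algebra u (tg p cp) dt (parB i k p cp).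
exists g, (conn x h N C), (conn x h N C'), theta; split=> //.
- exact: (conn_affine h1 h3 h4 h5).
- by split; [exact: (conn_affine h1 h3 h4 h5)|exact: (conn_dual h3 h5 hg)].
- by split=> //; exact (@conn_gauge R m M x h N h3 C C' theta ht gaugec).
Qed.

End GaugeSolution.

(** * Top degree wedge products *)

Section AlternatingForms.
Context {R : realType} {m : nat}.

Definition setrow k (i : 'I_k) (u : 'rV[R]_m) (v : 'M[R]_(k, m)) : 'M[R]_(k, m) :=
  \matrix_(a, b) if a == i then u 0 b else v a b.

Definition alternating_form k (f : @Defs.form R m k) : Prop :=
  forall (s : 'S_k) v, f (row_perm s v) = (-1) ^+ s * f v.

Definition multilinear k (f : @Defs.form R m k) : Prop :=
  forall i v (a : R) u w, f (setrow i (a *: u + w) v) =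
    a * f (setrow i u v) + f (setrow i w v).

Definition killed_by k (w : 'rV[R]_m) (f : @Defs.form R m k) : Prop :=
  forall v i, row i v = w -> f v = 0.

Lemma wedge_alternating k l (a : @Defs.form R m k) (b : @Defs.form R m l) :
  alternating_form (wedge a b).
Proof.
move=> t v; rewrite /wedge mulrCA; congr (_ * _).
rewrite (reindex_inj (mulIg t^-1)%g) mulr_sumr; apply: eq_bigr => s _.
rewrite -row_permM mulgKV odd_permM odd_permV signr_addb.
by rewrite !mulrA [(-1) ^+ t * _]mulrC.
Qed.

Lemma row_perm_setrow k (s : 'S_k) i u (v : 'M[R]_(k, m)) :
  row_perm s (setrow i u v) = setrow (s^-1 i)%g u (row_perm s v).
Proof. by apply/matrixP => a b; rewrite !mxE (can2_eq (permK s) (permKV s)). Qed.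

Lemma usub_setrow k l (i : 'I_(k + l)) (v : 'M[R]_(k + l, m)) :
  (exists2 i', i = lshift l i' & forall w, usubmx (setrow i w v) = setrow i' w (usubmx v)
     /\ dsubmx (setrow i w v) = dsubmx v) \/
  (exists2 i', i = rshift k i' & forall w, dsubmx (setrow i w v) = setrow i' w (dsubmx v)
     /\ usubmx (setrow i w v) = usubmx v).
Proof.
case: (split_ordP i) => i' ->; [left|right]; exists i' => // w; split; apply/matrixP => a b; rewrite !mxE.
- by rewrite (inj_eq (@lshift_inj _ _)).
- by rewrite eq_rlshift.
- by rewrite (inj_eq (@rshift_inj _ _)).
- by rewrite eq_lrshift.
Qed.

Lemma wedge_multilinear k l (a : @Defs.form R m k) (b : @Defs.form R m l) :
  multilinear a -> multilinear b -> multilinear (wedge a b).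
Proof.
move=> la lb i v t u w; rewrite /wedge mulrCA -mulrDr; congr (_ * _).
rewrite mulr_sumr -big_split; apply: eq_bigr => s _ /=; rewrite !row_perm_setrow.
have alg1 (e y X Y Z : R) : e * (y * X + Y) * Z = y * (e * X * Z) + e * Y * Z by ring.
have alg2 (e y X Y Z : R) : e * Z * (y * X + Y) = y * (e * Z * X) + e * Z * Y by ring.
case: (usub_setrow (s^-1 i)%g (row_perm s v)) => -[i' -> h];
  have [e1 e1'] := h (t *: u + w); have [e2 e2'] := h u; have [e3 e3'] := h w;
  rewrite e1 e1' e2 e2' e3 e3'.
  have := la i' (usubmx (row_perm s v)) t u w => ->.
  exact: alg1.
have := lb i' (dsubmx (row_perm s v)) t u w => ->.
exact: alg2.
Qed.

Lemma wedge_killed k l (a : @Defs.form R m k) (b : @Defs.form R m l) w :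
  killed_by w a -> killed_by w b -> killed_by w (wedge a b).
Proof.
move=> ka kb v i vi; rewrite /wedge big1 ?mulr0 // => s _.
have e : row (s^-1 i)%g (row_perm s v) = w.
  by rewrite -vi; apply/rowP => j; rewrite !mxE permKV.
case: (split_ordP (s^-1 i)%g) => i' si; rewrite si in e.
  by rewrite (ka _ i') ?mulr0 ?mul0r // row_usubmx.
by rewrite (kb _ i') ?mulr0 // row_dsubmx.
Qed.

Lemma form_of_two_multilinear B : multilinear (form_of_two B : @Defs.form R m 2).
Proof.
move=> i v a u w; rewrite /form_of_two.
have r0 j t : row j (setrow i t v) = if j == i then t else row j v.
  by apply/rowP => b; rewrite !mxE; case: ifP => _; rewrite ?mxE.
rewrite !r0 /form2; case: (eqVneq 0 i) => [<-|i0].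
  by rewrite [1 == 0]eq_sym /= !mulmxDl -!scalemxAl !mxE.
have -> : 1 == i by case: i i0 {r0} => -[|[|]].
by rewrite linearD linearZ /= mulmxDr -scalemxAr !mxE.
Qed.

Lemma form_of_one_multilinear h : multilinear (form_of_one h : @Defs.form R m 1).
Proof.
move=> i v a u w; rewrite /form_of_one (ord1 i).
have r0 t : row 0 (setrow 0 t v) = t by apply/rowP => b; rewrite !mxE.
by rewrite !r0 /form1 mulmxDl -scalemxAl !mxE.
Qed.

Lemma wedge_exp_multilinear B n : multilinear (wedge_exp (form_of_two B) n : @Defs.form R m (n * 2)).
Proof.
elim: n => [|n ih]; first by case.
by apply: wedge_multilinear => //; exact: form_of_two_multilinear.
Qed.

Lemma wedge_exp_alternating B n : alternating_form (wedge_exp (form_of_two B) n : @Defs.form R m (n * 2)).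
Proof.
case: n => [|n]; last exact: wedge_alternating.
move=> s v /=; rewrite mulr1 (_ : s = 1%g) ?odd_perm1 //.
by apply/permP => -[].
Qed.

Lemma form_of_two_killed (B : 'M[R]_m) (w : 'rV[R]_m) :
  B^T = - B -> w *m B = 0 -> killed_by w (form_of_two B).
Proof.
move=> sB wB v i vi; rewrite /form_of_two /form2.
have Bw : B *m w^T = 0.
  by apply: (can_inj (@trmxK _ _ _)); rewrite trmx_mul trmxK sB mulmxN wB oppr0 trmx0.
have [e|e] : row 0 v = w \/ row 1 v = w.
  by case: i vi => -[|[|//]] lti vi; [left|right]; rewrite -vi; congr row; exact: val_inj.
- by rewrite e wB mul0mx mxE.
- by rewrite e -mulmxA Bw mulmx0 mxE.
Qed.

Lemma wedge_exp_killed (B : 'M[R]_m) (w : 'rV[R]_m) n :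
  B^T = - B -> w *m B = 0 -> killed_by w (wedge_exp (form_of_two B) n).
Proof.
move=> sB wB; elim: n => [|n ih]; first by move=> v [].
by apply: wedge_killed => //; exact: form_of_two_killed.
Qed.

Lemma form_of_one_killed (h : 'cV[R]_m) (w : 'rV[R]_m) :
  w *m h = 0 -> killed_by w (form_of_one h).
Proof.
move=> wh v i; rewrite (ord1 i) => vi.
by rewrite /form_of_one /form1 vi wh mxE.
Qed.

End AlternatingForms.

Section TopForms.
Context {R : realType} {m : nat}.

Lemma multilinear_sum k (f : @Defs.form R m k) i v (I : Type) (r : seq I) (a : I -> R) (u : I -> 'rV[R]_m) :
  multilinear f ->
  f (setrow i (\sum_(j <- r) a j *: u j) v) = \sum_(j <- r) a j * f (setrow i (u j) v).
Proof.
move=> mf; elim: r => [|j r ih]; last by rewrite !big_cons mf ih.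
rewrite !big_nil; have := mf i v 1 0 0; rewrite scale1r addr0 mul1r.
by move=> /eqP; rewrite -[X in X == _]addr0 (can_eq (addKr _)) => /eqP.
Qed.

(** Induction on r, where only the first r rows may fail to be basis vectors: expand row r - 1 by
    multilinearity. Once all rows are basis vectors, either they permute the identity matrix or two
    of them coincide. *)
Lemma top_form_zero (d : @Defs.form R m m) : multilinear d -> alternating_form d ->
  d 1%:M = 0 -> forall v, d v = 0.
Proof.
move=> md ad d1.
suff main r : (r <= m)%N -> forall v : 'M[R]_m,
    (forall i : 'I_m, (r <= i)%N -> exists j, row i v = delta_mx 0 j) -> d v = 0.
  by move=> v; apply: (main m (leqnn m)) => i; rewrite leqNgt ltn_ord.
elim: r => [|r ih] rm v hv.
  have [phi hphi] := choice (fun i => hv i (leq0n i)).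
  have [/injectiveP inj|/injectivePn[i [i' ii' e]]] := boolP (injectiveb (finfun phi)).
    have inj' : injective phi by move=> a b ab; apply: inj; rewrite !ffunE.
    have -> : v = row_perm (perm inj') 1%:M.
      by apply/row_matrixP => i; rewrite hphi; apply/rowP => j; rewrite !mxE permE eqxx eq_sym.
    by rewrite ad d1 mulr0.
  rewrite !ffunE in e.
  have : d (row_perm (tperm i i') v) = d v.
    congr d; apply/row_matrixP => a; have -> : row a (row_perm (tperm i i') v) = row (tperm i i' a) v.
      by apply/rowP => b; rewrite !mxE.
    by rewrite !hphi; case: tpermP => [->|->|//]; rewrite e.
  rewrite ad odd_tperm ii' expr1 mulN1r => /eqP.
  by rewrite eq_sym -addr_eq0 -mulr2n mulrn_eq0 /= => /eqP.
pose i0 := Ordinal rm.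
have -> : v = setrow i0 (\sum_j v i0 j *: delta_mx 0 j) v.
  apply/matrixP => a b; rewrite mxE; case: eqP => [->|//].
  rewrite summxE (bigD1 b) //= !mxE !eqxx mulr1 big1 ?addr0 // => j jb.
  by rewrite !mxE eq_sym (negbTE jb) andbF mulr0.
rewrite multilinear_sum // big1 // => j _; rewrite ih ?mulr0 //; first exact: ltnW.
move=> i; rewrite leq_eqVlt => /predU1P[ri|ri].
  exists j; apply/rowP => b; rewrite !mxE -(inj_eq val_inj) /= -ri eqxx //.
have [j' hj'] := hv i ri; exists j'; rewrite -hj'; apply/rowP => b.
by rewrite !mxE -(inj_eq val_inj) /= gtn_eqF.
Qed.

Lemma det_multilinear : multilinear (fun v : 'M[R]_m => \det v).
Proof.
move=> i w a u u'; rewrite -[\det (setrow i u' w)]mul1r.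
have r0 t : row i (setrow i t w) = t by apply/rowP => b; rewrite !mxE eqxx.
have r1 t t' : row' i (setrow i t w) = row' i (setrow i t' w).
  by apply/matrixP => x b; rewrite !mxE eq_sym (negbTE (neq_lift _ _)).
by apply: (@determinant_multilinear _ _ _ _ _ i); rewrite ?r0 ?scale1r.
Qed.

(** The difference of the two sides is a top form that vanishes on the identity matrix. *)
Lemma top_form_det (f : @Defs.form R m m) v : multilinear f -> alternating_form f ->
  f v = \det v * f 1%:M.
Proof.
move=> mf af; apply/eqP; rewrite -subr_eq0; apply/eqP.
apply: (@top_form_zero (fun v => f v - \det v * f 1%:M)).
- by move=> i w a u u'; rewrite mf (det_multilinear i w a u u'); ring.
- move=> s w; rewrite af row_permE det_mulmx det_perm.
  by rewrite mulrBr mulrA.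
- by rewrite det1 mul1r subrr.
Qed.

End TopForms.

Section FixingPermutations.

Lemma tperm_val n (x y a : 'I_n) : tperm x y a =
  (if a == x :> nat then y else if a == y :> nat then x else a) :> nat.
Proof.
rewrite !(inj_eq val_inj); case: tpermP => [->|->|/eqP/negbTE -> /eqP/negbTE ->] //.
  by rewrite eqxx.
by case: eqP => [->|_]; rewrite ?eqxx.
Qed.

(** Signs are compared through determinants of permutation matrices, since the matrix of s is block
    diagonal with an identity block. *)
Lemma perm_fix_left k l (s : 'S_(k + l)) : (forall i, s (lshift l i) = lshift l i) ->
  exists2 t : 'S_l, forall j, s (rshift k j) = rshift k (t j) & odd_perm s = odd_perm t.
Proof.
move=> fs.
have ex j : exists j', s (rshift k j) = rshift k j'.
  case: (split_ordP (s (rshift k j))) => j' e; last by exists j'.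
  by move: e; rewrite -(fs j') => /perm_inj /eqP; rewrite eq_rlshift.
have [f hf] := choice ex.
have inj_f : injective f.
  by move=> a b ab; apply: (@rshift_inj k l); apply: (@perm_inj _ s); rewrite !hf ab.
exists (perm inj_f); first by move=> j; rewrite permE.
have dets p (u : 'S_p) : \det (perm_mx u : 'M[int]_p) = (-1) ^+ u by exact: det_perm.
apply/eqP; rewrite -(inj_eq (@signr_inj int)) -!dets.
have -> : perm_mx s = block_mx 1%:M 0 0 (perm_mx (perm inj_f)) :> 'M[int]_(k + l).
  apply/matrixP => a b; case: (split_ordP a) => a' ->; case: (split_ordP b) => b' ->.
  - by rewrite block_mxEul !mxE fs (inj_eq (@lshift_inj _ _)).
  - by rewrite block_mxEur !mxE fs eq_lrshift.
  - by rewrite block_mxEdl !mxE hf eq_rlshift.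
  - by rewrite block_mxEdr !mxE hf permE (inj_eq (@rshift_inj _ _)).
by rewrite det_ublock det1 mul1r.
Qed.

Lemma perm_fix_right k l (s : 'S_(k + l)) : (forall j, s (rshift k j) = rshift k j) ->
  exists2 t : 'S_k, forall i, s (lshift l i) = lshift l (t i) & odd_perm s = odd_perm t.
Proof.
move=> fs.
have ex i : exists i', s (lshift l i) = lshift l i'.
  case: (split_ordP (s (lshift l i))) => i' e; first by exists i'.
  by move: e; rewrite -(fs i') => /perm_inj /eqP; rewrite eq_lrshift.
have [f hf] := choice ex.
have inj_f : injective f.
  by move=> a b ab; apply: (@lshift_inj k l); apply: (@perm_inj _ s); rewrite !hf ab.
exists (perm inj_f); first by move=> j; rewrite permE.
have dets p (u : 'S_p) : \det (perm_mx u : 'M[int]_p) = (-1) ^+ u by exact: det_perm.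
apply/eqP; rewrite -(inj_eq (@signr_inj int)) -!dets.
have -> : perm_mx s = block_mx (perm_mx (perm inj_f)) 0 0 1%:M :> 'M[int]_(k + l).
  apply/matrixP => a b; case: (split_ordP a) => a' ->; case: (split_ordP b) => b' ->.
  - by rewrite block_mxEul !mxE hf permE (inj_eq (@lshift_inj _ _)).
  - by rewrite block_mxEur !mxE hf eq_lrshift.
  - by rewrite block_mxEdl !mxE fs eq_rlshift.
  - by rewrite block_mxEdr !mxE fs (inj_eq (@rshift_inj _ _)).
by rewrite det_ublock det1 mulr1.
Qed.

End FixingPermutations.

(** * Symplectic bases and nonvanishing of wedge powers *)

Section Darboux.
Context {R : realType}.

(** The standard symplectic matrix with pairs (2i, 2i + 1), on natural numbers so that shifts and
    swaps of pairs are plain arithmetic. *)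
Definition symp (i j : nat) : R :=
  (~~ odd i && (j == i.+1))%:R - (~~ odd j && (i == j.+1))%:R.

Definition darboux m n (B : 'M[R]_m) (v : 'M[R]_(n * 2, m)) : Prop :=
  v *m B *m v^T = \matrix_(i, j) symp i j.

Lemma form2Zl m (B : 'M[R]_m) a u w : form2 B (a *: u) w = a * form2 B u w.
Proof. by rewrite /form2 -!scalemxAl mxE. Qed.

Lemma form2_row m k l (B : 'M[R]_m) (v : 'M[R]_(k, m)) (w : 'M[R]_(l, m)) i j :
  form2 B (row i v) (row j w) = (v *m B *m w^T) i j.
Proof.
rewrite /form2 -row_mul [LHS]mxE [RHS]mxE; apply: eq_bigr => a _.
by rewrite [row _ _ _ _]mxE; congr (_ * _); rewrite !mxE.
Qed.

Lemma darboux_form2 m n (B : 'M[R]_m) (v : 'M[R]_(n * 2, m)) i j : darboux B v ->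
  form2 B (row i v) (row j v) = symp i j.
Proof.
by move=> /matrixP/(_ i j); rewrite [RHS]mxE form2_row.
Qed.

Lemma darbouxP m n (B : 'M[R]_m) (v : 'M[R]_(n * 2, m)) :
  (forall i j, form2 B (row i v) (row j v) = symp i j) -> darboux B v.
Proof.
by move=> h; apply/matrixP => i j; rewrite [RHS]mxE -h form2_row.
Qed.

(** It exchanges pair 0 with pair i. It preserves [symp] and, being a product of two transpositions
    or the identity, is even. *)
Definition pair_swap (i a : nat) : nat :=
  if a == 0%N then i.*2 else if a == i.*2 then 0%N
  else if a == 1%N then i.*2.+1 else if a == i.*2.+1 then 1%N else a.

Lemma symp_pair_swap i a b : symp (pair_swap i a) (pair_swap i b) = symp a b.
Proof.
suff h x y : (~~ odd (pair_swap i x) && (pair_swap i y == (pair_swap i x).+1)) =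
    (~~ odd x && (y == x.+1)) by rewrite /symp !h.
by rewrite /pair_swap; repeat (case: ifP => ?); lia.
Qed.

Lemma pair_swapK i : involutive (pair_swap i).
Proof.
move=> a; move e : (pair_swap i a) => b.
have : (a = 0 /\ b = i.*2 \/ a = i.*2 /\ b = 0 \/ a = 1 /\ b = i.*2.+1 \/
  a = i.*2.+1 /\ b = 1 \/ b = a /\ a <> 0 /\ a <> i.*2 /\ a <> 1 /\ a <> i.*2.+1)%N.
  by rewrite -e /pair_swap; repeat (case: ifP => ?); lia.
by rewrite /pair_swap; repeat (case: ifP => ?); lia.
Qed.

Lemma symp_nonzero a b : symp a b != 0 ->
  exists i, (a = i.*2 /\ b = i.*2.+1) \/ (a = i.*2.+1 /\ b = i.*2).
Proof.
rewrite /symp; case: (boolP (~~ odd a && (b == a.+1))) => h1.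
  by exists a./2; left; lia.
case: (boolP (~~ odd b && (a == b.+1))) => h2; last by rewrite subrr eqxx.
by exists b./2; right; lia.
Qed.

Lemma symp_even i : symp i.*2 i.*2.+1 = 1.
Proof. by rewrite /symp odd_double eqxx /= odd_double /= subr0. Qed.

Lemma symp_odd i : symp i.*2.+1 i.*2 = -1.
Proof. by rewrite /symp /= odd_double /= eqxx /= sub0r. Qed.

Lemma symp_shift a b : symp a.+2 b.+2 = symp a b.
Proof. by rewrite /symp /= !negbK !eqSS. Qed.

Lemma darboux_positive m n (B : 'M[R]_m) (v : 'M[R]_(n * 2, m)) :
  darboux B v -> 0 < wedge_exp (form_of_two B) n v.
Proof.
elim: n v => [|n ih] v dv; first exact: ltr01.
pose L := 2%N; pose K := (n * 2)%N.
pose i0 : 'I_(L + K) := lshift K 0; pose i1 : 'I_(L + K) := lshift K 1.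
pose G (s : 'S_(L + K)) (w : 'M[R]_(L + K, m)) : R := (-1) ^+ s *
  form_of_two B (usubmx (row_perm s w)) * wedge_exp (form_of_two B) n (dsubmx (row_perm s w)).
have aE s (w : 'M[R]_(L + K, m)) : @darboux m n.+1 B w ->
    form_of_two B (usubmx (row_perm s w)) = symp (s i0) (s i1).
  move=> dw; rewrite /form_of_two !row_usubmx.
  have e i : row i (row_perm s w) = row (s i) w by apply/rowP => j; rewrite !mxE.
  by rewrite !e; exact: (@darboux_form2 m n.+1 B w (s i0) (s i1) dw).
(* A term is nonzero only if the first two arguments form a symplectic pair;
   moving this pair to the front by a permutation of pairs shows it positive. *)
have fixed (s : 'S_(L + K)) (w : 'M[R]_(L + K, m)) : @darboux m n.+1 B w ->
    s i0 = i0 -> s i1 = i1 -> 0 < G s w.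
  move=> dw s0 s1.
  have fs i : s (lshift K i) = lshift K i.
    case: i => -[|[|//]] lti; [rewrite (_ : Ordinal lti = 0)|rewrite (_ : Ordinal lti = 1)] => //; exact: val_inj.
  have [t ht odd_t] := perm_fix_left fs.
  rewrite /G aE // s0 s1 (_ : symp i0 i1 = 1); last exact: (symp_even 0).
  have -> : dsubmx (row_perm s w) = row_perm t (dsubmx w).
    by apply/matrixP => a b; rewrite !mxE ht.
  rewrite wedge_exp_alternating odd_t mulr1 mulrA -signr_addb addbb mul1r.
  apply: ih; apply: darbouxP => i j.
  rewrite !row_dsubmx (@darboux_form2 m n.+1 B w (rshift L i) (rshift L j) dw) /=.
  exact: symp_shift.
have even_front (s : 'S_(L + K)) (w : 'M[R]_(L + K, m)) i : @darboux m n.+1 B w ->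
    s i0 = i.*2 :> nat -> s i1 = i.*2.+1 :> nat -> 0 < G s w.
  move=> dw s0 s1.
  have ltf (a : 'I_(L + K)) : (pair_swap i a < L + K)%N.
    have := ltn_ord (s i1); rewrite s1 /pair_swap; have := ltn_ord a.
    by repeat (case: ifP => ?); lia.
  pose f a := Ordinal (ltf a).
  have ff : involutive f by move=> a; apply: val_inj; rewrite /= pair_swapK.
  pose p := perm (inv_inj ff).
  have pp : (p * p = 1)%g by apply/permP => a; rewrite permM !permE ff.
  have op : odd_perm p = false.
    have -> : p = (tperm (s i0) i0 * tperm (s i1) i1)%g.
      apply/permP => a; rewrite permM permE; apply: val_inj => /=.
      move e : (tperm (s i0) i0 a) => b; move/(congr1 val): e => /=.
      have n1 : (i1 : nat) = 1%N by []. have n0 : (i0 : nat) = 0%N by [].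
      rewrite !tperm_val s0 s1 n0 n1 /pair_swap.
      by repeat (case: ifP => ?); lia.
    rewrite odd_permM !odd_tperm -!(inj_eq val_inj) /= s0 s1.
    by case: i {s0 s1 ltf f ff p pp}.
  have -> : G s w = G (s * p)%g (row_perm p w).
    rewrite /G -!row_permM -mulgA pp mulg1 odd_permM op addbF //.
  apply: fixed.
  - apply: darbouxP => a b.
    have e c : row c (row_perm p w) = row (f c) w by apply/rowP => j; rewrite !mxE permE.
    rewrite !e (@darboux_form2 m n.+1 B w (f a) (f b) dw) /=; exact: symp_pair_swap.
  - by apply: val_inj; rewrite permM permE /= s0 /pair_swap; repeat (case: ifP => ?); lia.
  - by apply: val_inj; rewrite permM permE /= s1 /pair_swap; repeat (case: ifP => ?); lia.
have nonneg (s : 'S_(L + K)) : 0 <= G s v.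
  have [z|nz] := eqVneq (symp (s i0) (s i1)) 0; first by rewrite /G aE // z mulr0 mul0r.
  have [i [[s0 s1]|[s0 s1]]] := symp_nonzero nz; first exact: ltW (even_front s v i dv s0 s1).
  (* The pair occurs in reversed order: swapping the first two arguments changes both the sign of
     the permutation and the sign of the 2-form. *)
  pose t := tperm i0 i1.
  have -> : G s v = G (t * s)%g v.
    rewrite /G odd_permM odd_tperm (_ : i0 != i1) // signr_addb !aE // !permM tpermL tpermR s0 s1 symp_even symp_odd.
    have -> : dsubmx (row_perm (t * s)%g v) = dsubmx (row_perm s v).
      by apply/matrixP => a b; rewrite !mxE permM tpermD.
    by congr (_ * _); rewrite expr1 mulrN1 mulN1r mulr1.
  by apply/ltW/(even_front _ _ i) => //; rewrite permM ?tpermL ?tpermR.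
(* The identity permutation supplies the strictly positive term among nonnegative ones. *)
have pos1 : 0 < G 1%g v by apply: fixed => //; rewrite perm1.
rewrite [wedge_exp _ _]/= /wedge; apply: mulr_gt0.
  by rewrite invr_gt0 ltr0n muln_gt0 !fact_gt0.
rewrite (bigD1 1%g) //= ltr_pwDl //.
by apply: sumr_ge0 => s _; exact: nonneg.
Qed.

Lemma symp_front a b : (a < 2)%N -> symp a b.+2 = 0 /\ symp b.+2 a = 0.
Proof.
move=> a2; rewrite /symp; split.
  rewrite (_ : _ && _ = false); last by lia.
  by rewrite (_ : _ && _ = false) ?subrr //; lia.
rewrite (_ : _ && _ = false); last by lia.
by rewrite (_ : _ && _ = false) ?subrr //; lia.
Qed.

Lemma symp_unit n : \matrix_(i < n * 2, j < n * 2) symp i j \in @unitmx R (n * 2).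
Proof.
elim: n => [|n ih]; first by rewrite unitmxE det_mx00 unitr1.
pose S2 : 'M[R]_2 := \matrix_(i, j) symp i j.
pose Sn : 'M[R]_(n * 2) := \matrix_(i, j) symp i j.
have u : block_mx S2 0 0 Sn \in unitmx.
  rewrite unitmxE det_ublock unitrM -!unitmxE ih andbT.
  rewrite unitmxE unitfE (expand_det_row _ 0) big_ord_recl big_ord1 /cofactor !det_mx11 !mxE /=.
  by rewrite /symp /= !subrr mul0r add0r sub0r subr0 mul1r expr1 mulrNN mulr1 oner_eq0.
rewrite (_ : \matrix_(i, j) _ = block_mx S2 0 0 Sn) //.
apply/matrixP => a b; rewrite mxE; case: (split_ordP a) => a' ->; case: (split_ordP b) => b' ->.
- by rewrite block_mxEul mxE.
- by rewrite block_mxEur mxE; exact: (symp_front b' (ltn_ord a')).1.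
- by rewrite block_mxEdl mxE; exact: (symp_front a' (ltn_ord b')).2.
- by rewrite block_mxEdr mxE; exact: symp_shift.
Qed.

(** Symplectic Gram-Schmidt: P projects onto the B-orthogonal complement of the pairs already found,
    and a nonzero entry of P B P^T yields a new pair there after rescaling. *)
Lemma darboux_ex m n (B : 'M[R]_m) : B^T = - B -> (n * 2 <= \rank B)%N ->
  exists v : 'M[R]_(n * 2, m), darboux B v.
Proof.
move=> sB; elim: n => [|n ih] rB; first by exists 0; apply/matrixP => -[].
have [|v dv] := ih; first by apply: leq_trans rB; rewrite leq_mul2r leqnSn orbT.
pose J : 'M[R]_(n * 2) := \matrix_(i, j) symp i j.
have uJ : J \in unitmx := symp_unit n.
pose P := 1%:M - B *m v^T *m invmx J *m v.
have PBv : P *m B *m v^T = 0.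
  rewrite /P !mulmxBl mul1mx -!mulmxA (mulmxA v) dv -/J (mulmxA v^T) (mulmxA B).
  by rewrite !mulmxA mulmxKV // subrr.
have PBP : P *m B *m P^T = P *m B.
  rewrite {2}/P linearB /= trmx1 mulmxBr mulmx1 !trmx_mul -!mulmxA.
  by rewrite !mulmxA PBv !mul0mx subr0.
(* Otherwise B = B v^T J^-1 v B would factor through dimension 2n, against the rank being at least
   2n + 2. *)
have : P *m B != 0.
  apply/eqP => PB0; move: rB; rewrite leqNgt => /negP; apply.
  have -> : B = B *m v^T *m invmx J *m v *m B.
    by apply/eqP; rewrite -subr_eq0 -{1}[B]mul1mx -mulmxBl -/P PB0.
  rewrite mulSn ltnS (leq_trans (mxrankM_maxl _ _)) // (leq_trans (mxrankM_maxr _ _)) //.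
  by rewrite (leq_trans (rank_leq_row _)) // leqnSn.
rewrite -PBP => /matrix0Pn[i [j a0]].
pose a := (P *m B *m P^T) i j; pose x := a^-1 *: row i P; pose y := row j P.
have Bsk : forall u w, form2 B u w = - form2 B w u by apply/form2_skewP.
have B0 u : form2 B u u = 0.
  by apply/eqP; rewrite -[_ == 0](mulrn_eq0 _ 2) mulr2n {1}Bsk addNr.
have xy : form2 B x y = 1.
  have e : form2 B (row i P) (row j P) = a by rewrite form2_row.
  by rewrite form2Zl e mulVf.
have Pv k l : form2 B (row k P) (row l v) = 0 by rewrite form2_row PBv mxE.
have xv l : form2 B x (row l v) = 0 by rewrite form2Zl Pv mulr0.
pose V : 'M[R]_(2 + n * 2, m) := col_mx (\matrix_(i < 2) if i == 0 then x else y) v.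
have V0 : row (lshift (n * 2) (0 : 'I_2)) V = x.
  by rewrite /V rowKu rowK.
have V1 : row (lshift (n * 2) (1 : 'I_2)) V = y.
  by rewrite /V rowKu rowK.
have Vr l : row (rshift 2 l) V = row l v by rewrite /V rowKd.
exists V; apply: darbouxP => p q.
have ord2 (c : 'I_2) : c = 0 \/ c = 1.
  by case: c => -[|[|//]] lt; [left|right]; exact: val_inj.
case: (split_ordP p) => p' ->; case: (split_ordP q) => q' ->.
- case: (ord2 p') => ->; case: (ord2 q') => ->; rewrite ?V0 ?V1.
  + by rewrite B0 /symp /= subrr.
  + by rewrite xy; symmetry; exact: (symp_even 0).
  + by rewrite Bsk xy; symmetry; exact: (symp_odd 0).
  + by rewrite B0 /symp /= subrr.
- rewrite Vr [RHS](symp_front q' (ltn_ord p')).1.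
  by case: (ord2 p') => ->; rewrite ?V0 ?V1 ?xv ?Pv.
- rewrite Vr [RHS](symp_front p' (ltn_ord q')).2 Bsk.
  by case: (ord2 q') => ->; rewrite ?V0 ?V1 ?xv ?Pv oppr0.
- by rewrite !Vr (darboux_form2 p' q' dv); symmetry; exact: symp_shift.
Qed.

(** Evaluate on a symplectic basis followed by xi. Since xi lies in the kernel of B, only
    permutations that keep xi in the last place contribute, and each contributes a positive
    amount. *)
Lemma wedge_nonzero m n (B : 'M[R]_m) (h : 'cV[R]_m) (xi : 'rV[R]_m) :
  B^T = - B -> (n * 2 <= \rank B)%N -> xi *m B = 0 -> form1 h xi = 1 ->
  exists v, wedge (wedge_exp (form_of_two B) n) (form_of_one h) v != 0.
Proof.
move=> sB rB xiB hxi; have [v dv] := darboux_ex sB rB.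
have pos := darboux_positive dv.
pose V := col_mx v xi; exists V; rewrite gt_eqF // /wedge; apply: mulr_gt0.
  by rewrite invr_gt0 ltr0n muln_gt0 !fact_gt0.
pose G (s : 'S_(n * 2 + 1)) := (-1) ^+ s *
  wedge_exp (form_of_two B) n (usubmx (row_perm s V)) *
  form_of_one h (dsubmx (row_perm s V)).
have fixed (s : 'S_(n * 2 + 1)) : s (rshift _ 0) = rshift _ 0 -> 0 < G s.
  move=> s0.
  have fs j : s (rshift (n * 2) j) = rshift (n * 2) j by rewrite (ord1 j).
  have [t ht odd_t] := perm_fix_right fs.
  have -> : G s = (-1) ^+ s * wedge_exp (form_of_two B) n (row_perm t v) * form1 h xi.
    rewrite /G; congr (_ * wedge_exp _ _ _ * _).
      by apply/matrixP => a b; rewrite 2![LHS]mxE ht [RHS]mxE; exact: col_mxEu.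
    rewrite /form_of_one; congr (form1 _ _).
    by apply/rowP => b; rewrite 3![LHS]mxE s0; exact: col_mxEd.
  by rewrite wedge_exp_alternating odd_t mulrA -signr_addb addbb mul1r hxi mulr1.
have nonneg (s : 'S_(n * 2 + 1)) : 0 <= G s.
  case: (split_ordP (s^-1 (rshift (n * 2) (0 : 'I_1)))%g) => i si; last first.
    apply/ltW/fixed; move/(congr1 s): si; rewrite permKV (ord1 i) => <- //.
  rewrite /G (wedge_exp_killed sB xiB (i := i)) ?mulr0 ?mul0r //.
  by apply/rowP => b; rewrite 3![LHS]mxE -si permKV; exact: col_mxEd.
rewrite (bigD1 1%g) //= ltr_pwDl //; first by apply: fixed; rewrite perm1.
by apply: sumr_ge0 => s _; exact: nonneg.
Qed.

End Darboux.

(** * Bordered skew forms *)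

Section BorderedForm.
Context {R : realType} {m : nat}.
Implicit Types (B : 'M[R]_m) (h : 'cV[R]_m).

Definition bordered B h : 'M[R]_(m + 1) := block_mx B h (- h^T) 0.

Lemma bordered_tr B h : B^T = - B -> (bordered B h)^T = - bordered B h.
Proof.
move=> sB; rewrite /bordered tr_block_mx sB trmx0 linearN /= trmxK.
by rewrite opp_block_mx opprK oppr0.
Qed.

(** The inverse of a skew matrix is skew, so its lower right entry is 0; the remaining identities
    are the blocks of the two products with the bordered matrix. *)
Lemma bordered_inverse B h (X := invmx (bordered B h)) :
  B^T = - B -> bordered B h \in unitmx ->
  [/\ (ulsubmx X)^T = - ulsubmx X, B *m ulsubmx X + h *m dlsubmx X = 1%:M,
      dlsubmx X *m B = 0, dlsubmx X *m h = 1%:M &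
      B *m ulsubmx X *m B = B].
Proof.
move=> sB uO.
have OX : bordered B h *m X = 1%:M by rewrite mulmxV.
have XO : X *m bordered B h = 1%:M by rewrite mulVmx.
have tX : X^T = - X.
  rewrite -[X^T]mul1mx -XO -mulmxA -[bordered B h]opprK -bordered_tr // mulNmx.
  by rewrite -trmx_mul XO trmx1 mulmxN mulmx1.
move: tX OX XO; rewrite -(submxK X) /bordered.
set N := ulsubmx _; set a := ursubmx _; set xi := dlsubmx _; set e := drsubmx _.
rewrite tr_block_mx opp_block_mx !mulmx_block (scalar_mx_block m 1 1).
case/eq_block_mx => tN ta _ te.
have e0 : e = 0.
  have : e 0 0 = - e 0 0 by move/matrixP/(_ 0 0): te; rewrite !mxE.
  move/eqP; rewrite -addr_eq0 -mulr2n mulrn_eq0 /= => /eqP e0.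
  by apply/matrixP => i j; rewrite !ord1 e0 [RHS]mxE.
case/eq_block_mx => h1 _ _ _; case/eq_block_mx => _ _ h2 h3.
have xiB : xi *m B = 0 by move: h2; rewrite e0 mul0mx addr0.
rewrite block_mxKul block_mxKdl; split=> //; first by move: h3; rewrite mulmx0 addr0.
have -> : B *m N = 1%:M - h *m xi by rewrite -h1 addrK.
by rewrite mulmxBl mul1mx -mulmxA xiB mulmx0 subr0.
Qed.

(** The row xi bounds the rank of B by m - 1 from above, and 1 = B N + h xi, whose second summand
    has rank at most one, bounds it from below. *)
Lemma bordered_rank B h (X := invmx (bordered B h)) :
  B^T = - B -> bordered B h \in unitmx -> (\rank B).+1 = m.
Proof.
move=> sB uO; have [_ e xiB xih _] := bordered_inverse sB uO; rewrite -/X in e xiB xih.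
have xi0 : dlsubmx X != 0.
  by apply: contra_eq_neq xih => ->; rewrite mul0mx eq_sym oner_neq0.
apply/eqP; rewrite eqn_leq; apply/andP; split.
  have : (dlsubmx X <= kermx B)%MS by apply/sub_kermxP.
  move/mxrankS; rewrite mxrank_ker rank_rV xi0 => r1.
  by rewrite -addn1 -leq_subRL ?rank_leq_row.
have : (\rank (B *m ulsubmx X + h *m dlsubmx X)%R <= \rank B + 1)%N.
  rewrite (leq_trans (mxrank_add _ _)) // leq_add ?mxrankM_maxl //.
  by rewrite (leq_trans (mxrankM_maxr _ _)) // rank_leq_row.
by rewrite e mxrank1 addn1.
Qed.

(** Let (w, t) be a null vector of the bordered matrix. If t = 0 then w itself serves. If t is
    nonzero, oddness of m gives a null vector u of B, and pairing the equation w B = t h^T with u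
    leaves t (u h) = 0. *)
Lemma bordered_singular B h : B^T = - B -> odd m -> bordered B h \notin unitmx ->
  exists w : 'rV[R]_m, [/\ w != 0, w *m B = 0 & w *m h = 0].
Proof.
move=> sB om; rewrite unitmxE unitfE negbK => /det0P[x x0].
rewrite -(hsubmxK x) /bordered mul_row_block mulmx0 addr0.
set w := lsubmx x; set t := rsubmx x.
rewrite -(row_mx0 _ 1 m 1) => /eq_row_mx[e1 e2].
have [t0|t0] := eqVneq t 0.
  exists w; split => //; last by move: e1; rewrite t0 mul0mx addr0.
  by apply: contra x0 => /eqP w0; rewrite -(hsubmxK x) -/w -/t w0 t0 row_mx0.
have /det0P[u u0 uB] : \det B == 0.
  have : \det B = - \det B by rewrite -{1}det_tr sB -scaleN1r detZ -signr_odd om expr1 mulN1r.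
  by move/eqP; rewrite -addr_eq0 -mulr2n mulrn_eq0.
have Bu : B *m u^T = 0.
  by apply: (can_inj (@trmxK _ _ _)); rewrite trmx_mul trmxK sB mulmxN uB oppr0 trmx0.
exists u; split=> //.
have : t *m (u *m h)^T = 0.
  move/(congr1 (fun z => z *m u^T)): e1.
  by rewrite mulmxDl -mulmxA Bu mulmx0 add0r mul0mx -mulmxA mulNmx mulmxN -trmx_mul => /eqP; rewrite oppr_eq0 => /eqP.
rewrite (mx11_scalar t) mul_scalar_mx => /eqP; rewrite scaler_eq0.
have -> : t 0 0 == 0 = false.
  by apply/negbTE; apply: contra t0 => /eqP t0; rewrite (mx11_scalar t) t0 -scalemx1 scale0r.
by move=> /eqP /(congr1 trmx); rewrite trmxK trmx0.
Qed.

End BorderedForm.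

Section WedgeVector.
Context {R : realType} {m : nat}.

Lemma det_setrow1 i (w : 'rV[R]_m) : \det (setrow i w 1%:M) = w 0 i.
Proof.
have -> : w = \sum_j w 0 j *: delta_mx 0 j by exact: row_sum_delta.
rewrite (multilinear_sum _ _ _ _ _ det_multilinear) (bigD1 i) //= big1 ?addr0.
  rewrite (_ : setrow _ _ _ = 1%:M) ?det1 ?mulr1; last first.
    by apply/matrixP => a b; rewrite !mxE; case: eqP => [->|//]; rewrite eqxx eq_sym.
  by rewrite -row_sum_delta.
move=> j ji; rewrite (determinant_alternate ji) ?mulr0 // => b.
by rewrite !mxE eqxx (negbTE ji) eqxx [b == j]eq_sym.
Qed.

End WedgeVector.

Section WedgePullback.
Context {R : realType} {m : nat}.

(** Replacing row i of the identity by w, where w_i is nonzero, gives a matrix of determinant w_i on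
    which f vanishes. The equation k = m is a hypothesis because the degrees n * 2 + 1 and 2 * n + 1
    are not convertible. *)
Lemma top_form_killed k (f : @Defs.form R m k) (w : 'rV[R]_m) : k = m ->
  multilinear f -> alternating_form f -> w != 0 -> killed_by w f -> forall v, f v = 0.
Proof.
move=> e; case: m / e f w => f w mf af w0 kw v.
have [i wi] : exists i, w 0 i != 0 by have /matrix0Pn[a [b ab]] := w0; exists b; rewrite -(ord1 a).
have f0 : f (setrow i w 1%:M) = 0 by apply: (kw _ i); apply/rowP => b; rewrite !mxE eqxx.
have := @top_form_det _ _ f (setrow i w 1%:M) mf af.
rewrite f0 det_setrow1 => /esym/eqP; rewrite mulf_eq0 (negbTE wi) /= => /eqP f1.
by rewrite top_form_det // f1 mulr0.
Qed.

Lemma top_form_cast k (e : k = m) (f : @Defs.form R m k) v :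
  multilinear f -> alternating_form f ->
  f v = \det (castmx (e, erefl) v) * f (castmx (esym e, erefl) 1%:M).
Proof. by case: m / e f v => f v mf af; rewrite !castmx_id top_form_det. Qed.

Lemma castmx_mul1 k (e : k = m) (J : 'M[R]_m) :
  castmx (e, erefl) (castmx (esym e, erefl) 1%:M *m J) = J.
Proof. by case: m / e J => J; rewrite !castmx_id mul1mx. Qed.

Lemma wedge_pullback k l (a a' : @Defs.form R m k) (b b' : @Defs.form R m l) (J : 'M[R]_m) v :
  (forall v, a' v = a (v *m J)) -> (forall v, b' v = b (v *m J)) ->
  wedge a' b' v = wedge a b (v *m J).
Proof.
move=> ha hb; rewrite /wedge; congr (_ * _); apply: eq_bigr => s _; rewrite ha hb.
have e : row_perm s v *m J = row_perm s (v *m J) by rewrite !row_permE mulmxA.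
by rewrite mul_usub_mx mul_dsub_mx e.
Qed.

Lemma wedge_exp_pullback (a a' : @Defs.form R m 2) (J : 'M[R]_m) n v :
  (forall v, a' v = a (v *m J)) -> wedge_exp a' n v = wedge_exp a n (v *m J).
Proof.
by move=> h; elim: n v => [//|n ih] v; exact: wedge_pullback.
Qed.

End WedgePullback.

Section TopWedge.
Context {R : realType} {n : nat}.
Local Notation m := (2 * n + 1)%N.
Implicit Types (B J : 'M[R]_m) (h : 'cV[R]_m).

Definition cosymplectic_form B h : @Defs.form R m (n * 2 + 1) :=
  wedge (wedge_exp (form_of_two B) n) (form_of_one h).

Lemma cosymplectic_multilinear B h : multilinear (cosymplectic_form B h).
Proof.
by apply: wedge_multilinear; [exact: wedge_exp_multilinear | exact: form_of_one_multilinear].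
Qed.

(** A singular bordered matrix yields a common null vector of B and h, and this vector kills the top
    form. *)
Lemma cosymplectic_bordered B h v : B^T = - B ->
  cosymplectic_form B h v != 0 -> bordered B h \in unitmx.
Proof.
move=> sB; apply: contraR => nu.
have om : odd m by rewrite mul2n oddD odd_double.
have [w [w0 wB wh]] := bordered_singular sB om nu; apply/eqP.
apply: (top_form_killed _ (@cosymplectic_multilinear B h) _ w0).
- by rewrite mulnC.
- exact: wedge_alternating.
- by apply: wedge_killed; [exact: wedge_exp_killed|exact: form_of_one_killed].
Qed.

Lemma cosymplectic_sum B h v :
  cosymplectic_form B h v = \sum_i cosymplectic_form B (delta_mx i 0) v * h i 0.
Proof.
rewrite /cosymplectic_form /wedge.
under [RHS]eq_bigr do rewrite -mulrA; rewrite -mulr_sumr; congr (_ * _).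
under [RHS]eq_bigr do rewrite mulr_suml; rewrite exchange_big; apply: eq_bigr => s _ /=.
set E := (-1) ^+ s * _; set w := dsubmx _.
transitivity (E * \sum_i (form_of_one (delta_mx i 0) w * h i 0)); last first.
  by rewrite mulr_sumr; apply: eq_bigr => i _; rewrite mulrA.
congr (_ * _).
rewrite /form_of_one /form1 mxE; apply: eq_bigr => i _; congr (_ * _).
rewrite [RHS]mxE (bigD1 i) //= big1 ?addr0; first by rewrite [delta_mx _ _ _ _]mxE !eqxx mulr1.
by move=> j ji; rewrite [delta_mx _ _ _ _]mxE (negbTE ji) mulr0.
Qed.

Fact top_degree : (n * 2 + 1)%N = m.
Proof. by rewrite mulnC. Qed.

(** The vector V such that B^n /\ h = h(V) det, where det is the coordinate volume form. *)
Definition wedge_vector B : 'rV[R]_m :=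
  \row_i cosymplectic_form B (delta_mx i 0) (castmx (esym top_degree, erefl) 1%:M).

Lemma wedge_vector_entry B i : wedge_vector B 0 i =
  cosymplectic_form B (delta_mx i 0) (castmx (esym top_degree, erefl) 1%:M).
Proof. by rewrite mxE. Qed.

Lemma wedge_vectorE B h v :
  cosymplectic_form B h v = \det (castmx (top_degree, erefl) v) * (wedge_vector B *m h) 0 0.
Proof.
rewrite (top_form_cast top_degree) //; last 2 first.
- exact: cosymplectic_multilinear.
- exact: wedge_alternating.
rewrite cosymplectic_sum [in RHS]mxE; congr (_ * _); apply: eq_bigr => i _.
by rewrite [wedge_vector _ _ _]mxE.
Qed.

(** V depends on the volume form and so is a vector density: by naturality of the wedge product, the
    value on the standard basis becomes the value on the rows of J, which costs a factor det J. *)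
Lemma wedge_vector_congr B J : wedge_vector (J *m B *m J^T) *m J = \det J *: wedge_vector B.
Proof.
apply/rowP => i.
have -> : (wedge_vector (J *m B *m J^T) *m J) 0 i =
    cosymplectic_form (J *m B *m J^T) (J *m delta_mx i 0) (castmx (esym top_degree, erefl) 1%:M).
  by rewrite wedge_vectorE castmxKV det1 mul1r mulmxA -colE [RHS]mxE.
rewrite [RHS]mxE [wedge_vector _ _ _]mxE.
set v := castmx _ _.
have -> : cosymplectic_form (J *m B *m J^T) (J *m delta_mx i 0) v =
    cosymplectic_form B (delta_mx i 0) (v *m J).
  apply: wedge_pullback => w; first apply: wedge_exp_pullback => {w} w.
    by rewrite /form_of_two /form2 !row_mul trmx_mul !mulmxA.
  by rewrite /form_of_one /form1 row_mul !mulmxA.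
by rewrite (wedge_vectorE B _ (v *m J)) (wedge_vectorE B _ v) castmx_mul1 castmxKV det1 mul1r.
Qed.

Lemma wedge_vector_neq0 B : B^T = - B -> \rank B = (2 * n)%N -> wedge_vector B != 0.
Proof.
move=> sB rB.
have [xi xi0 xiB] : exists2 xi : 'rV[R]_m, xi != 0 & xi *m B = 0.
  have : kermx B != 0 by rewrite -mxrank_eq0 mxrank_ker rB addKn.
  move=> /rowV0Pn[xi /sub_kermxP xiB xi0]; by exists xi.
pose h := ((xi *m xi^T) 0 0)^-1 *: xi^T.
have hxi : form1 h xi = 1.
  by rewrite /form1 -scalemxAr mxE mulVf // gt_eqF // dot_gt0.
have [v] : exists v, cosymplectic_form B h v != 0.
  by apply: wedge_nonzero xiB hxi => //; rewrite rB mulnC.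
by apply: contra_neq => v0; rewrite wedge_vectorE v0 mul0mx mxE mulr0.
Qed.

Lemma wedge_vector_form B h : (wedge_vector B *m h) 0 0 != 0 ->
  exists v, cosymplectic_form B h v != 0.
Proof.
by move=> h0; exists (castmx (esym top_degree, erefl) 1%:M); rewrite wedge_vectorE castmxKV det1 mul1r.
Qed.

End TopWedge.

(** * From gauge solutions to almost cosymplectic structures *)

Section ChangeOfBasis.
Context {R : realType} {m : nat}.
Implicit Types (J K T G : 'M[R]_m) (X : 'rV[R]_m).

Lemma end_bil_congr J K T G : K *m J = 1%:M ->
  (J *m T *m K) *m (J *m G *m J^T) = J *m (T *m G) *m J^T.
Proof. by move=> KJ; rewrite -!mulmxA (mulmxA K) KJ mul1mx !mulmxA. Qed.

Lemma bil_vec_congr J K G X : K *m J = 1%:M ->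
  (J *m G *m J^T) *m (X *m K)^T = J *m (G *m X^T).
Proof. by move=> KJ; rewrite trmx_mul -!mulmxA (mulmxA J^T) -trmx_mul KJ trmx1 mul1mx. Qed.

End ChangeOfBasis.

Section MusicalFields.
Context {R : realType} {m : nat} (M : manifold R m).
Implicit Types (c d : chart R m M) (p q : M) (U V : set M).

Lemma metric_spd (g : M -> 'M[R]_m) p : riemannian_metric g -> spd (g p).
Proof. by case=> _ sg pg; apply/form2_spdP; split; [exact: sg | exact: pg]. Qed.

Lemma skew_endomorphism_two_form (g theta : M -> 'M[R]_m) :
  riemannian_metric g -> endomorphism_field theta -> skew_symmetric g theta ->
  two_form (fun p => theta p *m g p) /\
  forall p, \rank (theta p *m g p) = \rank (theta p).
Proof.
move=> mg et st; have [bg _ _] := mg.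
split; last by move=> p; rewrite mxrankMfree // row_free_unit; exact/spd_unit/metric_spd.
split.
  apply/bilinear_fieldP => c cc; have oc := cdom_open c.
  have := smoM oc ((endomorphism_fieldP theta).1 et c cc) ((bilinear_fieldP g).1 bg c cc).
  apply: smo_ext oc _ => p cp; have cq := compatible_at p; have qq := chart_at_dom p.
  exact: end_bil_congr (jacK cq cc qq cp).
move=> p; apply/form2_skewP/matrixP => i j.
have [X vX Xp] := vector_field_ex p (delta_mx 0 i).
have [Y vY Yp] := vector_field_ex p (delta_mx 0 j).
have := st X Y vX vY p; rewrite Xp Yp => e.
rewrite [in LHS]mxE [in RHS]mxE -!form2_delta.
have [_ sg _] := mg.
have -> : form2 (theta p *m g p) (delta_mx 0 j) (delta_mx 0 i) =
    form2 (g p) (delta_mx 0 i) (delta_mx 0 j *m theta p).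
  by rewrite sg /form2 !mulmxA.
by rewrite -[LHS]opprK -e /form2 !mulmxA.
Qed.

Lemma metric_one_form (g : M -> 'M[R]_m) X : bilinear_field g -> vector_field X ->
  one_form (fun p => g p *m (X p)^T).
Proof.
move=> bg vX; apply/one_formP => c cc; have oc := cdom_open c.
have := smoM oc ((bilinear_fieldP g).1 bg c cc) (smo_tr oc ((vector_fieldP X).1 vX c cc)).
apply: smo_ext oc _ => p cp; have cq := compatible_at p; have qq := chart_at_dom p.
exact: bil_vec_congr (jacK cq cc qq cp).
Qed.

Lemma smf_sum (I : Type) (l : seq I) (P : pred I) U (f : I -> M -> R) : open U ->
  (forall i, P i -> smf U (f i)) -> smf U (fun p => \sum_(i <- l | P i) f i p).
Proof.
move=> oU hf c ac k; apply: Ck_sum; first exact: open_chart_image.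
by move=> i Pi; exact: hf.
Qed.

Lemma smf_wedge k l U (a : M -> @Defs.form R m k) (b : M -> @Defs.form R m l) v : open U ->
  (forall v, smf U (fun p => a p v)) -> (forall v, smf U (fun p => b p v)) ->
  smf U (fun p => wedge (a p) (b p) v).
Proof.
move=> oU ha hb; apply: smfM => //; first exact: smf_cst.
apply: smf_sum => // s _; apply: smfM => //; apply: smfM => //; exact: smf_cst.
Qed.

Lemma smf_wedge_exp U (a : M -> @Defs.form R m 2) n v : open U ->
  (forall v, smf U (fun p => a p v)) -> smf U (fun p => wedge_exp (a p) n v).
Proof.
move=> oU ha; elim: n v => [|n ih] v; first exact: smf_cst.
exact: smf_wedge.
Qed.

Lemma smf_form2 U (B : M -> 'M[R]_m) (X Y : M -> 'rV[R]_m) : open U -> smo U B ->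
  smo U X -> smo U Y -> smf U (fun p => form2 (B p) (X p) (Y p)).
Proof.
move=> oU hB hX hY.
exact: (smoM oU (smoM oU hX hB) (smo_tr oU hY) 0 0).
Qed.

End MusicalFields.

Section Normalization.
Context {R : realType} {m : nat}.
Implicit Types (g J : 'M[R]_m) (u : 'rV[R]_m).

Definition normalized g u : 'rV[R]_m := (Num.sqrt (form2 g u u))^-1 *: u.

(** Passing to unit length leaves only the sign of the determinant factor in play. *)
Lemma normalizedZ g a u : 0 < a -> spd g -> normalized g (a *: u) = normalized g u.
Proof.
move=> a0 sg; have e : form2 g (a *: u) (a *: u) = a ^+ 2 * form2 g u u.
  by rewrite /form2 linearZ /= -!scalemxAl -scalemxAr !mxE expr2 !mulrA.
rewrite /normalized e sqrtrM ?sqr_ge0 // sqrtr_sqr gtr0_norm // scalerA.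
by rewrite invfM mulrAC mulVf ?mul1r // gt_eqF.
Qed.

Lemma normalized_congr g J u : normalized (J *m g *m J^T) u *m J = normalized g (u *m J).
Proof. by rewrite /normalized -scalemxAl /form2 trmx_mul !mulmxA. Qed.

End Normalization.

Section Orientation.
Context {R : realType} {n : nat} (M : manifold R (2 * n + 1)).
Local Notation m := (2 * n + 1)%N.
Implicit Types (c d : chart R m M) (p q : M) (U V : set M).

Lemma smo_wedge_vector U (B : M -> 'M[R]_m) : open U -> smo U B ->
  smo U (fun p => wedge_vector (B p)).
Proof.
move=> oU hB i j; rewrite ord1.
apply: (smf_ext oU (fun p _ => esym (wedge_vector_entry (B p) j))).
apply: smf_wedge => // w; last exact: smf_cst.
apply: smf_wedge_exp => // {}w; apply: smf_form2 => //; exact: smo_cst.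
Qed.

Lemma normalized_wedge_vector (g B J K : 'M[R]_m) (a : R) : J *m K = 1%:M ->
  normalized g (a *: wedge_vector B) *m J =
  normalized (K *m g *m K^T) ((a * \det J) *: wedge_vector (K *m B *m K^T)).
Proof.
move=> JK.
have JJ A : J *m (K *m A *m K^T) *m J^T = A.
  by rewrite -!mulmxA -trmx_mul JK trmx1 mulmx1 !mulmxA JK mul1mx.
rewrite -{1}(JJ g) normalized_congr -scalemxAl -{1}(JJ B) wedge_vector_congr.
by rewrite scalerA.
Qed.

Variables (b : M -> chart R m M) (g B : M -> 'M[R]_m).
Hypotheses (b_compatible : forall p, compatible (b p)) (b_dom : forall p, cdom (b p) p)
  (b_oriented : forall p q, cdom (b p) q -> 0 < \det (jac (b q) (b p) q)).
Hypotheses (g_metric : riemannian_metric g) (B_form : two_form B)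
  (B_rank : forall p, \rank (B p) = (2 * n)%N).

(* [wedge_vector] transforms as a vector up to the determinant of the change of
   basis, whose sign is fixed by the oriented charts [b]. *)
Definition reeb p : 'rV[R]_m :=
  normalized (g p) (\det (jac (b p) (chart_at p) p) *: wedge_vector (B p)).

(** The chart [b q] used in [reeb] may jump with q. On the domain of a fixed [b p] it can be
    replaced by [b p]: the determinant changes by a positive factor, which normalization removes.
    Smoothness can then be read from the formula. *)
Lemma vecc_reeb p c q : compatible c -> cdom c q -> cdom (b p) q ->
  vecc reeb c q =
  normalized (bilc g c q) (\det (jac (b p) c q) *: wedge_vector (bilc B c q)).
Proof.
move=> cc cq bq; set a := chart_at q; have ca := compatible_at q; have aq := chart_at_dom q.
have cbq := b_compatible q; have bqq := b_dom q; have cbp := b_compatible p.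
have -> : vecc reeb c q = normalized (bilc g c q)
    (\det (jac (b q) c q) *: wedge_vector (bilc B c q)).
  rewrite (@jac_comp _ _ _ (b q) a c q) // det_mulmx.
  exact: normalized_wedge_vector (jacK ca cc aq cq).
rewrite (@jac_comp _ _ _ (b q) (b p) c q) // det_mulmx -scalerA.
apply: normalizedZ; first exact: b_oriented.
by apply: bilc_spd => //; exact: metric_spd.
Qed.

Lemma reeb_vector_field : vector_field reeb.
Proof.
have [bg _ _] := g_metric; have [bB _] := B_form.
apply: (tensor_intro (vec_tensorial reeb)) => p.
have cc := compatible_at p; set c := chart_at p; have cp := chart_at_dom p.
have cb := b_compatible p; have bp := b_dom p.
pose U := cdom c `&` cdom (b p).
have oU : open U by apply: openI; exact: cdom_open.
exists c, U; split => //; first by move=> q [].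
pose Y q := \det (jac (b p) c q) *: wedge_vector (bilc B c q).
apply: (@smo_ext _ _ _ _ _ U (fun q => normalized (bilc g c q) (Y q))) => // [q [cq bq]|].
  by rewrite (vecc_reeb cc cq bq).
have sg : smo U (bilc g c).
  by apply: smo_sub ((bilinear_fieldP g).1 bg c cc) => q [].
have sB : smo U (bilc B c).
  by apply: smo_sub ((bilinear_fieldP B).1 bB c cc) => q [].
have sY : smo U Y.
  apply: smoZ => //; last exact: smo_wedge_vector.
  by apply: smf_det => //; apply: smo_sub (jac_smooth cb cc) => q [].
have pos q : U q -> 0 < form2 (bilc g c q) (Y q) (Y q).
  move=> [cq bq]; have [_] : spd (bilc g c q) by apply: bilc_spd => //; exact: metric_spd.
  apply; rewrite scaler_eq0 negb_or; apply/andP; split.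
    by rewrite -unitfE -unitmxE; exact: jac_unit.
  have uJ : jac c (chart_at q) q \in unitmx.
    by apply: jac_unit => //; [exact: compatible_at|exact: chart_at_dom].
  apply: wedge_vector_neq0.
    rewrite /bilc !trmx_mul trmxK mulmxA.
    by rewrite ((form2_skewP _).1 (B_form.2 q)) mulmxN mulNmx.
  rewrite /bilc mxrankMfree ?row_free_unit ?unitmx_tr //.
  by rewrite -mxrank_tr trmx_mul mxrankMfree ?row_free_unit ?unitmx_tr // mxrank_tr.
apply: smoZ => //; apply: smfV => //; last first.
  by apply: smf_sqrt => //; apply: smf_form2.
by move=> q Uq; rewrite gt_eqF // sqrtr_gt0 pos.
Qed.

Lemma reeb_cosymplectic p : exists v, cosymplectic_form (B p) (g p *m (reeb p)^T) v != 0.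
Proof.
apply: wedge_vector_form.
have sB := (form2_skewP _).1 (B_form.2 p).
have V0 := wedge_vector_neq0 sB (B_rank p).
have [_ pg] := metric_spd p g_metric.
rewrite /reeb /normalized scalerA linearZ /= -!scalemxAr mxE mulmxA.
set D := \det _; have D0 : D != 0.
  by rewrite -unitfE -unitmxE; apply: jac_unit;
    [exact: b_compatible|exact: compatible_at|exact: b_dom|exact: chart_at_dom].
have DV0 : D *: wedge_vector (B p) != 0 by rewrite scaler_eq0 negb_or D0.
rewrite !mulf_neq0 //; last by rewrite gt_eqF // pg.
by rewrite invr_eq0 gt_eqF // sqrtr_gt0; exact: pg.
Qed.

End Orientation.

Lemma gauge_cosymplectic (R : realType) n (M : manifold R (2 * n + 1)) :
  orientable M -> has_skew_gauge_solution M (2 * n) -> has_almost_cosymplectic M.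
Proof.
move=> [S [cover compat pos]] [g [_ [_ [theta [mg _ _ [et rt] [st _]]]]]].
have [tB rB] := skew_endomorphism_two_form mg et st.
have [b hb] := choice (fun p => (let: ex_intro2 c Sc cp := cover p in ex_intro _ c (conj Sc cp))
  : exists c, S c /\ cdom c p).
have cb p : compatible (b p) by move=> d ad; exact: compat (hb p).1 ad.
have rB' p : \rank (theta p *m g p) = (2 * n)%N by rewrite rB rt.
have ob p q : cdom (b p) q -> 0 < \det (jac (b q) (b p) q).
  by move=> bq; apply: pos bq; [exact: (hb q).1|exact: (hb p).1|exact: (hb q).2].
have db p := (hb p).2.
pose xi := reeb b g (fun p => theta p *m g p).
exists (fun p => theta p *m g p), (fun p => g p *m (xi p)^T); split=> //.
- by apply: metric_one_form; [case: mg | exact: (reeb_vector_field cb db ob mg tB rB')].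
- by move=> p; exact: (reeb_cosymplectic cb db mg tB rB').
Qed.

(** * The product with a line *)

Section BorderedAlgebra.
Context {R : realType} {m : nat}.
Implicit Types (B F G J : 'M[R]_m) (h eta : 'cV[R]_m).

Lemma bordered_congr B h J : block_mx J 0 0 1%:M *m bordered B h *m
  (block_mx J 0 0 1%:M)^T = bordered (J *m B *m J^T) (J *m h).
Proof.
rewrite /bordered tr_block_mx !mulmx_block !trmx0 trmx1.
by rewrite !(mul0mx, mulmx0, addr0, add0r, mul1mx, mulmx1) mulNmx trmx_mul.
Qed.

Lemma bordered_congr_unit B h J : J \in unitmx -> bordered B h \in unitmx ->
  bordered (J *m B *m J^T) (J *m h) \in unitmx.
Proof.
move=> uJ uO; rewrite -bordered_congr !unitmx_mul unitmx_tr uO !unitmxE.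
by rewrite det_ublock det1 mulr1 -unitmxE uJ.
Qed.

Lemma bordered_submx (A : 'M[R]_(m + 1)) : A^T = - A -> A = bordered (ulsubmx A) (ursubmx A).
Proof.
move=> sA; rewrite /bordered -{1}[A]submxK; congr block_mx.
  by rewrite trmx_ursub sA; apply/matrixP => i j; rewrite !mxE opprK.
apply/matrixP => i j; rewrite !ord1.
move/matrixP/(_ (rshift m 0) (rshift m 0)): sA; rewrite !mxE => /eqP.
by rewrite -addr_eq0 -mulr2n mulrn_eq0 => /eqP.
Qed.

Lemma nondegenerate_unit (A : 'M[R]_m) :
  (forall u, (forall v, form2 A u v = 0) -> u = 0) <-> A \in unitmx.
Proof.
split=> [h|uA u hu].
  rewrite unitmxE unitfE; apply/det0P => -[u u0 uA].
  by move/eqP: u0; apply; apply: h => v; rewrite /form2 uA mul0mx mxE.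
rewrite -(mulmxK uA u); rewrite (_ : u *m A = 0) ?mul0mx //; apply/rowP => j.
by rewrite [RHS]mxE -(hu (delta_mx 0 j)) /form2 trmx_delta -colE [RHS]mxE.
Qed.

(* [F *m eta = 0], and [F *m G - G *m F^T] pairs u with u *m F to
   |u F|^2 + |u|^2 when u is in the kernel of eta. *)
Lemma contact_bordered_unit F G (xi : 'rV[R]_m) eta : spd G -> form1 eta xi = 1 ->
  (forall u, u *m F *m F = - u + form1 eta u *: xi) ->
  bordered (F *m G - G *m F^T) eta \in unitmx.
Proof.
move=> sG ex FF.
have Fv (u : 'rV[R]_m) : u *m F *m F = - u + u *m eta *m xi.
  by rewrite FF; congr (_ + _); rewrite [u *m eta]mx11_scalar mul_scalar_mx.
have eta0 : eta != 0.
  by apply: contra_eq_neq ex => ->; rewrite /form1 mulmx0 mxE eq_sym oner_neq0.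
have xe : xi *m eta = 1%:M by rewrite [LHS]mx11_scalar; congr (_%:M).
have F2 : F *m F = - 1%:M + eta *m xi.
  by apply/row_matrixP => i; rewrite !rowE mulmxA Fv mulmxDr mulmxN mulmx1 mulmxA.
have F2e : F *m (F *m eta) = 0.
  by rewrite mulmxA F2 mulmxDl mulNmx mul1mx -mulmxA xe mulmx1 addNr.
(* F commutes with F^2, hence with eta xi, so F eta = eta k for a scalar k; then F^2 eta = 0 forces
   k^2 = 0. *)
have Fe : F *m eta = 0.
  have c : eta *m xi *m F = F *m eta *m xi.
    by apply: (addrI (- F)); rewrite -{1}[F]mul1mx -mulNmx -mulmxDl -F2 -mulmxA F2 mulmxDr mulmxN mulmx1 mulmxA.
  have [k e1] : exists k : 'M[R]_1, F *m eta = eta *m k.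
    by exists (xi *m F *m eta); rewrite !mulmxA c -mulmxA xe mulmx1.
  have : F *m (F *m eta) = eta *m (k *m k) by rewrite e1 mulmxA e1 -mulmxA.
  rewrite F2e; move: e1; rewrite (mx11_scalar k).
  set a := k 0 0; rewrite -scalar_mxM !mul_mx_scalar => -> /esym/eqP.
  by rewrite scaler_eq0 (negbTE eta0) orbF mulf_eq0 orbb => /eqP ->; rewrite scale0r.
rewrite unitmxE unitfE; apply/det0P => -[x x0].
rewrite -(hsubmxK x) /bordered mul_row_block mulmx0 addr0.
set w := lsubmx x; set t := rsubmx x.
rewrite -(row_mx0 _ 1 m 1) => /eq_row_mx[e1 e2].
have w0 : w = 0.
  apply/eqP/negPn/negP => w0; have [_ pG] := sG.
  have t0 : t *m - eta^T *m (w *m F)^T = 0.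
    by rewrite mulmxN mulNmx -mulmxA -trmx_mul -mulmxA Fe mulmx0 trmx0 mulmx0 oppr0.
  have : (w *m (F *m G - G *m F^T) *m (w *m F)^T) 0 0 = 0.
    move/(congr1 (fun z => z *m (w *m F)^T)): e1.
    by rewrite mulmxDl t0 addr0 mul0mx => ->; rewrite mxE.
  have -> : w *m (F *m G - G *m F^T) *m (w *m F)^T =
      (w *m F) *m G *m (w *m F)^T + w *m G *m w^T.
    rewrite mulmxBr mulmxBl -!mulmxA; congr (_ + _).
    rewrite -trmx_mul -!mulmxA -mulmxN -mulmxN; congr (_ *m (_ *m _)).
    by rewrite (mulmxA w) Fv e2 mul0mx addr0 linearN opprK.
  move=> /eqP; rewrite mxE gt_eqF //.
  by rewrite ltr_pwDr ?pG ?spd_ge0.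
move: x0; rewrite -(hsubmxK x) -/w -/t w0.
move: e1; rewrite w0 mul0mx add0r [t]mx11_scalar mul_scalar_mx => /eqP.
rewrite scaler_eq0 oppr_eq0 trmx_eq0 (negbTE eta0) orbF => /eqP ->.
by rewrite -scalemx1 scale0r row_mx0 eqxx.
Qed.

End BorderedAlgebra.

Section LineProduct.
Context {R : realType} {m : nat}.

Lemma derive_lsub (f : 'rV[R]_m -> R) (x v : 'rV[R]_(m + 1)) :
  'D_v (f \o lsubmx) x = 'D_(lsubmx v) f (lsubmx x).
Proof. by rewrite /derive quotient_lsub. Qed.

Lemma jac_line (T : topologicalType) (c d : chart R m T) (q : T * R) :
  smooth_transition c d -> cdom c q.1 -> cdom d q.1 ->
  jac (line_chart c) (line_chart d) q = block_mx (jac c d q.1) 0 0 1%:M.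
Proof.
move=> cd cp dp; apply/matrixP => i j.
rewrite (jacE i j (line_smooth_transition cd) cp dp).
case: (split_ordP j) => j' ->.
  transitivity ('D_(delta_mx 0 i) ((fun x => cmap d (cinv c x) 0 j') \o lsubmx)
      (cmap (line_chart c) q)).
    by apply: eq_derive => x; rewrite /= row_mxEl.
  rewrite derive_lsub /= row_mxKl.
  case: (split_ordP i) => i' ->.
    rewrite block_mxEul (jacE i' j' cd cp dp).
    have -> // : lsubmx (delta_mx 0 (lshift 1 i')) = delta_mx 0 i' :> 'rV[R]_m.
    by apply/matrixP => a b; rewrite !mxE (inj_eq (@lshift_inj _ _)).
  rewrite block_mxEdl [RHS]mxE.
  have -> : lsubmx (delta_mx 0 (rshift m i')) = 0 :> 'rV[R]_m.
    by apply/matrixP => a b; rewrite !mxE eq_lrshift andbF.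
  by rewrite derive0.
transitivity ('D_(delta_mx 0 i) (fun x : 'rV[R]_(m + 1) => x 0 (rshift m j'))
    (cmap (line_chart c) q)).
  by apply: eq_derive => x; rewrite /= row_mxEr !mxE !ord1 eqxx mulr1n.
rewrite derive_coord mxE eqxx /=; case: (split_ordP i) => i' ->.
  by rewrite block_mxEur eq_rlshift mxE.
by rewrite block_mxEdr !ord1 eqxx mxE.
Qed.

Variable M : manifold R m.
Local Notation W := (product_line M).
Implicit Types (c : chart R m M).

Lemma bilc_line (A : W -> 'M[R]_(m + 1)) c (q : W) : atlas c -> cdom c q.1 ->
  @bilc R (m + 1) W A (line_chart c) q =
  block_mx (jac c (chart_at q.1) q.1) 0 0 1%:M *m A q *m
  (block_mx (jac c (chart_at q.1) q.1) 0 0 1%:M)^T.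
Proof.
move=> ac cq; rewrite /bilc.
have e := @jac_line M c (chart_at q.1) q
  (atlas_smooth ac (chart_at_atlas _)) cq (chart_at_dom _).
by rewrite -e.
Qed.

(** The 2-form B + h /\ dt, with B and h pulled back to the product. *)
Lemma bordered_two_form (B : M -> 'M[R]_m) (h : M -> 'cV[R]_m) :
  two_form B -> one_form h ->
  @two_form R (m + 1) W (fun q => bordered (B q.1) (h q.1)).
Proof.
move=> [bB sB] oh; split; last first.
  by move=> q; apply/form2_skewP/bordered_tr/form2_skewP; exact: sB.
move=> _ [c ac <-] i j k.
have hF : Ckmx k (cimg c) (fun x => bordered (bilc B c (cinv c x)) (covc h c (cinv c x))).
  have oc : open (cimg c) by exact: cimg_open.
  apply: Ckmx_block => //.
  - by move=> a b; exact: (bB c ac a b k).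
  - by move=> a b; exact: (oh c ac a b k).
  - by apply: CkmxN => //; apply: Ckmx_tr => // a b; exact: (oh c ac a b k).
  - exact: Ckmx_cst.
have ol : open (cimg (line_chart c)) by exact: cimg_open.
have sub : cimg (line_chart c) `<=` @lsubmx R 1 m 1 @^-1` cimg c.
  by move=> _ [q cq <-] /=; rewrite row_mxKl; exists q.1.
apply: (Ck_ext ol _ (Ck_subset sub (Ck_lsub (hF i j)))) => x lx /=.
have [cx _] := cimg_inv (sub _ lx).
have := @bilc_line (fun q => bordered (B q.1) (h q.1)) c (cinv (line_chart c) x) ac cx.
by rewrite bordered_congr /bilc /= => ->.
Qed.

End LineProduct.

Lemma symplectic_gauge (R : realType) m (M : manifold R m) :
  has_almost_symplectic M -> has_skew_gauge_solution M m.
Proof.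
move=> [omega [tw nw]]; have [bw sw] := tw.
have uw p : omega p \in unitmx by apply/nondegenerate_unit; exact: nw.
have uc c p : atlas c -> cdom c p -> bilc omega c p \in unitmx.
  move=> /atlas_compatible cc cp.
  have uJ : jac c (chart_at p) p \in unitmx.
    by apply: jac_unit => //; [exact: compatible_at | exact: chart_at_dom].
  by rewrite /bilc !unitmx_mul unitmx_tr uJ uw.
apply: (gauge_solution (Nf := fun c p => invmx (bilc omega c p)) tw).
- move=> c ac; apply: smo_inv; first exact: cdom_open.
    by move=> p; exact: uc.
  by move/bilinear_fieldP: bw; apply; exact: atlas_compatible.
- move=> c p ac cp; have u := uc c p ac cp; split; last by rewrite mulmxV // mul1mx.
  have sB : (bilc omega c p)^T = - bilc omega c p.
    by rewrite bilc_tr /bilc ((form2_skewP _).1 (sw p)) mulmxN mulNmx.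
  rewrite trmx_inv sB; set X := bilc _ _ _ in u *.
  apply: (can_inj (mulKmx u)); rewrite mulmxN mulmxV //.
  by rewrite -[X in X *m _]opprK mulNmx mulmxV // -scaleN1r unitmxZ // unitrN1.
- by move=> p; rewrite mxrank_unit.
Qed.

(** For an arbitrary metric g the bilinear form phi g need not be skew; its antisymmetrization w is
    used instead, and the symplectic form is w + eta /\ dt. *)
Lemma contact_symplectic (R : realType) n (M : manifold R (2 * n + 1)) :
  has_almost_contact M -> has_almost_symplectic (product_line M).
Proof.
move=> [phi [xi [eta [ephi vxi oeta ex phi2]]]].
have [g mg] := riemannian_metric_ex M; have [bg _ _] := mg.
pose w p := phi p *m g p - g p *m (phi p)^T.
have sw p : (w p)^T = - w p.
  have [sg _] := metric_spd p mg.
  by rewrite /w linearB /= !trmx_mul trmxK sg opprB.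
have tw : two_form w.
  split; last by move=> p; apply/form2_skewP.
  apply/bilinear_fieldP => c cc; have oc := cdom_open c.
  have h := smoM oc ((endomorphism_fieldP phi).1 ephi c cc) ((bilinear_fieldP g).1 bg c cc).
  apply: smo_ext oc _ (smoB oc h (smo_tr oc h)) => p cp.
  have [sg _] := metric_spd p mg.
  have cq := compatible_at p; have qq := chart_at_dom p.
  have e : endc phi c p *m bilc g c p = jac c (chart_at p) p *m (phi p *m g p) *m (jac c (chart_at p) p)^T.
    exact: end_bil_congr (jacK cq cc qq cp).
  rewrite e /bilc /w mulmxBr mulmxBl; congr (_ - _).
  by rewrite !trmx_mul trmxK sg !mulmxA.
exists (fun q => bordered (w q.1) (eta q.1)); split; first exact: bordered_two_form.
move=> q; apply/nondegenerate_unit; apply: contact_bordered_unit (phi2 q.1) => //.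
exact: metric_spd.
Qed.

Section BorderedGauge.
Context {R : realType} {m : nat} (M : manifold R m).
Local Notation W := (product_line M).
Implicit Types (c : chart R m M) (p : M).

Lemma smo_ulsub r1 r2 s1 s2 U (F : M -> 'M[R]_(r1 + r2, s1 + s2)) : open U ->
  smo U F -> smo U (fun p => ulsubmx (F p)).
Proof. by move=> oU hF i j; apply: (smf_ext oU _ (hF (lshift r2 i) (lshift s2 j))) => p _; rewrite !mxE. Qed.

Lemma smo_ursub r1 r2 s1 s2 U (F : M -> 'M[R]_(r1 + r2, s1 + s2)) : open U ->
  smo U F -> smo U (fun p => ursubmx (F p)).
Proof. by move=> oU hF i j; apply: (smf_ext oU _ (hF (lshift r2 i) (rshift s1 j))) => p _; rewrite !mxE. Qed.

Lemma bordered_gauge (B : M -> 'M[R]_m) (h : M -> 'cV[R]_m) r : m = r.+1 ->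
  two_form B -> one_form h -> (forall p, bordered (B p) (h p) \in unitmx) ->
  has_skew_gauge_solution M r.
Proof.
move=> mr tB oh uO; have [bB sB] := tB.
have sB' p : (B p)^T = - B p by apply/form2_skewP.
have sBc c p : (bilc B c p)^T = - bilc B c p.
  by rewrite bilc_tr /bilc sB' mulmxN mulNmx.
have uc c p : atlas c -> cdom c p -> bordered (bilc B c p) (covc h c p) \in unitmx.
  move=> /atlas_compatible cc cp; apply: bordered_congr_unit (uO p).
  by apply: jac_unit => //; [exact: compatible_at | exact: chart_at_dom].
apply: (gauge_solution
  (Nf := fun c p => ulsubmx (invmx (bordered (bilc B c p) (covc h c p)))) tB).
- move=> c ac; have oc := cdom_open c; have cc := atlas_compatible ac.
  have := (bilinear_fieldP B).1 bB c cc; have := (one_formP h).1 oh c cc => sh sb.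
  apply: smo_ulsub => //; apply: smo_inv => //; first by move=> p; exact: uc.
  apply: smo_block => //; last exact: smo_cst.
  by apply: smoN => //; exact: smo_tr.
- move=> c p ac cp.
  by have [h1 _ _ _ h2] := bordered_inverse (sBc c p) (uc c p ac cp).
- by move=> p; have := bordered_rank (sB' p) (uO p); move: (\rank _) => k; rewrite mr => -[].
Qed.

Lemma smo_slice r s (F : W -> 'M[R]_(r, s)) c : atlas c ->
  (forall i j, smooth_on (cimg (line_chart c)) (fun x => F (cinv (line_chart c) x) i j)) ->
  smo (cdom c) (fun p => F (p, 0)).
Proof.
move=> ac hF; apply: (smo_chart (atlas_compatible ac)) => //; first exact: cdom_open.
move=> k i j.
have oi : open (cimg c) by exact: cimg_open.
have ol : open (cimg (line_chart c)) by exact: cimg_open.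
pose e (x : 'rV[R]_m) : 'rV[R]_(m + 1) := row_mx x 0.
have he a : Ck k (cimg c) (fun x => e x 0 a).
  case: (split_ordP a) => b ->.
    by apply: Ck_ext oi _ (Ck_coord _ _ b) => x _; rewrite /e row_mxEl.
  by apply: Ck_ext oi _ (Ck_cst _ _ 0) => x _; rewrite /e row_mxEr mxE.
have ec x : cimg c x -> cimg (line_chart c) (e x).
  move=> [p cp <-]; exists (p, 0) => //=.
  by rewrite /e -scalemx1 scale0r.
apply: Ck_ext oi _ (Ck_comp oi ol ec he (hF i j k)) => x _ /=.
by rewrite /e row_mxKl row_mxKr mxE.
Qed.

(** A skew matrix has a zero corner, so the nondegenerate form on the slice t = 0 is automatically
    bordered: B is its restriction to M and h its contraction with d/dt. *)
Lemma gauge_line r : m = r.+1 -> has_skew_gauge_solution W (m + 1) ->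
  has_skew_gauge_solution M r.
Proof.
move=> mr [g [_ [_ [theta [mg _ _ [et rt] [st _]]]]]].
have [tB rB] := skew_endomorphism_two_form mg et st; have [bB sB] := tB.
pose A (q : W) : 'M[R]_(m + 1) := theta q *m g q.
have sA q : (A q)^T = - A q by apply/form2_skewP; exact: sB.
have uA q : A q \in unitmx by rewrite -row_full_unit /row_full rB rt.
pose B (p : M) := ulsubmx (A (p, 0)); pose h (p : M) := ursubmx (A (p, 0)).
have AE p : bordered (B p) (h p) = A (p, 0) by rewrite [RHS]bordered_submx.
have sBp p : (B p)^T = - B p.
  by rewrite /B trmx_ulsub sA; apply/matrixP => i j; rewrite !mxE.
have smA c : atlas c ->
    smo (cdom c) (fun p => bordered (bilc B c p) (covc h c p)).
  move=> ac; have oc := cdom_open c.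
  have al : @atlas R (m + 1) W (line_chart c) by exists c.
  have := @smo_slice _ _ (@bilc R (m + 1) W A (line_chart c)) c ac (bB _ al).
  apply: smo_ext oc _ => p cp.
  by rewrite (@bilc_line _ _ _ A c (p, 0) ac cp) -AE bordered_congr.
apply: (@bordered_gauge B h) => //.
- split; last by move=> p; apply/form2_skewP.
  move=> c ac i j k; have oc := cdom_open c.
  have := smo_ext oc (fun p _ => block_mxKul _ _ _ _) (smo_ulsub oc (smA c ac)).
  by move=> /(_ i j c ac k); rewrite setIid.
- move=> c ac i j k; have oc := cdom_open c.
  have := smo_ext oc (fun p _ => block_mxKur _ _ _ _) (smo_ursub oc (smA c ac)).
  by move=> /(_ i j c ac k); rewrite setIid.
- by move=> p; rewrite AE.
Qed.

End BorderedGauge.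

(** * From almost cosymplectic to almost contact structures *)

Section GeometricMean.
Context {R : realType} {m : nat}.
Implicit Types (G P H J : 'M[R]_m).

(** The geometric mean of G and P, characterized as the positive definite solution H of the Riccati
    equation H G^-1 H = P. *)
Definition gmean G P : 'M[R]_m :=
  sqrtmx G *m sqrtmx (invmx (sqrtmx G) *m P *m invmx (sqrtmx G)) *m sqrtmx G.

Lemma spd_sandwich F P : spd F -> spd P -> spd (F *m P *m F).
Proof. by move=> pF pP; rewrite -{2}(proj1 pF); apply: spd_congr => //; exact: spd_unit. Qed.

Lemma gmeanP G P : spd G -> spd P ->
  spd (gmean G P) /\ gmean G P *m invmx G *m gmean G P = P.
Proof.
move=> pG pP; have [pF FF] := sqrtmxP pG; have uF := spd_unit pF.
rewrite /gmean; set F := sqrtmx G in pF FF uF *.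
have [pS SS] := sqrtmxP (spd_sandwich (spd_inv pF) pP).
move: pS SS; set S := sqrtmx _ => pS SS; split; first exact: spd_sandwich.
have FGF : F *m invmx G *m F = 1%:M.
  have uG := spd_unit pG; apply: (can_inj (mulKmx uF)); rewrite mulmx1.
  by rewrite !mulmxA FF mulmxV // mul1mx.
have -> : F *m S *m F *m invmx G *m (F *m S *m F) = F *m (S *m (F *m invmx G *m F) *m S) *m F.
  by rewrite !mulmxA.
by rewrite FGF mulmx1 SS !mulmxA mulmxV // mul1mx mulmxKV.
Qed.

Lemma gmean_unique G P H : spd G -> spd H -> H *m invmx G *m H = P -> gmean G P = H.
Proof.
move=> pG pH e; have [pF FF] := sqrtmxP pG; have uF := spd_unit pF.
rewrite /gmean; set F := sqrtmx G in pF FF uF *.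
have -> : sqrtmx (invmx F *m P *m invmx F) = invmx F *m H *m invmx F.
  apply: sqrtmx_unique; first exact: spd_sandwich (spd_inv pF) pH.
  rewrite -e -FF; have -> : invmx (F *m F) = invmx F *m invmx F.
    have uFF : F *m F \in unitmx by rewrite unitmx_mul uF.
    apply: (can_inj (mulKmx uFF)); rewrite mulmxV // -!mulmxA (mulmxA F (invmx F)).
    by rewrite mulmxV // mul1mx mulmxV.
  by rewrite !mulmxA.
by rewrite !mulmxA mulmxV // mul1mx mulmxKV.
Qed.

Lemma invmx_mul G H : G \in unitmx -> H \in unitmx -> invmx (G *m H) = invmx H *m invmx G.
Proof.
move=> uG uH; have u : G *m H \in unitmx by rewrite unitmx_mul uG.
apply: (can_inj (mulKmx u)); rewrite mulmxV // -!mulmxA (mulmxA H (invmx H)).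
by rewrite mulmxV // mul1mx mulmxV.
Qed.

(** The square roots in the formula do not commute with congruence, but the Riccati equation is
    invariant and its solution unique. *)
Lemma gmean_congr G P J : spd G -> spd P -> J \in unitmx ->
  gmean (J *m G *m J^T) (J *m P *m J^T) = J *m gmean G P *m J^T.
Proof.
move=> pG pP uJ; have [pH HH] := gmeanP pG pP.
have uT : J^T \in unitmx by rewrite unitmx_tr.
apply: gmean_unique; [exact: spd_congr|exact: spd_congr|].
rewrite !invmx_mul ?unitmx_mul ?uJ ?(spd_unit pG) // -{3}HH !mulmxA mulmxK //.
by rewrite mulmxKV.
Qed.

End GeometricMean.

Section ContactMetric.
Context {R : realType} {m : nat}.
Implicit Types (B G J : 'M[R]_m) (h : 'cV[R]_m) (xi : 'rV[R]_m).

(** When xi h = 1, u - (u h) xi is the projection of u onto ker h along xi; adding h h^T makes xi a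
    unit normal of ker h. *)
Definition split_metric G h xi : 'M[R]_m :=
  (1%:M - h *m xi) *m G *m (1%:M - h *m xi)^T + h *m h^T.

(** The form of minus the square of B G^-1; h h^T restores definiteness in the direction of the
    kernel of B. *)
Definition shape_form B G h : 'M[R]_m := B *m invmx G *m B^T + h *m h^T.

(* With P the shape form and G' the split metric, the metric H solving
   [H G'^-1 H = P] makes B H^-1 the orthogonal factor in the polar
   decomposition of B G'^-1 on the kernel of h. *)
Definition contact_metric B G h xi : 'M[R]_m :=
  gmean (split_metric G h xi) (shape_form B (split_metric G h xi) h).

Lemma sum_of_squares_spd (C G : 'M[R]_m) h : spd G ->
  (forall u : 'rV[R]_m, u *m C = 0 -> u *m h = 0 -> u = 0) -> spd (C *m G *m C^T + h *m h^T).
Proof.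
move=> pG inj; have [sG _] := pG; split.
  by rewrite linearD /= !trmx_mul !trmxK sG mulmxA.
move=> u u0; rewrite mulmxDr mulmxDl mxE.
have -> : u *m (C *m G *m C^T) *m u^T = (u *m C) *m G *m (u *m C)^T.
  by rewrite trmx_mul !mulmxA.
have -> : u *m (h *m h^T) *m u^T = (u *m h) *m (u *m h)^T.
  by rewrite trmx_mul !mulmxA.
have [C0|C0] := eqVneq (u *m C) 0; last first.
  by rewrite ltr_pwDl ?dot_ge0 //; case: pG => _; apply.
rewrite ltr_pwDr ?spd_ge0 // dot_gt0 //.
by apply: contra u0 => /eqP h0; apply/eqP; exact: inj.
Qed.

(** Once B G^-1 and H G^-1 commute, the square of B H^-1 times P equals B G^-1 B, which is - P + h
    h^T; and xi P = h^T rewrites this as (- 1 + h xi) P. *)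
Lemma contact_square (B G P H : 'M[R]_m) h xi :
  spd G -> spd H -> P \in unitmx -> H *m invmx G *m H = P ->
  P = B *m invmx G *m B^T + h *m h^T -> B^T = - B ->
  xi *m B = 0 -> xi *m h = 1%:M -> xi *m G = h^T ->
  B *m invmx H *m (B *m invmx H) = - 1%:M + h *m xi.
Proof.
move=> pG pH uP HGH PE sB xiB xih xiG; have uG := spd_unit pG; have uH := spd_unit pH.
have hG : h^T *m invmx G = xi by rewrite -xiG mulmxK.
have Gh : invmx G *m h = xi^T.
  by rewrite -hG trmx_mul trmxK trmx_inv (proj1 pG).
have Bxi : B *m xi^T = 0.
  by apply: (can_inj (@trmxK _ _ _)); rewrite trmx_mul trmxK sB mulmxN xiB oppr0 trmx0.
(* H G^-1 is a square root of P G^-1, which commutes with B G^-1. The defect D solves a homogeneous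
   equation, brought to Sylvester form by conjugating with the square root F of G^-1. *)
have comm : B *m invmx G *m H = H *m invmx G *m B.
  have [pF FF] := sqrtmxP (spd_inv pG); have uF := spd_unit pF.
  move: (sqrtmx _) pF FF uF => F pF FF uF.
  have [D DE] : exists D, D = B *m invmx G *m H - H *m invmx G *m B by eexists.
  have D0 : H *m invmx G *m D + D *m invmx G *m H = 0.
    have e1 : H *m invmx G *m D = H *m invmx G *m B *m invmx G *m H - P *m invmx G *m B.
      by rewrite DE mulmxBr !mulmxA HGH.
    have e2 : D *m invmx G *m H = B *m invmx G *m P - H *m invmx G *m B *m invmx G *m H.
      by rewrite DE !mulmxBl -HGH !mulmxA.
    have e3 : B *m invmx G *m P = P *m invmx G *m B.
      have bh : B *m invmx G *m h = 0 by rewrite -mulmxA Gh.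
      have hb : h *m h^T *m invmx G *m B = 0 by rewrite -(mulmxA h) hG -mulmxA xiB mulmx0.
      by rewrite PE sB mulmxDr !mulmxDl !(mulmxN, mulNmx, mulmxA) bh hb mul0mx.
    by rewrite e1 e2 e3 addrA subrK subrr.
  have : F *m D *m F = 0.
    apply: (@sylvester_inj _ _ (F *m H *m F) (F *m H *m F)); try exact: spd_sandwich.
    have -> : F *m H *m F *m (F *m D *m F) = F *m (H *m (F *m F) *m D) *m F by rewrite !mulmxA.
    have -> : F *m D *m F *m (F *m H *m F) = F *m (D *m (F *m F) *m H) *m F by rewrite !mulmxA.
    by rewrite FF -mulmxDl -mulmxDr D0 mulmx0 mul0mx.
  move=> FDF; apply/eqP; rewrite -subr_eq0 -DE; apply/eqP.
  by rewrite -(mulKmx uF D) -(mulmxK uF (F *m D)) FDF mul0mx mulmx0.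
have e : invmx H *m B = invmx G *m B *m invmx H *m G.
  apply: (can_inj (mulKmx uH)); rewrite mulKVmx //.
  by rewrite !mulmxA -comm mulmxK // mulmxKV.
have PV : invmx H *m G *m invmx H *m P = 1%:M.
  by rewrite -HGH !mulmxA mulmxKV // mulmxK // mulVmx.
apply: (can_inj (mulmxK uP)).
rewrite mulmxA -(mulmxA B) e.
have -> : B *m (invmx G *m B *m invmx H *m G) *m invmx H *m P =
  B *m invmx G *m B *m (invmx H *m G *m invmx H *m P) by rewrite !mulmxA.
rewrite PV mulmx1 mulmxDl mulNmx mul1mx PE sB mulmxN.
rewrite mulmxDr mulmxN -!mulmxA (mulmxA xi B) xiB mul0mx mulmx0 oppr0 add0r.
by rewrite (mulmxA xi h) xih mul1mx !mulmxA opprD opprK addrNK.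
Qed.

Variables (B G N : 'M[R]_m) (h : 'cV[R]_m) (xi : 'rV[R]_m).
Hypotheses (pG : spd G) (sB : B^T = - B) (xiB : xi *m B = 0) (xih : xi *m h = 1%:M)
  (BN : B *m N + h *m xi = 1%:M).

Let G' := split_metric G h xi.
Let P := shape_form B G' h.
Let H := contact_metric B G h xi.

Lemma split_metric_spd : spd G'.
Proof.
apply: sum_of_squares_spd => // u; rewrite mulmxBr mulmx1 => /eqP.
by rewrite subr_eq0 => /eqP e uh; rewrite e mulmxA uh mul0mx.
Qed.

Lemma shape_form_spd : spd P.
Proof.
apply: sum_of_squares_spd; first exact: spd_inv split_metric_spd.
by move=> u uB uh; rewrite -[u]mulmx1 -BN mulmxDr !mulmxA uB uh !mul0mx addr0.
Qed.

Lemma contact_metric_spd : spd H.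
Proof. exact: (gmeanP split_metric_spd shape_form_spd).1. Qed.

Lemma contact_metric_square :
  B *m invmx H *m (B *m invmx H) = - 1%:M + h *m xi.
Proof.
have pG' := split_metric_spd; have pP := shape_form_spd.
have [pH HGH] := gmeanP pG' pP.
have xiG : xi *m G' = h^T.
  have e : xi *m (1%:M - h *m xi) = 0 by rewrite mulmxBr mulmx1 mulmxA xih mul1mx subrr.
  by rewrite /G' /split_metric mulmxDr !mulmxA e xih !mul0mx add0r mul1mx.
by apply: (contact_square (G := G') (P := P)) => //; exact: spd_unit.
Qed.

End ContactMetric.

Section ContactMetricChange.
Context {R : realType} {m : nat}.
Implicit Types (B G J K : 'M[R]_m) (h : 'cV[R]_m) (xi : 'rV[R]_m).

Lemma split_metric_congr J K G h xi : J *m K = 1%:M -> K *m J = 1%:M ->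
  split_metric (J *m G *m J^T) (J *m h) (xi *m K) = J *m split_metric G h xi *m J^T.
Proof.
move=> JK KJ; rewrite /split_metric.
have -> : 1%:M - J *m h *m (xi *m K) = J *m (1%:M - h *m xi) *m K.
  by rewrite mulmxBr mulmx1 mulmxBl JK !mulmxA.
move: (1%:M - h *m xi) => Pi.
rewrite mulmxDr mulmxDl; congr (_ + _); last by rewrite trmx_mul !mulmxA.
have -> : J *m Pi *m K *m (J *m G *m J^T) *m (J *m Pi *m K)^T =
    J *m Pi *m (K *m J) *m G *m (K *m J)^T *m Pi^T *m J^T.
  by rewrite !trmx_mul !mulmxA.
by rewrite KJ trmx1 !mulmx1 !mulmxA.
Qed.

Lemma shape_form_congr J B G h : J \in unitmx -> G \in unitmx ->
  shape_form (J *m B *m J^T) (J *m G *m J^T) (J *m h) = J *m shape_form B G h *m J^T.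
Proof.
move=> uJ uG; rewrite /shape_form mulmxDr mulmxDl; congr (_ + _).
  rewrite !invmx_mul ?unitmx_mul ?uJ ?unitmx_tr // !trmx_mul trmxK !mulmxA.
  by rewrite mulmxK ?unitmx_tr // mulmxKV.
by rewrite trmx_mul !mulmxA.
Qed.

(** Two equations determine xi, which makes this block of the inverse transform as a vector under
    changes of chart. *)
Lemma bordered_reeb_unique B h xi : B^T = - B -> bordered B h \in unitmx ->
  xi *m B = 0 -> xi *m h = 1%:M -> dlsubmx (invmx (bordered B h)) = xi.
Proof.
move=> sB uO xB xh; have [_ e yB yh _] := bordered_inverse sB uO.
set y := dlsubmx _ in e yB yh *.
apply/eqP; rewrite -subr_eq0 -[y - xi]mulmx1 -e mulmxDr !mulmxA !mulmxBl.
by rewrite yB xB yh xh !subrr addr0.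
Qed.

End ContactMetricChange.

Section ContactFromCosymplectic.
Context {R : realType} {m : nat} (M : manifold R m).
Implicit Types (c : chart R m M) (p : M) (U : set M).

Lemma smo_sqrtmx r U (S : M -> 'M[R]_r) : open U -> (forall p, U p -> spd (S p)) ->
  smo U S -> smo U (fun p => sqrtmx (S p)).
Proof.
move=> oU pS /smoP hS; apply/smoP => c ac k.
have oi : open (cmap c @` (cdom c `&` U)) by exact: open_chart_image.
apply: (Ckmx_sqrt oi (S := S \o cinv c)); last exact: hS.
by move=> _ [p [cp Up] <-] /=; rewrite cmapK //; exact: pS.
Qed.

Lemma smo_gmean r U (G P : M -> 'M[R]_r) : open U ->
  (forall p, U p -> spd (G p)) -> (forall p, U p -> spd (P p)) ->
  smo U G -> smo U P -> smo U (fun p => gmean (G p) (P p)).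
Proof.
move=> oU pG pP hG hP.
have pF p : U p -> spd (sqrtmx (G p)) by move=> Up; case: (sqrtmxP (pG p Up)).
have hF : smo U (fun p => sqrtmx (G p)) by exact: smo_sqrtmx.
have hV : smo U (fun p => invmx (sqrtmx (G p))).
  by apply: smo_inv => // p Up; exact/spd_unit/pF.
have hS : smo U (fun p => sqrtmx (invmx (sqrtmx (G p)) *m P p *m invmx (sqrtmx (G p)))).
  apply: smo_sqrtmx => //; last by do 2!(apply: smoM => //).
  by move=> p Up; apply: spd_sandwich (pP p Up); exact/spd_inv/pF.
by rewrite /gmean; do 2!(apply: smoM => //).
Qed.

Lemma smo_dlsub r1 r2 s1 s2 U (F : M -> 'M[R]_(r1 + r2, s1 + s2)) : open U ->
  smo U F -> smo U (fun p => dlsubmx (F p)).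
Proof. by move=> oU hF i j; apply: (smf_ext oU _ (hF (rshift r1 i) (lshift s2 j))) => p _; rewrite !mxE. Qed.

Variables (B : M -> 'M[R]_m) (h : M -> 'cV[R]_m) (g : M -> 'M[R]_m).
Hypotheses (tB : two_form B) (oh : one_form h)
  (uO : forall p, bordered (B p) (h p) \in unitmx) (mg : riemannian_metric g).

Let xi p := dlsubmx (invmx (bordered (B p) (h p))).
Let N p := ulsubmx (invmx (bordered (B p) (h p))).
Let H p := contact_metric (B p) (g p) (h p) (xi p).

Let sB p : (B p)^T = - B p.
Proof. by apply/form2_skewP; case: tB. Qed.

Let xiB p : xi p *m B p = 0.
Proof. by case: (bordered_inverse (sB p) (uO p)). Qed.

Let xih p : xi p *m h p = 1%:M.
Proof. by case: (bordered_inverse (sB p) (uO p)). Qed.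

Let BN p : B p *m N p + h p *m xi p = 1%:M.
Proof. by case: (bordered_inverse (sB p) (uO p)). Qed.

Let vecc_xi c p : compatible c -> cdom c p ->
  vecc xi c p = dlsubmx (invmx (bordered (bilc B c p) (covc h c p))).
Proof.
move=> cc cp; have cq := compatible_at p; have qq := chart_at_dom p.
have JK := jacK cq cc qq cp; symmetry; rewrite /vecc /bilc /covc.
have uJ : jac c (chart_at p) p \in unitmx by exact: jac_unit.
move: (jac c _ _) (jac _ c _) JK uJ => J K KJ uJ.
apply: bordered_reeb_unique.
- by rewrite !trmx_mul trmxK sB mulNmx mulmxN mulmxA.
- exact: bordered_congr_unit.
- by rewrite -!mulmxA (mulmxA K) KJ mul1mx mulmxA xiB mul0mx.
- by rewrite -mulmxA (mulmxA K) KJ mul1mx xih.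
Qed.

Let unit_c c p : compatible c -> cdom c p -> bordered (bilc B c p) (covc h c p) \in unitmx.
Proof.
move=> cc cp; apply: bordered_congr_unit (uO p).
by apply: jac_unit => //; [exact: compatible_at | exact: chart_at_dom].
Qed.

Let smo_xi c : compatible c -> smo (cdom c) (vecc xi c).
Proof.
move=> cc; have oc := cdom_open c.
apply: (smo_ext oc (fun p cp => esym (vecc_xi cc cp))).
have hB := (bilinear_fieldP B).1 tB.1 c cc; have hh := (one_formP h).1 oh c cc.
apply: smo_dlsub => //; apply: smo_inv => // [p cp|].
  exact: unit_c.
apply: smo_block => //; last exact: smo_cst.
by apply: smoN => //; exact: smo_tr.
Qed.

Let pH p : spd (H p).
Proof. by apply: (contact_metric_spd (N := N p)) => //; exact: metric_spd. Qed.

(** Every ingredient of the metric is natural under changes of basis, so its components in a chart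
    come from those of B, g, h and xi there, where smoothness is visible. *)
Let bilc_H c p : compatible c -> cdom c p ->
  bilc H c p = contact_metric (bilc B c p) (bilc g c p) (covc h c p) (vecc xi c p).
Proof.
move=> cc cp; have cq := compatible_at p; have qq := chart_at_dom p.
have KJ := jacK cq cc qq cp; have JK := jacK cc cq cp qq; rewrite /vecc /bilc /covc.
have uJ : jac c (chart_at p) p \in unitmx by exact: jac_unit.
move: (jac c _ _) (jac _ c _) JK KJ uJ => J K JK KJ uJ.
have pg := metric_spd p mg.
have ps : spd (split_metric (g p) (h p) (xi p)) by exact: split_metric_spd.
rewrite /H /contact_metric split_metric_congr // shape_form_congr //; last exact: spd_unit.
by rewrite gmean_congr //; apply: (shape_form_spd (N := N p)).
Qed.

Let bH : bilinear_field H.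
Proof.
have [bg _ _] := mg.
apply/bilinear_fieldP => c cc; have oc := cdom_open c.
apply: (smo_ext oc (fun p cp => esym (bilc_H cc cp))).
have hB := (bilinear_fieldP B).1 tB.1 c cc; have hh := (one_formP h).1 oh c cc.
have hg := (bilinear_fieldP g).1 bg c cc; have hx := smo_xi cc.
have sBc p : (bilc B c p)^T = - bilc B c p by rewrite bilc_tr /bilc sB mulmxN mulNmx.
pose X p := bordered (bilc B c p) (covc h c p).
have uX p : cdom c p -> X p \in unitmx.
  exact: unit_c.
have pg p : cdom c p -> spd (bilc g c p).
  by move=> cp; apply: bilc_spd => //; exact: metric_spd.
have facts p : cdom c p ->
    spd (split_metric (bilc g c p) (covc h c p) (vecc xi c p)) /\
    spd (shape_form (bilc B c p) (split_metric (bilc g c p) (covc h c p) (vecc xi c p)) (covc h c p)).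
  move=> cp; rewrite vecc_xi //; have [_ e1 e2 e3 _] := bordered_inverse (sBc p) (uX p cp).
  by split; [apply: split_metric_spd => //; exact: pg|apply: shape_form_spd e1 => //; exact: pg].
have hs : smo (cdom c) (fun p => split_metric (bilc g c p) (covc h c p) (vecc xi c p)).
  have hPi : smo (cdom c) (fun p => 1%:M - covc h c p *m vecc xi c p).
    by apply: smoB => //; [exact: smo_cst|exact: smoM].
  by apply: smoD => //; apply: smoM => //; [exact: smoM|exact: smo_tr|exact: smo_tr].
apply: smo_gmean => //; try by move=> p /facts[].
apply: smoD => //; apply: smoM => //; try exact: smo_tr.
by apply: smoM => //; apply: smo_inv => // p /facts[/spd_unit].
Qed.

Lemma contact_structure : exists (phi : M -> 'M[R]_m) (zeta : M -> 'rV[R]_m),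
  [/\ endomorphism_field phi, vector_field zeta,
      forall p, form1 (h p) (zeta p) = 1 &
      forall p u, u *m phi p *m phi p = - u + form1 (h p) u *: zeta p].
Proof.
exists (fun p => B p *m invmx (H p)), xi; split.
- apply/endomorphism_fieldP => c cc; have oc := cdom_open c.
  have hu p : cdom c p -> bilc H c p \in unitmx by move=> cp; apply: spd_unit; exact: bilc_spd.
  have hV := smo_inv oc hu ((bilinear_fieldP H).1 bH c cc).
  apply: smo_ext oc _ (smoM oc ((bilinear_fieldP B).1 tB.1 c cc) hV) => p cp.
  by rewrite endc_musical //; exact: spd_unit.
- by apply/vector_fieldP => c; exact: smo_xi.
- by move=> p; rewrite /form1 xih mxE.
- move=> p u; rewrite -mulmxA (contact_metric_square _ (sB p) (xiB p) (xih p) (BN p)); last exact: metric_spd.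
  rewrite mulmxDr mulmxN mulmx1; congr (_ + _).
  by rewrite mulmxA /form1 {1}[u *m h p]mx11_scalar mul_scalar_mx.
Qed.

End ContactFromCosymplectic.

Lemma cosymplectic_contact (R : realType) n (M : manifold R (2 * n + 1)) :
  has_almost_cosymplectic M -> has_almost_contact M.
Proof.
move=> [B [h [tB oh nz]]]; have [g mg] := riemannian_metric_ex M.
have uO p : bordered (B p) (h p) \in unitmx.
  have [v nzv] := nz p; apply: cosymplectic_bordered nzv.
  by apply/form2_skewP; case: tB.
have [phi [xi [ephi vxi hxi phi2]]] := contact_structure tB oh uO mg.
by exists phi, xi, h.
Qed.

Theorem corollary3p2 (R : realType) (n : nat) (M : manifold R (2 * n + 1))
  (M_orientable : orientable M) :
  [<-> (* (1) *) has_skew_gauge_solution M (2 * n);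
       (* (2) *) has_almost_cosymplectic M;
       (* (2'), almost contact *) has_almost_contact M;
       (* (3) *) has_almost_symplectic (product_line M);
       (* (4) *) has_skew_gauge_solution (product_line M) (2 * n + 2)].
Proof.
have W_dim : (2 * n + 2 = (2 * n + 1) + 1)%N by rewrite -addnA.
tfae.
- exact: gauge_cosymplectic.
- exact: cosymplectic_contact.
- exact: contact_symplectic.
- by rewrite W_dim; exact: symplectic_gauge.
- by rewrite W_dim; apply: gauge_line; rewrite addn1.
Qed.
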